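(* Let $\mathcal{A}$ be a unital Banach algebra with unit $\mathbf{e}$, $\omega$ a weight on $\mathbb{R}$, and let $f\in L^1(\mathbb{R},\omega,\mathcal{A})$ be such that $\mathbf{e}+\int_{\mathbb{R}} f(x)e^{itx}\,dx$ is left invertible (respectively, right invertible, invertible) in $\mathcal{A}$ for all $t\in\mathbb{R}$. Then there is a weight $\nu$ on $\mathbb{R}$ and $g\in L^1(\mathbb{R},\nu,\mathcal{A})$ such that $1\leq\nu\leq\omega$, $\nu$ is constant if and only if $\omega$ is constant, and $\mathbf{1}+g$ is a left inverse (respectively, right inverse, inverse) of $\mathbf{1}+f$ (in $L^1(\mathbb{R},\nu,\mathcal{A})_{\mathbf{1}}$). In particular, if $\omega$ is admissible, then $\mathbf{1}+f$ is left invertible (respectively, right invertible, invertible) in $L^1(\mathbb{R},\omega,\mathcal{A})_{\mathbf{1}}$.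
   Context: All algebras are complex. A weight on $\mathbb{R}$ is a Borel measurable map $\omega:\mathbb{R}\to[1,\infty)$ with $\omega(x+y)\leq\omega(x)\omega(y)$ for all $x,y\in\mathbb{R}$. Put $\rho_{1,\omega}=\sup\{\log\omega(x)^{1/x}:x<0\}$ and $\rho_{2,\omega}=\inf\{\log\omega(x)^{1/x}:x>0\}$; $\omega$ is admissible if $\rho_{1,\omega}=0=\rho_{2,\omega}$. $L^1(\mathbb{R},\omega,\mathcal{A})$ is the Banach algebra of (classes of) functions $f:\mathbb{R}\to\mathcal{A}$ with $\|f\|_\omega=\int_{\mathbb{R}}\|f(x)\|\omega(x)\,dx<\infty$, with convolution product $(f\star g)(x)=\int_{\mathbb{R}}f(x-t)g(t)\,dt$. $L^1(\mathbb{R},\omega,\mathcal{A})_{\mathbf{1}}$ is its unitization, obtained by adjoining a unit $\mathbf{1}$. *)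

(* Defs.v *)
From HB Require Import structures.
From mathcomp Require Import all_boot all_order all_algebra.
From mathcomp Require Import complex.
From mathcomp Require Import all_classical all_reals all_analysis.

Set Implicit Arguments.
Unset Strict Implicit.
Unset Printing Implicit Defensive.

Import Order.TTheory GRing.Theory Num.Theory.
Import numFieldNormedType.Exports.

Local Open Scope classical_set_scope.
Local Open Scope ring_scope.
Local Open Scope complex_scope.

(* The product and the unit are fields of their own because a hierarchy joining
   [GRing.Algebra] and [CompleteNormedModule] clashes with [Num.NumDomain].
   Neither [bone != 0] nor [`|bone| = 1] is imposed. *)
HB.mixin Record isUnitalBanachAlgebra (K : numFieldType) A
    of CompleteNormedModule K A := {
  bmul : A -> A -> A;
  bone : A;
  bmulA : associative bmul;
  bmul1l : left_id bone bmul;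
  bmul1r : right_id bone bmul;
  bmulDl : left_distributive bmul +%R;
  bmulDr : right_distributive bmul +%R;
  bscalerAl : forall (c : K) (x y : A), c *: bmul x y = bmul (c *: x) y;
  bscalerAr : forall (c : K) (x y : A), c *: bmul x y = bmul x (c *: y);
  ler_norm_bmul : forall x y : A, `|bmul x y| <= `|x| * `|y|
}.

#[short(type="unitalBanachAlgType")]
HB.structure Definition UnitalBanachAlgebra (K : numFieldType) :=
  { A of CompleteNormedModule K A & isUnitalBanachAlgebra K A }.

(* [ueq] is the equality of the ambient algebra; it is a parameter because the
   elements of L^1 below are functions considered up to a.e. equality.
   [is_inverse LeftInv ueq umul uone v u] reads: v is a left inverse of u. *)
Variant inverse_kind := LeftInv | RightInv | TwoSidedInv.

Definition is_inverse (k : inverse_kind) (T : Type) (ueq : T -> T -> Prop)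
    (umul : T -> T -> T) (uone : T) (v u : T) : Prop :=
  match k with
  | LeftInv => ueq (umul v u) uone
  | RightInv => ueq (umul u v) uone
  | TwoSidedInv => ueq (umul v u) uone /\ ueq (umul u v) uone
  end.

Definition invertible_in (R : realType) (A : unitalBanachAlgType R[i])
    (k : inverse_kind) (a : A) : Prop :=
  exists b : A, is_inverse k eq bmul bone b a.

Section Bochner.
Variables (R : realType) (A : completeNormedModType R[i]).
Implicit Types (f s : R -> A).

Local Notation mu := (@lebesgue_measure R).

(* In a normed module over [R[i]] the norm takes values in [R[i]]. *)
Definition rnorm (a : A) : R := complex.Re `|a|.

Definition simple_function s : Prop :=
  finite_set (range s) /\
  (forall a : A, measurable (s @^-1` [set a] : set (measurableTypeR R))).

Definition integrable_simple_function s : Prop :=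
  simple_function s /\
  (forall a : A, a != 0 -> (mu (s @^-1` [set a]) < +oo)%E).

(* The (possibly infinite) measure of the fibre over 0 is multiplied by 0. *)
Definition simple_integral s : A :=
  \sum_(a \in [set: A]) (fine (mu (s @^-1` [set a])))%:C *: a.

Definition strongly_measurable f : Prop :=
  exists s : nat -> R -> A, (forall n, simple_function (s n)) /\
    (forall x, s n x @[n --> \oo] --> f x).

Definition is_bochner_integral f (v : A) : Prop :=
  strongly_measurable f /\
  exists s : nat -> R -> A,
    [/\ forall n, integrable_simple_function (s n),
        (\int[mu]_x (rnorm (f x - s n x))%:E)%E @[n --> \oo] --> 0%E
      & simple_integral (s n) @[n --> \oo] --> v].

(* Equal to 0 when f is not Bochner integrable. *)
Definition bochner_integral f : A := xget 0 [set v | is_bochner_integral f v].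

Definition ae_equal f g : Prop := {ae mu, forall x, f x = g x}.

(* Membership of the class of f; every a.e. class of strongly
   Lebesgue-measurable functions has a representative which is an everywhere
   limit of Borel simple functions, as required here. *)
Definition weighted_L1 (w : R -> R) f : Prop :=
  strongly_measurable f /\ (\int[mu]_x (rnorm (f x) * w x)%:E < +oo)%E.

Definition cis (t : R) : R[i] := cos t +i* sin t.

Definition fourier f (t : R) : A :=
  bochner_integral (fun x => cis (t * x) *: f x).

End Bochner.

Section Weight.
Variable R : realType.
Implicit Types w : R -> R.

Definition weight w : Prop :=
  [/\ measurable_fun [set: measurableTypeR R]
       (w : measurableTypeR R -> measurableTypeR R),
      forall x, 1 <= w x
    & forall x y, w (x + y) <= w x * w y].

Definition constant_fun w : Prop := exists c, forall x, w x = c.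

Definition rho1 w : R := sup [set ln (w x `^ x^-1) | x in [set x | x < 0]].
Definition rho2 w : R := inf [set ln (w x `^ x^-1) | x in [set x | 0 < x]].

Definition admissible w : Prop := rho1 w = 0 /\ rho2 w = 0.

End Weight.

Section Unitization.
Variables (R : realType) (A : unitalBanachAlgType R[i]).
Implicit Types (f g : R -> A).

Definition convolution f g (x : R) : A :=
  bochner_integral (fun t => bmul (f (x - t)) (g t)).

(* The pair (l, f) stands for l 1 + f. *)
Definition unitization : Type := (R[i] * (R -> A))%type.
Implicit Types u v : unitization.

Definition in_unitization (w : R -> R) u : Prop := weighted_L1 w u.2.

Definition unitization_eq u v : Prop := u.1 = v.1 /\ ae_equal u.2 v.2.

Definition unitization_one : unitization := (1, fun=> 0).

Definition one_plus f : unitization := (1, f).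

Definition unitization_mul u v : unitization :=
  (u.1 * v.1,
   fun x => u.1 *: v.2 x + v.1 *: u.2 x + convolution u.2 v.2 x).

Definition inverse_in_unitization (w : R -> R) (k : inverse_kind) v u : Prop :=
  [/\ in_unitization w v, in_unitization w u
    & is_inverse k unitization_eq unitization_mul unitization_one v u].

Definition invertible_in_unitization (w : R -> R) (k : inverse_kind) u : Prop :=
  exists v, inverse_in_unitization w k v u.

End Unitization.

(* Main.v *)
(* Wiener's theorem is first proved for the weight 1, by localization.  Near a
   frequency t0 with b (e + f^(t0)) = e, multiply e + f on the left by V_d b,
   where V_d is a de la Vallee Poussin kernel equal to 1 in frequency on [-d, d]
   and modulated to t0; since V_d b * f is close to V_d b f^(t0) for small d, the
   product is V_d e + H with H of norm < 1.  As F_d * V_d = F_d for the Fejer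
   kernel F_d, a Neumann series gives x with x * (1 + f) = F_d y for every y, and
   d can be chosen uniformly for t0 in a compact set.  Finitely many modulated
   F_d add up to a kernel K with K * F_a = F_a, and F_a * f is close to f for
   large a, so a last Neumann series solves x * (1 + f) = y.

   For a general weight w, let nu_e be the infimal convolution of w and
   exp (e |x|).  It is a continuous weight with 1 <= nu_e <= w and tends to 1
   as e -> 0.  Truncating the inverse 1 + g found in L^1 where w is large gives
   1 + g' with g' in L^1(w) and (1 + g')(1 + f) = 1 + h, where h is in L^1(w) and
   is small in L^1; by dominated convergence its nu_e-norm is < 1 for small e,
   and 1 + h is inverted by a Neumann series in L^1(nu_e).  If w is unbounded,
   then nu_e is not constant; if w is bounded, w itself can be used.  An admissible w is
   O(exp (e |x|)) for all e > 0, hence O(nu_e).  Right inverses are left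
   inverses over the opposite algebra. *)
Require Import Defs.
From HB Require Import structures.
From mathcomp Require Import all_boot all_order all_algebra.
From mathcomp Require Import complex.
From mathcomp Require Import all_classical all_reals all_analysis.
From mathcomp Require Import measurable_realfun lra ring.

Set Implicit Arguments.
Unset Strict Implicit.
Unset Printing Implicit Defensive.

Import Order.TTheory GRing.Theory Num.Theory.
Import numFieldNormedType.Exports.

Local Open Scope classical_set_scope.
Local Open Scope ring_scope.
Local Open Scope complex_scope.

(** * Invariance of Lebesgue measure *)

(** The algebra A is not commutative, so characters and maximal ideals are no help, and L^1 has no
    unit in which an inverse could be sought. The object studied instead is the set of all y in L^1
    of the form x * (1 + f): it is stable under sums and under left multiplication by L^1, and it
    has to be everything. Kernels enter as scalar functions times the unit of A, hence commute with
    all of L^1; this lets a kernel pass through the solution of a Neumann series. Identities such as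
    F_d * V_d = F_d would follow from injectivity of the Fourier transform; they are obtained
    instead by writing the Fejer kernel as an average of cosines, on which an even kernel acts by
    multiplication with its transform. The weighted step cannot be done in L^1(w) itself: w may grow
    exponentially, and h is small only in L^1. Since nu_e depends only on w and e, and every small e
    works, the left and the right construction can share one weight. *)

Section LebesgueInvariance.
Variable R : realType.
Local Notation mu := (@lebesgue_measure R).
Local Notation RM := (measurableTypeR R).

Lemma measurable_reflect (x : R) :
  measurable_fun [set: RM] (fun t : RM => x - t : RM).
Proof. exact: measurable_funB. Qed.

(** Lebesgue measure is characterized by its values on the intervals []a, b]]; reflection turns them
    into [[x - b, x - a[], of the same length. *)
Lemma lebesgue_measure_reflect (x : R) (E : set RM) : measurable E ->
  mu ((fun t => x - t) @^-1` E) = mu E.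
Proof.
move=> mE.
have mf := measurable_reflect x.
rewrite -[LHS]/(pushforward mu (fun t : RM => x - t : RM) E).
apply/esym/lebesgue_measure_unique => //= _ [[a b]] _ <-.
rewrite /pushforward (_ : _ @^-1` _ = `[x - b, x - a[%classic); last first.
  by apply/seteqP; split=> t /=; rewrite !in_itv/=; lra.
rewrite !lebesgue_measure_itv/= !lte_fin ltrD2l ltrN2.
by case: ifP => // _; rewrite -!EFinD; congr EFin; ring.
Qed.

Lemma measurable_scale (b : R) :
  measurable_fun [set: RM] (fun t : RM => b * t : RM).
Proof. exact: mulrl_measurable. Qed.

Lemma lebesgue_measure_scale (b : R) (b0 : 0 < b) (E : set RM) : measurable E ->
  (b%:E * mu ((fun t => b * t)%R @^-1` E))%E = mu E.
Proof.
move=> mE.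
have mf := measurable_scale b.
pose bn := NngNum (ltW b0).
pose m : {measure set (measurableTypeR R) -> \bar R} :=
  mscale bn (pushforward mu (fun t : measurableTypeR R => b * t : measurableTypeR R)).
rewrite -[LHS]/(m mf E); apply/esym.
apply: lebesgue_measure_unique => //= _ [[c d]] _ <-.
rewrite /m /= /mscale/= /pushforward (_ : _ @^-1` _ = `](c / b), (d / b)]%classic); last first.
  apply/seteqP; split=> t /=; rewrite !in_itv/=.
    by rewrite ltr_pdivrMr// ler_pdivlMr// ![b * t]mulrC.
  by rewrite ltr_pdivrMr// ler_pdivlMr// ![b * t]mulrC.
rewrite !lebesgue_measure_itv/= !lte_fin ltr_pM2r ?invr_gt0//.
case: ifP => // _; last by rewrite mule0.
by rewrite -!EFinD -EFinM -mulrBl mulrC divfK ?gt_eqF.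
Qed.

Local Open Scope ereal_scope.

Lemma ge0_integral_reflect (x : R) (f : RM -> \bar R) :
  measurable_fun [set: RM] f -> (forall t, 0 <= f t) ->
  \int[mu]_t f (x - t)%R = \int[mu]_t f t.
Proof.
move=> mf f0; have mr := measurable_reflect x.
have E : \int[pushforward mu (fun t : RM => (x - t)%R : RM)]_t f t =
    \int[mu]_t f (x - t)%R.
  by rewrite (@ge0_integral_pushforward _ _ RM RM R _ mr mu _ _ measurableT mf).
rewrite -E; apply: eq_measure_integral => A mA _.
exact: lebesgue_measure_reflect.
Qed.

(** A translation is the composite of the reflections [t -> - t] and [t -> y - t]. *)
Lemma ge0_integral_shift (y : R) (f : RM -> \bar R) :
  measurable_fun [set: RM] f -> (forall t, 0 <= f t) ->
  \int[mu]_t f (t - y)%R = \int[mu]_t f t.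
Proof.
move=> mf f0; rewrite -[RHS](ge0_integral_reflect 0)//.
rewrite -[RHS](ge0_integral_reflect y)//.
  by apply: eq_integral => t _; congr f; rewrite sub0r opprB.
exact: (measurableT_comp mf (measurable_reflect 0)).
Qed.

Lemma ge0_integral_scale (b : R) (f : RM -> \bar R) : (0 < b)%R ->
  measurable_fun [set: RM] f -> (forall t, 0 <= f t) ->
  \int[mu]_t f (b * t)%R = b^-1%:E * \int[mu]_t f t.
Proof.
move=> b0 mf f0; have mr := measurable_scale b.
pose bn := NngNum (ltW b0).
pose m : {measure set (measurableTypeR R) -> \bar R} :=
  mscale bn (pushforward mu (fun t : measurableTypeR R => b * t : measurableTypeR R)%R).
have E : \int[m mr]_t f t = b%:E * \int[mu]_t f (b * t)%R.
  by rewrite ge0_integral_mscale//= (@ge0_integral_pushforward _ _ RM RM R _ mr mu _ _ measurableT mf).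
have -> : \int[mu]_t f t = \int[m mr]_t f t.
  apply: eq_measure_integral => A mA _.
  exact/esym/lebesgue_measure_scale.
by rewrite E muleA -EFinM mulVf ?gt_eqF// mul1e.
Qed.

Lemma integral_reflect (x : R) (f : RM -> \bar R) :
  measurable_fun [set: RM] f ->
  \int[mu]_t f (x - t)%R = \int[mu]_t f t.
Proof.
move=> mf; rewrite integralE [RHS]integralE.
congr (_ - _).
  have /= <- := @ge0_integral_reflect x f^\+ (measurable_funepos mf) (fun=> funepos_ge0 _ _).
  by apply: eq_integral => t _; rewrite !funeposE.
have /= <- := @ge0_integral_reflect x f^\- (measurable_funeneg mf) (fun=> funeneg_ge0 _ _).
by apply: eq_integral => t _; rewrite !funenegE.
Qed.

End LebesgueInvariance.

(** * Strong measurability *)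

Section RNorm.
Variables (R : realType) (A : completeNormedModType R[i]).
Implicit Types a b : A.

Lemma rnormE a : `|a| = (rnorm a)%:C.
Proof. by rewrite /rnorm RRe_real// normr_real. Qed.

Lemma rnorm_ge0 a : 0 <= rnorm a.
Proof. by rewrite -ler0c -rnormE. Qed.

Lemma rnorm0 : rnorm (0 : A) = 0.
Proof. by rewrite /rnorm normr0. Qed.

Lemma rnorm0_eq0 a : rnorm a = 0 -> a = 0.
Proof. by move=> h; apply/normr0_eq0; rewrite rnormE h. Qed.

Lemma rnormN a : rnorm (- a) = rnorm a.
Proof. by rewrite /rnorm normrN. Qed.

Lemma rnormB a b : rnorm (a - b) = rnorm (b - a).
Proof. by rewrite -rnormN opprB. Qed.

Lemma rnormD a b : rnorm (a + b) <= rnorm a + rnorm b.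
Proof. by rewrite -lecR rmorphD /= -!rnormE ler_normD. Qed.

Lemma rnorm_dist a b : `|rnorm a - rnorm b| <= rnorm (a - b).
Proof.
have h1 := rnormD (a - b) b; have h2 := rnormD (b - a) a.
rewrite subrK in h1; rewrite subrK rnormB in h2.
by rewrite ler_norml; apply/andP; split; lra.
Qed.

Lemma rnorm_sum (I : Type) (r : seq I) (P : pred I) (F : I -> A) :
  rnorm (\sum_(i <- r | P i) F i) <= \sum_(i <- r | P i) rnorm (F i).
Proof.
elim/big_rec2: _ => [|i y x _ h]; first by rewrite rnorm0.
by apply: le_trans (rnormD _ _) _; rewrite lerD2l.
Qed.

Lemma rnormZ (c : R[i]) a : rnorm (c *: a) = Normc.normc c * rnorm a.
Proof. by apply: complexI; rewrite rmorphM /= -!rnormE normrZ. Qed.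

Lemma normc_real (r : R) : Normc.normc r%:C = `|r|.
Proof. by rewrite /= expr0n /= addr0 sqrtr_sqr. Qed.

Lemma rnormZR (r : R) a : rnorm (r%:C *: a) = `|r| * rnorm a.
Proof. by rewrite rnormZ normc_real. Qed.

Lemma normc_cis (t : R) : Normc.normc (cis t) = 1.
Proof. by rewrite /cis /= cos2Dsin2 sqrtr1. Qed.

Lemma rnorm_cis (t : R) a : rnorm (cis t *: a) = rnorm a.
Proof. by rewrite rnormZ normc_cis mul1r. Qed.

Lemma cvg_rnormP (T : Type) (F : set_system T) {FF : Filter F} (u : T -> A) (l : A) :
  u t @[t --> F] --> l <-> rnorm (u t - l) @[t --> F] --> (0 : R).
Proof.
split=> [/cvgrPdist_lt h|/cvgrPdist_lt h].
  apply/cvgrPdist_lt => e e0.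
  have /h : 0 < e%:C :> R[i] by rewrite ltcR.
  apply: filterS => t; rewrite rnormE ltcR sub0r normrN rnormB.
  by rewrite ger0_norm// rnorm_ge0.
apply/cvgrPdist_lt => -[e e']; rewrite ltcE /= => /andP[/eqP -> e0].
have := h _ e0; apply: filterS => t.
by rewrite rnormE complexr0 ltcR sub0r normrN ger0_norm ?rnorm_ge0// rnormB.
Qed.

Lemma cvg_rnorm (T : Type) (F : set_system T) {FF : Filter F} (u : T -> A) (l : A) :
  u t @[t --> F] --> l -> rnorm (u t) @[t --> F] --> rnorm l.
Proof.
move=> /cvg_rnormP/cvgrPdist_lt h; apply/cvgrPdist_lt => e /h.
apply: filterS => t; rewrite sub0r normrN ger0_norm ?rnorm_ge0// => he.
by apply: le_lt_trans (rnorm_dist _ _) _; rewrite rnormB.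
Qed.

Lemma rnorm_complete (u : nat -> A) :
  (forall e, 0 < e -> exists N, forall n m, (N <= n)%N -> (N <= m)%N ->
    rnorm (u n - u m) < e) -> exists l : A, u n @[n --> \oo] --> l.
Proof.
move=> h; suff : cvg (u @ \oo) by move=> /cvg_ex.
apply/cauchy_cvgP/cauchy_exP => -[e e']; rewrite ltcE /= => /andP[/eqP -> e0].
have [N hN] := h _ e0; exists (u N); exists N => // n /= Nn.
by rewrite -ball_normE /= rnormE complexr0 ltcR; exact: hN.
Qed.

End RNorm.

Section FinMeasurable.
Variable R : realType.
Local Notation RM := (measurableTypeR R).

(** The body is that of [simple_function], for an arbitrary codomain: pairs and booleans are then
    allowed as values, and simple functions can be combined through them. *)
Definition fin_measurable (T : Type) (p : R -> T) : Prop :=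
  finite_set (range p) /\ forall t, measurable (p @^-1` [set t] : set RM).

Lemma fin_measurable_preimage (T : Type) (p : R -> T) (B : set T) :
  fin_measurable p -> measurable (p @^-1` B : set RM).
Proof.
move=> [fp mp].
rewrite (_ : _ @^-1` _ = \bigcup_(t in range p `&` B) (p @^-1` [set t])).
  by apply: fin_bigcup_measurable => //; exact: finite_setIl.
apply/seteqP; split=> [x Bx|x [t [_ Bt]] /= ->//].
by exists (p x) => //; split => //; exists x.
Qed.

Lemma fin_measurable_comp (T U : Type) (p : R -> T) (h : T -> U) :
  fin_measurable p -> fin_measurable (h \o p).
Proof.
move=> fp; split; last by move=> t; exact: (fin_measurable_preimage (h @^-1` [set t]) fp).
case: fp => fr _; rewrite (_ : range _ = h @` range p); first exact: finite_image.
by rewrite image_comp.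
Qed.

Lemma fin_measurable_pair (T U : Type) (p : R -> T) (q : R -> U) :
  fin_measurable p -> fin_measurable q -> fin_measurable (fun x => (p x, q x)).
Proof.
move=> fp fq; split.
  apply: (@sub_finite_set _ _ (range p `*` range q)).
    by move=> _ [x _ <-]; split; exists x.
  by apply: finite_setX; [exact: fp.1|exact: fq.1].
move=> [t u]; rewrite (_ : _ @^-1` _ = p @^-1` [set t] `&` q @^-1` [set u]).
  by apply: measurableI; [exact: fp.2|exact: fq.2].
by apply/seteqP; split=> x /=; [case=> -> ->|case=> -> ->].
Qed.

Lemma fin_measurable_cst (T : Type) (c : T) : fin_measurable (fun=> c).
Proof.
split; first by apply: (@sub_finite_set _ _ [set c]) => // _ [x _ <-].
move=> t; have [->|ct] := pselect (t = c).
  by rewrite (_ : _ @^-1` _ = setT)//; apply/seteqP; split.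
by rewrite (_ : _ @^-1` _ = set0)//; apply/seteqP; split => // x /= /esym.
Qed.

Lemma fin_measurable_bool (b : R -> bool) :
  measurable ([set x | b x] : set RM) -> fin_measurable b.
Proof.
move=> mb; split; first exact: finite_finset.
case; first by rewrite (_ : _ @^-1` _ = [set x | b x]).
rewrite (_ : _ @^-1` _ = ~` [set x | b x]); first exact: measurableC.
by apply/seteqP; split=> x /=; [move=> ->|move=> /negP/negbTE].
Qed.

Lemma fin_measurable_if (T : Type) (b : R -> bool) (p q : R -> T) :
  measurable ([set x | b x] : set RM) -> fin_measurable p -> fin_measurable q ->
  fin_measurable (fun x => if b x then p x else q x).
Proof.
move=> /fin_measurable_bool fb fp fq.
exact: (fin_measurable_comp (fun bpq => if bpq.1.1 then bpq.1.2 else bpq.2)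
  (fin_measurable_pair (fin_measurable_pair fb fp) fq)).
Qed.

Lemma fin_measurable_fun d (T : measurableType d) (p : R -> T) :
  fin_measurable p -> measurable_fun [set: RM] p.
Proof. by move=> fp _ Y mY; rewrite setTI; exact: fin_measurable_preimage. Qed.

End FinMeasurable.

Section StrongMeasurability.
Import HBSimple.
Variable R : realType.
Local Notation RM := (measurableTypeR R).
Implicit Types (A B C : completeNormedModType R[i]).

Lemma measurable_set_bool (b : R -> bool) :
  measurable_fun [set: RM] b -> measurable ([set x | b x] : set RM).
Proof.
move=> mb; rewrite (_ : [set x | b x] = setT `&` b @^-1` [set true]).
  exact: mb.
by apply/seteqP; split=> x //= [].
Qed.

Lemma strongly_measurable_simple A (s : R -> A) :
  simple_function s -> strongly_measurable s.
Proof. by move=> ss; exists (fun=> s); split => // x; exact: cvg_cst. Qed.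

Lemma strongly_measurable_map2 A B C (h : A -> B -> C) f g :
  (forall (u : nat -> A) (v : nat -> B) a b, u n @[n --> \oo] --> a ->
    v n @[n --> \oo] --> b -> h (u n) (v n) @[n --> \oo] --> h a b) ->
  strongly_measurable f -> strongly_measurable g ->
  strongly_measurable (fun x => h (f x) (g x)).
Proof.
move=> hc [s [ss sf]] [t [tt tg]]; exists (fun n x => h (s n x) (t n x)); split.
  move=> n; exact: (fin_measurable_comp (fun p => h p.1 p.2)
    (fin_measurable_pair (ss n) (tt n))).
by move=> x; exact: hc.
Qed.

Lemma strongly_measurable_map A B (h : A -> B) f :
  (forall (u : nat -> A) a, u n @[n --> \oo] --> a ->
    h (u n) @[n --> \oo] --> h a) ->
  strongly_measurable f -> strongly_measurable (h \o f).
Proof.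
move=> hc sf; exact: (strongly_measurable_map2 (h := fun a _ => h a)
  (fun u v a b ua _ => hc u a ua) sf sf).
Qed.

Lemma measurable_rnorm A (f : R -> A) : strongly_measurable f ->
  measurable_fun [set: RM] (fun x => rnorm (f x)).
Proof.
move=> [s [ss sf]].
apply: (@measurable_fun_cvg _ RM R setT (fun n x => rnorm (s n x))).
  move=> n; apply: fin_measurable_fun.
  exact: (fin_measurable_comp (@rnorm R A) (ss n)).
by move=> x _; apply: cvg_rnorm; exact: sf.
Qed.

Lemma strongly_measurable_cst A (a : A) : strongly_measurable (fun=> a : A).
Proof. by apply: strongly_measurable_simple; exact: fin_measurable_cst. Qed.

Lemma strongly_measurableD A (f g : R -> A) :
  strongly_measurable f -> strongly_measurable g ->
  strongly_measurable (fun x => f x + g x).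
Proof.
by move=> mf mg; apply: (strongly_measurable_map2 (h := fun a b : A => a + b)) mf mg => u v a b; exact: cvgD.
Qed.

Lemma strongly_measurableZ A (c : R[i]) (f : R -> A) :
  strongly_measurable f -> strongly_measurable (fun x => c *: f x).
Proof.
by move=> mf; apply: (strongly_measurable_map (h := fun a : A => c *: a)) mf => u a; exact: cvgZr.
Qed.

Lemma strongly_measurableN A (f : R -> A) :
  strongly_measurable f -> strongly_measurable (fun x => - f x).
Proof.
by move=> mf; apply: (strongly_measurable_map (h := fun a : A => - a)) mf => u a; exact: cvgN.
Qed.

Lemma strongly_measurableB A (f g : R -> A) :
  strongly_measurable f -> strongly_measurable g ->
  strongly_measurable (fun x => f x - g x).
Proof. by move=> mf mg; apply: strongly_measurableD mf (strongly_measurableN mg). Qed.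

Lemma strongly_measurable_sum A (I : Type) (r : seq I) (P : pred I) (F : I -> R -> A) :
  (forall i, strongly_measurable (F i)) ->
  strongly_measurable (fun x => \sum_(i <- r | P i) F i x).
Proof.
move=> mF; elim: r => [|i r ih].
  rewrite (_ : (fun x => _) = (fun=> 0)); first exact: strongly_measurable_cst.
  by apply/funext => x; rewrite big_nil.
case Pi : (P i).
  rewrite (_ : (fun x => _) = (fun x => F i x + \sum_(j <- r | P j) F j x)).
    exact: strongly_measurableD.
  by apply/funext => x; rewrite big_cons Pi.
rewrite (_ : (fun x => _) = (fun x => \sum_(j <- r | P j) F j x))//.
by apply/funext => x; rewrite big_cons Pi.
Qed.

Lemma strongly_measurable_comp A (phi : RM -> RM) (f : R -> A) :
  measurable_fun [set: RM] phi ->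
  strongly_measurable f -> strongly_measurable (f \o phi).
Proof.
move=> mphi [s [ss sf]]; exists (fun n => s n \o phi); split; last first.
  by move=> x; exact: sf.
move=> n; split.
  by apply: sub_finite_set (ss n).1 => _ [x _ <-]; exists (phi x).
move=> a; have := mphi measurableT _ ((ss n).2 a).
by rewrite setTI -comp_preimage.
Qed.

Lemma strongly_measurable_if A (b : R -> bool) (f g : R -> A) :
  measurable ([set x | b x] : set RM) ->
  strongly_measurable f -> strongly_measurable g ->
  strongly_measurable (fun x => if b x then f x else g x).
Proof.
move=> mb [s [ss sf]] [t [tt tg]].
exists (fun n x => if b x then s n x else t n x); split.
  by move=> n; exact: (fin_measurable_if mb (ss n) (tt n)).
by move=> x; case: (b x).
Qed.

Lemma strongly_measurable_real A (u : R -> R) (f : R -> A) :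
  measurable_fun [set: RM] u -> strongly_measurable f ->
  strongly_measurable (fun x => (u x)%:C *: f x).
Proof.
move=> mu [s [ss sf]].
have [g gu] := @approximation_sfun _ RM R (EFin \o u) setT measurableT
  ((measurable_EFinP _ _).2 mu).
exists (fun n x => (g n x)%:C *: s n x); split.
  move=> n; have fg : fin_measurable (g n).
    split; first exact: (fimfunP (g n)).
    move=> r; rewrite -[X in measurable X]setTI.
    by apply: measurable_funP => //; exact: measurable_set1.
  exact: (fin_measurable_comp (fun p : R * A => p.1%:C *: p.2)
    (fin_measurable_pair fg (ss n))).
move=> x; have /fine_cvgP [_ hu] := gu x I.
apply: cvgZ (sf x); apply/cvgrPdist_lt => -[e e']; rewrite ltcE /= => /andP[/eqP -> e0].
move/cvgrPdist_lt : hu => /(_ _ e0); apply: filterS => n /= h.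
by rewrite -rmorphB /= normc_def /= expr0n /= addr0 sqrtr_sqr complexr0 ltcR.
Qed.

(** The approximating simple functions take countably many values in all, and these accumulate at
    every value of f. Together with the converse below, this describes strong measurability by a
    separable range. *)
Lemma strongly_measurable_dense A (f : R -> A) : strongly_measurable f ->
  exists d : nat -> A, forall x e, 0 < e -> exists i, rnorm (f x - d i) < e.
Proof.
move=> [s [ss sf]].
have /choice[l lE] : forall n, exists l : seq A, range (s n) = [set` l].
  by move=> n; apply/finite_seqP; exact: (ss n).1.
pose d k := if (unpickle k : option (nat * nat)) is Some ni
  then nth 0 (l ni.1) ni.2 else 0.
exists d => x e e0.
have /cvg_rnormP/cvgrPdist_lt/(_ e e0) [N _ hN] := sf x.
have sl : s N x \in l N.
  have : range (s N) (s N x) by exists x.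
  by rewrite lE.
exists (pickle (N, index (s N x) (l N))).
rewrite /d pickleK /= nth_index// rnormB.
by have := hN N (leqnn N); rewrite /= sub0r normrN ger0_norm ?rnorm_ge0.
Qed.

(* The n-th simple function picks the nearest point among the first n+1 points
   of a sequence that is dense in the range. *)
Lemma dense_strongly_measurable A (f : R -> A) (d : nat -> A) :
  (forall x e, 0 < e -> exists i, rnorm (f x - d i) < e) ->
  (forall i, measurable_fun [set: RM] (fun x => rnorm (f x - d i))) ->
  strongly_measurable f.
Proof.
move=> dd md.
pose fix s n x {struct n} : A := if n is n'.+1 then
  if rnorm (f x - d n) < rnorm (f x - s n' x) then d n else s n' x else d 0%N.
have ms n : simple_function (s n) /\
    measurable_fun [set: RM] (fun x => rnorm (f x - s n x)).
  elim: n => [|n [ssn msn]]; first by split; [exact: fin_measurable_cst|exact: md].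
  have mb : measurable ([set x | rnorm (f x - d n.+1) < rnorm (f x - s n x)] : set RM).
    by apply: measurable_set_bool; exact: measurable_fun_ltr.
  split; first by have := fin_measurable_if mb (fin_measurable_cst R (d n.+1)) ssn.
  rewrite (_ : (fun x => _) = (fun x => if rnorm (f x - d n.+1) < rnorm (f x - s n x)
    then rnorm (f x - d n.+1) else rnorm (f x - s n x))).
    by apply: measurable_fun_ifT => //; exact: measurable_fun_ltr.
  by apply/funext => x /=; case: ifP.
have sd x n i : (i <= n)%N -> rnorm (f x - s n x) <= rnorm (f x - d i).
  elim: n i => [|n ih] i; first by rewrite leqn0 => /eqP ->.
  rewrite leq_eqVlt => /orP[/eqP -> /=|]; first by case: ltP => // /ltW.
  rewrite ltnS => /ih /= h; case: ltP => // /ltW h'; exact: le_trans h' h.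
exists s; split; first by move=> n; exact: (ms n).1.
move=> x; apply/cvg_rnormP/cvgrPdist_lt => e e0.
have [i hi] := dd x e e0; exists i => // n /= hn.
rewrite sub0r normrN ger0_norm ?rnorm_ge0// rnormB.
exact: le_lt_trans (sd _ _ _ hn) hi.
Qed.

(** A diagonal sequence of simple functions need not converge, as none of the convergences is
    uniform. Separability of the range, unlike the approximants, passes to the limit. *)
Lemma strongly_measurable_cvg A (f : nat -> R -> A) (g : R -> A) :
  (forall n, strongly_measurable (f n)) ->
  (forall x, f n x @[n --> \oo] --> g x) -> strongly_measurable g.
Proof.
move=> mf fg.
have /choice[d dP] : forall n, exists d : nat -> A,
    forall x e, 0 < e -> exists i, rnorm (f n x - d i) < e.
  by move=> n; exact: strongly_measurable_dense.
pose d' k := if (unpickle k : option (nat * nat)) is Some ni then d ni.1 ni.2 else 0.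
apply: (@dense_strongly_measurable A g d') => [x e e0|i].
  have e2 : 0 < e / 2 by rewrite divr_gt0.
  have /cvg_rnormP/cvgrPdist_lt/(_ _ e2) [N _ /(_ N (leqnn N)) hN] := fg x.
  have [i hi] := dP N x _ e2; exists (pickle (N, i)); rewrite /d' pickleK /=.
  rewrite -(subrK (f N x) (g x)) -addrA (splitr e).
  apply: le_lt_trans (rnormD _ _) _; apply: ltrD => //.
  by move: hN; rewrite sub0r normrN ger0_norm ?rnorm_ge0// rnormB.
apply: (@measurable_fun_cvg _ RM R setT (fun n x => rnorm (f n x - d' i))).
  move=> n; apply: measurable_rnorm; apply: strongly_measurableB => //.
  exact: strongly_measurable_cst.
by move=> x _; apply: cvg_rnorm; apply: cvgB; [exact: fg|exact: cvg_cst].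
Qed.

(** Values of norm above [2 * rnorm (f x)] are replaced by 0. Where [f x = 0] only 0 is left;
    elsewhere the factor 2 leaves room for the convergence, and the replacement stops after finitely
    many indices. *)
Lemma strongly_measurable_dominated A (f : R -> A) : strongly_measurable f ->
  exists s : nat -> R -> A, [/\ forall n, simple_function (s n),
    forall x, s n x @[n --> \oo] --> f x &
    forall n x, rnorm (s n x) <= 2 * rnorm (f x)].
Proof.
move=> mf; have mnf := measurable_rnorm mf; have [s [ss sf]] := mf.
pose b n x := rnorm (s n x) <= 2 * rnorm (f x).
exists (fun n x => if b n x then s n x else 0); split.
- move=> n; have m1 := measurable_rnorm (strongly_measurable_simple (ss n)).
  have m2 : measurable_fun [set: RM] (fun x => 2 * rnorm (f x)).
    by apply: measurable_funM => //; exact: measurable_cst.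
  have mb : measurable ([set x | b n x] : set RM).
    by apply: measurable_set_bool; exact: measurable_fun_ler.
  exact: (fin_measurable_if mb (ss n) (fin_measurable_cst R (0 : A))).
- move=> x; have [fx0|fx0] := eqVneq (rnorm (f x)) 0.
    rewrite (rnorm0_eq0 fx0) (_ : (fun n => _) = (fun=> 0)); first exact: cvg_cst.
    apply/funext => n; case: ifP => //; rewrite /b fx0 mulr0 => h.
    by apply: rnorm0_eq0; apply/eqP; rewrite eq_le h rnorm_ge0.
  have fx1 : 0 < rnorm (f x) by rewrite lt_neqAle eq_sym fx0 rnorm_ge0.
  have /cvg_rnormP/cvgrPdist_lt/(_ _ fx1) [N _ hN] := sf x.
  apply: cvg_trans (sf x); apply: near_eq_cvg; exists N => // n /= Nn.
  rewrite /b; case: ifP => // /negP[].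
  have := hN n Nn; rewrite /= sub0r normrN ger0_norm ?rnorm_ge0// => h.
  have := rnormD (s n x - f x) (f x); rewrite subrK; lra.
- move=> n x; case: ifP => // _.
  by rewrite rnorm0 mulr_ge0// rnorm_ge0.
Qed.

End StrongMeasurability.

(** * The Bochner integral *)

Section DominatedConvergence.
Variable R : realType.
Local Notation RM := (measurableTypeR R).
Local Notation mu := (@lebesgue_measure R).
Local Open Scope ereal_scope.

Lemma dominated_cvg0 (g : nat -> RM -> R) (G : RM -> R) :
  (forall n, measurable_fun [set: RM] (g n)) -> measurable_fun [set: RM] G ->
  (forall n x, 0 <= g n x <= G x)%R -> \int[mu]_x (G x)%:E < +oo ->
  (forall x, g n x @[n --> \oo] --> 0%R) ->
  \int[mu]_x (g n x)%:E @[n --> \oo] --> 0.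
Proof.
move=> mg mG gG iG g0.
have G0 x : (0 <= G x)%R by have /andP[h1 h2] := gG 0%N x; exact: le_trans h1 h2.
have [] := @dominated_convergence _ RM R mu setT measurableT
  (fun n x => (g n x)%:E) (cst 0) (fun x => (G x)%:E).
- by move=> n; apply/measurable_EFinP.
- exact: measurable_cst.
- apply: aeW => x _; apply/fine_cvgP; split; last exact: g0.
  by apply: nearW.
- apply/integrableP; split; first exact/measurable_EFinP.
  by under eq_integral do rewrite gee0_abs ?lee_fin ?G0//.
- apply: aeW => x n _; have /andP[h1 h2] := gG n x.
  by rewrite gee0_abs ?lee_fin.
by move=> _ _; rewrite integral0.
Qed.

End DominatedConvergence.

(** * Integrals of simple functions *)

Section SimpleIntegral.
Variables (R : realType) (A : completeNormedModType R[i]).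
Local Notation RM := (measurableTypeR R).
Local Notation mu := (@lebesgue_measure R).
Implicit Types (s : R -> A).

Definition fin_measure (E : set RM) : R := fine (mu E).

Lemma simple_integral_seq s (u : seq A) : uniq u -> (forall x, s x \in u) ->
  simple_integral s = \sum_(a <- u) (fin_measure (s @^-1` [set a]))%:C *: a.
Proof.
move=> uu su; rewrite /simple_integral [RHS]fsbig_seq//.
rewrite [RHS](fsbig_widen [set` u] [set: A])//= => a [_ /= na].
rewrite (_ : _ @^-1` _ = set0) /fin_measure ?measure0 ?scale0r//.
by apply/seteqP; split=> // x /= xa; apply: na; rewrite -xa.
Qed.

(** The fibres of p may cut the fibres of [phi \o p] into pieces. Additivity survives [fine] because
    the pieces have finite measure, except where phi vanishes and the term is 0 anyway. With p a
    pair of simple functions, this is the common refinement that makes the integral additive. *)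
Lemma simple_integral_comp (T : choiceType) (p : R -> T) (phi : T -> A) (u : seq T) :
  fin_measurable p -> uniq u -> (forall x, p x \in u) ->
  (forall t, phi t != 0 -> (mu (p @^-1` [set t]) < +oo)%E) ->
  simple_integral (phi \o p) =
  \sum_(t <- u) (fin_measure (p @^-1` [set t]))%:C *: phi t.
Proof.
move=> fp uu pu fin.
rewrite (simple_integral_seq (u := undup (map phi u))) ?undup_uniq//; last first.
  by move=> x; rewrite mem_undup; apply: map_f.
have E a : (fin_measure ((phi \o p) @^-1` [set a]))%:C *: a =
    \sum_(t <- u) if phi t == a then (fin_measure (p @^-1` [set t]))%:C *: phi t else 0.
  rewrite -big_mkcond /=; have [->|a0] := eqVneq a 0.
    by rewrite scaler0 big1// => t /eqP ->; rewrite scaler0.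
  rewrite (eq_bigr (fun t => (fin_measure (p @^-1` [set t]))%:C *: a)); last first.
    by move=> t /eqP ->.
  rewrite -scaler_suml -rmorph_sum /=; congr (_%:C *: a).
  rewrite /fin_measure (_ : _ @^-1` _ =
      \bigcup_(t in [set` [seq t <- u | phi t == a]]) (p @^-1` [set t])); last first.
    apply/seteqP; split=> [x /= pa|x [t /=]].
      by exists (p x) => //=; rewrite mem_filter pa eqxx pu.
    by rewrite mem_filter => /andP[/eqP <- _] ->.
  rewrite measure_fin_bigcup//; last 2 first.
  - by apply/trivIsetP => i j _ _ ij; apply/seteqP; split => // x [/= -> /eqP]; exact/negP.
  - by move=> t _; exact: fp.2.
  rewrite -fsbig_seq ?filter_uniq// big_filter sum_fine// => t /eqP ta.
  rewrite ge0_fin_numE//.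
  by apply: fin; rewrite ta.
under eq_bigr do rewrite E.
rewrite exchange_big /=.
rewrite big_seq [RHS]big_seq; apply: eq_bigr => t tu.
rewrite (bigD1_seq (phi t)) ?undup_uniq ?mem_undup//=; last exact: map_f.
by rewrite eqxx big1 ?addr0// => a /negPf; rewrite eq_sym => ->.
Qed.

Lemma fin_measurable_seq (T : choiceType) (p : R -> T) : fin_measurable p ->
  exists u : seq T, uniq u /\ forall x, p x \in u.
Proof.
move=> [/finite_seqP[u uE] _]; exists (undup u); rewrite undup_uniq; split=> // x.
rewrite mem_undup; have : range p (p x) by exists x.
by rewrite uE.
Qed.

Lemma simple_integralB s (t : R -> A) : integrable_simple_function s ->
  integrable_simple_function t ->
  simple_integral (fun x => s x - t x) = simple_integral s - simple_integral t.
Proof.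
move=> [fs is_] [ft it].
have fst := fin_measurable_pair fs ft.
have [u [uu su]] := fin_measurable_seq fst.
have mst a : measurable ((fun x => (s x, t x)) @^-1` [set a] : set RM) by exact: fst.2.
have h1 a b : a != 0 -> (mu ((fun x => (s x, t x)) @^-1` [set (a, b)]) < +oo)%E.
  move=> /is_; apply: le_lt_trans; apply: le_measure; rewrite ?inE//; last first.
    by move=> x /= [].
  exact: fs.2.
have h2 a b : b != 0 -> (mu ((fun x => (s x, t x)) @^-1` [set (a, b)]) < +oo)%E.
  move=> /it; apply: le_lt_trans; apply: le_measure; rewrite ?inE//; last first.
    by move=> x /= [].
  exact: ft.2.
have e1 := simple_integral_comp (phi := fun p : A * A => p.1) fst uu su.
have e2 := simple_integral_comp (phi := fun p : A * A => p.2) fst uu su.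
have e3 := simple_integral_comp (phi := fun p : A * A => p.1 - p.2) fst uu su.
rewrite [LHS]e3; last first.
  move=> [a b] /= ab; have [a0|a0] := eqVneq a 0; last exact: h1.
  by apply: h2; apply: contra ab => /eqP ->; rewrite a0 subr0.
rewrite [simple_integral s]e1; last by case=> a b; exact: h1.
rewrite [simple_integral t]e2; last by case=> a b; exact: h2.
by rewrite -sumrB; apply: eq_bigr => p _; rewrite scalerBr.
Qed.

(** A nonzero value of the difference is taken only where s or t is nonzero, and each of these two
    sets is a finite union of fibres of finite measure. *)
Lemma integrable_simpleB s (t : R -> A) : integrable_simple_function s ->
  integrable_simple_function t ->
  integrable_simple_function (fun x => s x - t x).
Proof.
move=> [fs is_] [ft it].
have fst := fin_measurable_pair fs ft.
have fB := fin_measurable_comp (fun p : A * A => p.1 - p.2) fst.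
split=> // a a0.
have ms0 : measurable (~` (s @^-1` [set 0]) : set RM) by apply: measurableC; exact: fs.2.
have mt0 : measurable (~` (t @^-1` [set 0]) : set RM) by apply: measurableC; exact: ft.2.
have fin0 (r : R -> A) : fin_measurable r -> (forall b, b != 0 -> (mu (r @^-1` [set b]) < +oo)%E) ->
    (mu (~` (r @^-1` [set (0 : A)%R])) < +oo)%E.
  move=> fr ir; have [u [uu ru]] := fin_measurable_seq fr.
  rewrite (_ : ~` _ = \bigcup_(b in [set` [seq b <- u | b != 0]]) (r @^-1` [set b])).
    rewrite measure_fin_bigcup//; last 2 first.
    - by apply/trivIsetP => i j _ _ ij; apply/seteqP; split => // x [/= -> /eqP]; exact/negP.
    - by move=> b _; exact: fr.2.
    rewrite -fsbig_seq ?filter_uniq// big_seq; apply: lte_sum_pinfty => b.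
    rewrite mem_filter => /andP[b0 _]; exact: ir.
    exact: finite_seq.
  apply/seteqP; split=> [x /= /eqP rx|x [b /=]].
    by exists (r x) => //=; rewrite mem_filter rx ru.
  by rewrite mem_filter => /andP[/eqP b0 _] ->.
apply: (@le_lt_trans _ _ (mu (~` (s @^-1` [set (0 : A)]) `|` ~` (t @^-1` [set (0 : A)])))).
  apply: le_measure; rewrite ?inE; [exact: fB.2|exact: measurableU|].
  move=> x /= sta; apply/not_andP => -[s0 t0].
  by move/eqP : a0; apply; rewrite -sta s0 t0 subr0.
apply: le_lt_trans (measureU2 _ ms0 mt0) _.
by apply: lte_add_pinfty; exact: fin0.
Qed.

Lemma simple_integral_norm s : integrable_simple_function s ->
  ((rnorm (simple_integral s))%:E <= \int[mu]_x (rnorm (s x))%:E)%E.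
Proof.
move=> [fs is_]; have [u [uu su]] := fin_measurable_seq fs.
rewrite (simple_integral_seq uu su).
have -> : (\int[mu]_x (rnorm (s x))%:E = \int[mu]_x
    (\sum_(a <- u) (rnorm a)%:E * (\1_(s @^-1` [set a]) x)%:E)%E)%E.
  apply: eq_integral => x _; rewrite (bigD1_seq (s x) (su x) uu) /= big1 ?adde0.
    by rewrite indicE mem_set// mule1.
  by move=> a asx; rewrite indicE memNset ?mule0// => /= /esym/eqP; exact/negP.
rewrite ge0_integral_sum//; last 2 first.
- move=> a; apply: measurable_funeM; apply/measurable_EFinP; apply: measurable_indic.
  exact: fs.2.
- by move=> a x _; rewrite mule_ge0// lee_fin ?rnorm_ge0.
have E a : (\int[mu]_x ((rnorm a)%:E * (\1_(s @^-1` [set a]) x)%:E) =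
   (rnorm ((fin_measure (s @^-1` [set a]))%:C *: a))%:E)%E.
  rewrite ge0_integralZl_EFin ?rnorm_ge0//; last first.
    by apply/measurable_EFinP; apply: measurable_indic; exact: fs.2.
  rewrite integral_indic//; last exact: fs.2.
  rewrite setIT rnormZR ger0_norm; last by rewrite fine_ge0.
  have [->|a0] := eqVneq a 0; first by rewrite rnorm0 mul0e mulr0.
  rewrite mulrC EFinM fineK//= ge0_fin_numE; [exact: is_|exact: measure_ge0].
rewrite (eq_bigr _ (fun a _ => E a)).
by rewrite sumEFin lee_fin rnorm_sum.
Qed.

End SimpleIntegral.

Section Inorm.
Variables (R : realType) (A : completeNormedModType R[i]).
Local Notation RM := (measurableTypeR R).
Local Notation mu := (@lebesgue_measure R).
Implicit Types (f g h s : R -> A).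

Definition inorm f : \bar R := \int[mu]_x (rnorm (f x))%:E.

Lemma inorm_ge0 f : (0 <= inorm f)%E.
Proof. by apply: integral_ge0 => x _; rewrite lee_fin rnorm_ge0. Qed.

Lemma measurable_rnormE f : strongly_measurable f ->
  measurable_fun [set: RM] (fun x => (rnorm (f x))%:E).
Proof. by move=> mf; apply/measurable_EFinP; exact: measurable_rnorm. Qed.

Lemma inorm_le f (g : RM -> \bar R) : strongly_measurable f ->
  measurable_fun [set: RM] g ->
  (forall x, (rnorm (f x))%:E <= g x)%E -> (inorm f <= \int[mu]_x g x)%E.
Proof.
move=> mf mg fg; apply: ge0_le_integral => //.
- by move=> x _; rewrite lee_fin rnorm_ge0.
- exact: measurable_rnormE.
Qed.

Lemma inormD f g : strongly_measurable f -> strongly_measurable g ->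
  (inorm (fun x => (f x + g x)%R) <= inorm f + inorm g)%E.
Proof.
move=> mf mg; rewrite /inorm -ge0_integralD//; last 4 first.
- by move=> x _; rewrite lee_fin rnorm_ge0.
- exact: measurable_rnormE.
- by move=> x _; rewrite lee_fin rnorm_ge0.
- exact: measurable_rnormE.
apply: inorm_le.
- exact: strongly_measurableD.
- by apply: emeasurable_funD; exact: measurable_rnormE.
- by move=> x; rewrite -EFinD lee_fin rnormD.
Qed.

Lemma inormN f : inorm (fun x => - f x) = inorm f.
Proof. by apply: eq_integral => x _; rewrite rnormN. Qed.

Lemma inormB f g : inorm (fun x => f x - g x) = inorm (fun x => g x - f x).
Proof. by apply: eq_integral => x _; rewrite rnormB. Qed.

Lemma inorm_dist f g h : strongly_measurable f -> strongly_measurable g ->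
  strongly_measurable h ->
  (inorm (fun x => (f x - h x)%R) <=
   inorm (fun x => (f x - g x)%R) + inorm (fun x => (g x - h x)%R))%E.
Proof.
move=> mf mg mh; have := inormD (strongly_measurableB mf mg) (strongly_measurableB mg mh).
by apply: le_trans; rewrite le_eqVlt; apply/orP; left; apply/eqP;
  apply: eq_integral => x _; rewrite addrA subrK.
Qed.

End Inorm.

Lemma ae_imply (R : realType) (P Q : R -> Prop) : (forall x, P x -> Q x) ->
  {ae @lebesgue_measure R, forall x, P x} -> {ae @lebesgue_measure R, forall x, Q x}.
Proof. by move=> PQ; apply: negligibleS => x /= nQ /PQ. Qed.

Lemma ae_and (R : realType) (P Q : R -> Prop) :
  {ae @lebesgue_measure R, forall x, P x} -> {ae @lebesgue_measure R, forall x, Q x} ->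
  {ae @lebesgue_measure R, forall x, P x /\ Q x}.
Proof.
move=> hP hQ; have := negligibleU hP hQ; apply: negligibleS => x /= /not_andP[]; by [left|right].
Qed.

Section Bochner.
Variables (R : realType) (A : completeNormedModType R[i]).
Local Notation RM := (measurableTypeR R).
Local Notation mu := (@lebesgue_measure R).
Implicit Types (f g s : R -> A).

Lemma integrable_simple_sm s : integrable_simple_function s -> strongly_measurable s.
Proof. by move=> [ss _]; exact: strongly_measurable_simple. Qed.

Lemma inorm_simple_lty s : integrable_simple_function s -> (inorm s < +oo)%E.
Proof.
move=> [fs is_]; have [u [uu su]] := fin_measurable_seq fs.
have -> : (inorm s = \int[mu]_x
    (\sum_(a <- u) (rnorm a)%:E * (\1_(s @^-1` [set a]) x)%:E)%E)%E.
  apply: eq_integral => x _; rewrite (bigD1_seq (s x) (su x) uu) /= big1 ?adde0.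
    by rewrite indicE mem_set// mule1.
  by move=> a asx; rewrite indicE memNset ?mule0// => /= /esym/eqP; exact/negP.
rewrite ge0_integral_sum//; last 2 first.
- move=> a; apply: measurable_funeM; apply/measurable_EFinP; apply: measurable_indic.
  exact: fs.2.
- by move=> a x _; rewrite mule_ge0// lee_fin ?rnorm_ge0.
apply: lte_sum_pinfty => a _.
rewrite ge0_integralZl_EFin ?rnorm_ge0//; last first.
  by apply/measurable_EFinP; apply: measurable_indic; exact: fs.2.
rewrite integral_indic//; last exact: fs.2.
rewrite setIT; have [->|a0] := eqVneq a 0; first by rewrite rnorm0 mul0e.
by apply: lte_mul_pinfty => //; [rewrite lee_fin rnorm_ge0|exact: is_].
Qed.

Lemma chebyshev_simple s : simple_function s -> (inorm s < +oo)%E ->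
  integrable_simple_function s.
Proof.
move=> fs is_; split=> // a a0.
have ra0 : 0 < rnorm a.
  by rewrite lt_neqAle rnorm_ge0 andbT eq_sym; apply: contra a0 => /eqP/rnorm0_eq0 ->.
have ma : measurable (s @^-1` [set a] : set RM) by exact: fs.2.
have h : ((rnorm a)%:E * mu (s @^-1` [set a]) <= inorm s)%E.
  rewrite -[X in (_ * mu X)%E]setIT -integral_indic// -ge0_integralZl_EFin//; last 2 first.
  - by apply/measurable_EFinP; exact: measurable_indic.
  - exact: ltW.
  apply: ge0_le_integral => //.
  - by move=> x _; rewrite mule_ge0// lee_fin ltW.
  - by apply: measurable_funeM; apply/measurable_EFinP; exact: measurable_indic.
  - by apply: measurable_rnormE; exact: strongly_measurable_simple.
  move=> x _; rewrite -EFinM lee_fin indicE.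
  have [/set_mem /= ->|_] := boolP (x \in s @^-1` [set a]).
    by rewrite mulr1.
  by rewrite mulr0 rnorm_ge0.
rewrite ltey; apply/eqP => muy; move: h; rewrite muy gt0_muley ?lte_fin//.
by rewrite leye_eq => /eqP h; rewrite h in is_.
Qed.

(** As the simple functions are dominated by [2 * rnorm (f x)], the errors are dominated by
    [3 * rnorm (f x)], and dominated convergence applies. *)
Lemma bochner_approx f : strongly_measurable f -> (inorm f < +oo)%E ->
  exists s : nat -> R -> A, [/\ forall n, integrable_simple_function (s n),
    forall x, s n x @[n --> \oo] --> f x,
    forall n x, rnorm (s n x) <= 2 * rnorm (f x) &
    inorm (fun x => f x - s n x) @[n --> \oo] --> 0%E].
Proof.
move=> mf fi; have [s [ss sf s2]] := strongly_measurable_dominated mf.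
have mss n := strongly_measurable_simple (ss n).
have m3 : measurable_fun [set: RM] (fun x => 3 * rnorm (f x)).
  by apply: measurable_funM; [exact: measurable_cst|exact: measurable_rnorm].
have fin (c : R) : 0 <= c -> (\int[mu]_x (c * rnorm (f x))%:E < +oo)%E.
  move=> c0; under eq_integral do rewrite EFinM.
  rewrite ge0_integralZl_EFin//; last 2 first.
  - by move=> x _; rewrite lee_fin rnorm_ge0.
  - exact: measurable_rnormE.
  exact: lte_mul_pinfty.
exists s; split=> //.
- move=> n; apply: chebyshev_simple => //; apply: le_lt_trans (fin 2 _) => //.
  apply: inorm_le; [exact: mss| |by move=> x; rewrite lee_fin].
  by apply/measurable_EFinP; apply: measurable_funM; [exact: measurable_cst|exact: measurable_rnorm].
apply: (@dominated_cvg0 _ (fun n x => rnorm (f x - s n x)) (fun x => 3 * rnorm (f x))) => //.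
- by move=> n; apply: measurable_rnorm; exact: strongly_measurableB.
- move=> n x; rewrite rnorm_ge0 /=; apply: le_trans (rnormD _ _) _.
  by rewrite rnormN; have := s2 n x; lra.
- exact: fin.
- move=> x; under eq_fun do rewrite rnormB.
  by apply/cvg_rnormP; exact: sf.
Qed.

Lemma bochner_unique f v v' : is_bochner_integral f v -> is_bochner_integral f v' -> v = v'.
Proof.
move=> [mf [s [is_ sf sv]]] [_ [t [it tf tv']]].
have : rnorm (simple_integral (s n) - simple_integral (t n)) @[n --> \oo] --> (0 : R).
  have h : (inorm (fun x => f x - s n x)%R + inorm (fun x => f x - t n x)%R)%E @[n --> \oo] --> 0%E.
    by rewrite -[X in _ --> X]adde0; apply: cvgeD.
  have : (rnorm (simple_integral (s n) - simple_integral (t n)))%:E @[n --> \oo] --> 0%E.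
    apply: squeeze_cvge (cvg_cst 0%E) h; apply: nearW => n.
    rewrite lee_fin rnorm_ge0 /= -simple_integralB//.
    apply: le_trans (simple_integral_norm (integrable_simpleB (is_ n) (it n))) _.
    rewrite (inormB f (s n)); apply: inorm_dist => //; exact: integrable_simple_sm.
  by move=> /fine_cvgP[].
have : simple_integral (s n) - simple_integral (t n) @[n --> \oo] --> v - v' by exact: cvgB.
move=> /cvg_rnorm h1 h2.
have /rnorm0_eq0/eqP : rnorm (v - v') = 0 by exact: (cvg_unique _ h1 h2).
by rewrite subr_eq0 => /eqP.
Qed.

Lemma is_bochner_lty f v : is_bochner_integral f v -> (inorm f < +oo)%E.
Proof.
move=> [mf [s [is_ sf sv]]].
have /fine_cvgP[[N _ hN] _] := sf; have {hN} := hN N (leqnn N).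
rewrite ge0_fin_numE; last exact: inorm_ge0.
move=> h; have mss := integrable_simple_sm (is_ N).
have := inormD (strongly_measurableB mf mss) mss.
under [X in inorm X]eq_fun do rewrite subrK.
by move=> h'; apply: le_lt_trans h' _; apply: lte_add_pinfty => //; exact: inorm_simple_lty.
Qed.

Lemma is_bochner_norm f v : is_bochner_integral f v -> ((rnorm v)%:E <= inorm f)%E.
Proof.
move=> [mf [s [is_ sf sv]]]; apply/lee_addgt0Pr => e e0.
have e2 : 0 < e / 2 by rewrite divr_gt0.
have /cvg_rnormP/cvgrPdist_lt/(_ _ e2) h1 := sv.
have /fine_cvgP[h3 /cvgrPdist_lt/(_ _ e2) h2] := sf.
have [N _ /(_ N (leqnn N)) [[/= ha hb] hc]] := filterI (filterI h1 h2) h3.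
rewrite sub0r normrN ger0_norm ?rnorm_ge0// in ha.
rewrite sub0r normrN ger0_norm ?fine_ge0 ?inorm_ge0// in hb.
have hs := simple_integral_norm (is_ N).
have mss := integrable_simple_sm (is_ N).
have hd := inormD mf (strongly_measurableB mss mf).
have hE : inorm (s N) = inorm (fun x => f x + (s N x - f x)).
  by apply: eq_integral => x _; rewrite addrC subrK.
apply: (@le_trans _ _ ((rnorm (simple_integral (s N)) + e / 2)%:E)).
  rewrite lee_fin; have := rnormD (v - simple_integral (s N)) (simple_integral (s N)).
  by rewrite subrK (rnormB v); lra.
rewrite [leRHS](_ : _ = (inorm f + (e / 2)%:E + (e / 2)%:E)%E); last first.
  by rewrite [in LHS](splitr e) EFinD addeA.
rewrite EFinD leeD2r//.
apply: (le_trans hs); rewrite -/(inorm _) hE; apply: (le_trans hd); rewrite leeD2l//.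
by rewrite inormB -[X in (X <= _)%E]fineK// lee_fin ltW.
Qed.

Lemma is_bochner_bochner f : strongly_measurable f -> (inorm f < +oo)%E ->
  is_bochner_integral f (bochner_integral f).
Proof.
move=> mf fi; suff [v hv] : exists v, is_bochner_integral f v.
  by apply: (@xgetPex _ 0 [set v | is_bochner_integral f v]); exists v.
have [s [is_ sf s2 sn]] := bochner_approx mf fi.
have [v hv] : exists v : A, simple_integral (s n) @[n --> \oo] --> v.
  apply: rnorm_complete => e e0.
  have e2 : 0 < e / 2 by rewrite divr_gt0.
  have /fine_cvgP[h3 /cvgrPdist_lt/(_ _ e2) h2] := sn.
  have [N _ hN] := filterI h2 h3; exists N => n m Nn Nm.
  rewrite -simple_integralB//.
  have b k : (N <= k)%N -> (inorm (fun x => f x - s k x)%R < (e / 2)%:E)%E.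
    move=> /hN[/= ha hb]; rewrite -[X in (X < _)%E]fineK// lte_fin.
    by rewrite sub0r normrN ger0_norm ?fine_ge0 ?inorm_ge0// in ha.
  rewrite -lte_fin (splitr e) EFinD.
  apply: le_lt_trans (simple_integral_norm (integrable_simpleB (is_ n) (is_ m))) _.
  apply: le_lt_trans (lteD (b n Nn) (b m Nm)).
  rewrite (inormB f (s n)); apply: inorm_dist => //; exact: integrable_simple_sm.
by exists v; split=> //; exists s; split.
Qed.

Lemma bochner_integralE f v : is_bochner_integral f v -> bochner_integral f = v.
Proof.
move=> hv; apply: (bochner_unique (f := f)) => //.
apply: is_bochner_bochner; [by case: hv|exact: is_bochner_lty hv].
Qed.

Lemma bochner_integral_dflt f : ~ (inorm f < +oo)%E -> bochner_integral f = 0.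
Proof.
move=> h; rewrite /bochner_integral; case: xgetP => // v _ hv.
by exfalso; apply: h; exact: is_bochner_lty hv.
Qed.

Lemma bochner_integral_norm f : strongly_measurable f ->
  ((rnorm (bochner_integral f))%:E <= inorm f)%E.
Proof.
move=> mf; case: (pselect (inorm f < +oo)%E) => [fi|fi].
  exact/is_bochner_norm/is_bochner_bochner.
by rewrite bochner_integral_dflt// rnorm0 inorm_ge0.
Qed.

Lemma is_bochnerB f g v u : is_bochner_integral f v -> is_bochner_integral g u ->
  is_bochner_integral (fun x => f x - g x) (v - u).
Proof.
move=> [mf [s [is_ sf sv]]] [mg [t [it tg tu]]].
split; first exact: strongly_measurableB.
exists (fun n x => s n x - t n x); split.
- by move=> n; exact: integrable_simpleB.
- have h : (inorm (fun x => f x - s n x)%R + inorm (fun x => g x - t n x)%R)%E @[n --> \oo] --> 0%E.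
    by rewrite -[X in _ --> X]adde0; apply: cvgeD.
  apply: squeeze_cvge (cvg_cst 0%E) h; apply: nearW => n.
  rewrite inorm_ge0 /= -(inormN (fun x => g x - t n x)).
  have m1 := strongly_measurableB mf (integrable_simple_sm (is_ n)).
  have m2 := strongly_measurableB mg (integrable_simple_sm (it n)).
  apply: le_trans (inormD m1 (strongly_measurableN m2)).
  rewrite le_eqVlt; apply/orP; left; apply/eqP; apply: eq_integral => x _.
  by congr (_%:E); congr rnorm; rewrite !opprB addrACA [RHS]addrACA; congr (_ + _); rewrite addrC.
- under eq_fun do rewrite simple_integralB//.
  exact: cvgB.
Qed.

Lemma ae_is_bochner f g v : is_bochner_integral f v -> strongly_measurable g ->
  ae_equal f g -> is_bochner_integral g v.
Proof.
move=> [mf [s [is_ sf sv]]] mg fg; split=> //; exists s; split=> //.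
rewrite (_ : (fun n => _) = (fun n => \int[mu]_x (rnorm (f x - s n x))%:E)%E)//.
apply/funext => n; apply/esym; have mss := integrable_simple_sm (is_ n).
apply: ae_eq_integral => //.
- by apply: measurable_rnormE; exact: strongly_measurableB.
- by apply: measurable_rnormE; exact: strongly_measurableB.
- by apply: ae_imply fg => x -> _.
Qed.

Lemma simple_integral_reflect s (x : R) : simple_function s ->
  simple_integral (fun t => s (x - t)) = simple_integral s.
Proof.
move=> fs; apply: eq_fsbigr => a _; congr ((fine _)%:C *: a).
by rewrite -(lebesgue_measure_reflect x (fs.2 a)).
Qed.

Lemma inorm_reflect f (x : R) : strongly_measurable f ->
  inorm (fun t => f (x - t)) = inorm f.
Proof.
move=> mf; apply: (@ge0_integral_reflect _ x (fun t => (rnorm (f t))%:E)).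
  exact: measurable_rnormE.
by move=> t; rewrite lee_fin rnorm_ge0.
Qed.

Lemma strongly_measurable_reflect f (x : R) : strongly_measurable f ->
  strongly_measurable (fun t => f (x - t)).
Proof. exact: (strongly_measurable_comp (measurable_reflect x)). Qed.

Lemma is_bochner_reflect f v (x : R) : is_bochner_integral f v ->
  is_bochner_integral (fun t => f (x - t)) v.
Proof.
move=> [mf [s [is_ sf sv]]]; split; first exact: strongly_measurable_reflect.
exists (fun n t => s n (x - t)); split.
- move=> n; have ms := integrable_simple_sm (is_ n); apply: chebyshev_simple.
    split; first by apply: sub_finite_set (is_ n).1.1 => _ [t _ <-]; exists (x - t).
    move=> a; have := measurable_reflect x measurableT ((is_ n).1.2 a).
    by rewrite setTI.
  by rewrite inorm_reflect//; exact: inorm_simple_lty.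
- rewrite (_ : (fun n => _) = (fun n => \int[mu]_x (rnorm (f x - s n x))%:E)%E)//.
  apply/funext => n; apply: (@inorm_reflect (fun t => f t - s n t)).
  by apply: strongly_measurableB => //; exact: integrable_simple_sm.
- rewrite (_ : (fun n => _) = (fun n => simple_integral (s n)))//.
  by apply/funext => n; apply: simple_integral_reflect; exact: (is_ n).1.
Qed.

Lemma bochner_integral_reflect f (x : R) :
  bochner_integral (fun t => f (x - t)) = bochner_integral f.
Proof.
rewrite /bochner_integral; congr xget; apply/seteqP; split=> v /= h.
  have := is_bochner_reflect x h; congr is_bochner_integral.
  by apply/funext => t; rewrite opprB addrCA subrr addr0.
exact: is_bochner_reflect.
Qed.

Lemma bochner_cvg (f : nat -> R -> A) (g : R -> A) :
  (forall n, strongly_measurable (f n)) -> strongly_measurable g ->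
  (inorm g < +oo)%E ->
  inorm (fun x => f n x - g x) @[n --> \oo] --> 0%E ->
  bochner_integral (f n) @[n --> \oo] --> bochner_integral g.
Proof.
move=> mf mg gi fg; apply/cvg_rnormP/cvgrPdist_lt => e e0.
have /fine_cvgP[h3 /cvgrPdist_lt/(_ _ e0) h2] := fg.
apply: filterS2 h2 h3 => n /= ha hb.
rewrite sub0r normrN ger0_norm ?rnorm_ge0//.
rewrite sub0r normrN ger0_norm ?fine_ge0 ?inorm_ge0// in ha.
have fi : (inorm (f n) < +oo)%E.
  have := inormD (strongly_measurableB (mf n) mg) mg.
  under [X in inorm X]eq_fun do rewrite subrK.
  move=> h'; apply: le_lt_trans h' _; apply: lte_add_pinfty => //.
  by rewrite -ge0_fin_numE ?inorm_ge0.
have := is_bochner_norm (is_bochnerB (is_bochner_bochner (mf n) fi) (is_bochner_bochner mg gi)).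
by rewrite -lte_fin => h; apply: le_lt_trans h _; rewrite -[X in (X < _)%E]fineK// lte_fin.
Qed.

End Bochner.

Section BochnerMap.
Variables (R : realType) (A B : completeNormedModType R[i]).

Lemma is_bochner_simple (s : R -> A) : integrable_simple_function s ->
  is_bochner_integral s (simple_integral s).
Proof.
move=> is_; split; first exact: integrable_simple_sm.
exists (fun=> s); split=> //; last exact: cvg_cst.
under eq_fun do under eq_integral do rewrite subrr rnorm0.
by rewrite integral0; exact: cvg_cst.
Qed.

Lemma inorm_map (T : A -> B) (K : R) (f : R -> A) : 0 <= K ->
  (forall a, rnorm (T a) <= K * rnorm a) ->
  strongly_measurable f -> strongly_measurable (T \o f) ->
  (inorm (T \o f) <= K%:E * inorm f)%E.
Proof.
move=> K0 TK mf mTf; rewrite /inorm -ge0_integralZl_EFin//; last 2 first.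
- by move=> x _; rewrite lee_fin rnorm_ge0.
- exact: measurable_rnormE.
apply: inorm_le => //; last by move=> x; rewrite -EFinM lee_fin TK.
by apply: measurable_funeM; exact: measurable_rnormE.
Qed.

(** Homogeneity over real scalars is what a simple integral calls for: its coefficients are measures
    of fibres. *)
Lemma is_bochner_map (T : A -> B) (K : R) (f : R -> A) (v : A) : 0 <= K ->
  (forall a, rnorm (T a) <= K * rnorm a) ->
  (forall a b, T (a - b) = T a - T b) ->
  (forall (r : R) a, T (r%:C *: a) = r%:C *: T a) ->
  is_bochner_integral f v -> is_bochner_integral (T \o f) (T v).
Proof.
move=> K0 TK TB TZ [mf [s [is_ sf sv]]].
have T0 : T 0 = 0 by rewrite -(subr0 0) TB subrr.
have TD a b : T (a + b) = T a + T b.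
  have TN : T (- b) = - T b by rewrite -sub0r TB T0 sub0r.
  by rewrite -{1}(opprK b) TB TN opprK.
have Tcvg (u : nat -> A) a : u n @[n --> \oo] --> a -> T (u n) @[n --> \oo] --> T a.
  move=> /cvg_rnormP ua; apply/cvg_rnormP.
  have ua' : K * rnorm (u n - a) @[n --> \oo] --> (0 : R).
    by rewrite -(mulr0 K); apply: cvgM => //; exact: cvg_cst.
  apply: squeeze_cvgr (cvg_cst (0 : R)) ua'; apply: nearW => n.
  by rewrite rnorm_ge0 /= -TB TK.
have mTf : strongly_measurable (T \o f) by exact: strongly_measurable_map.
have fTs n : simple_function (T \o s n) by exact: (fin_measurable_comp T (is_ n).1).
have iTs n : integrable_simple_function (T \o s n).
  apply: chebyshev_simple => //.
  have ms := integrable_simple_sm (is_ n).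
  apply: le_lt_trans (inorm_map K0 TK ms (strongly_measurable_simple (fTs n))) _.
  by apply: lte_mul_pinfty => //; exact: inorm_simple_lty.
split=> //; exists (fun n => T \o s n); split=> //.
- have h : (K%:E * inorm (fun x => f x - s n x)%R)%E @[n --> \oo] --> 0%E.
    by rewrite -(mule0 K%:E); apply: cvgeZl.
  apply: squeeze_cvge (cvg_cst 0%E) h; apply: nearW => n.
  have ms := integrable_simple_sm (is_ n).
  rewrite inorm_ge0 /=; apply: le_trans (inorm_map K0 TK _ _).
  + rewrite le_eqVlt; apply/orP; left; apply/eqP; apply: eq_integral => x _ /=.
    by rewrite TB.
  + exact: strongly_measurableB.
  + by apply: strongly_measurable_map => //; exact: strongly_measurableB.
- rewrite (_ : (fun n => _) = (fun n => T (simple_integral (s n)))); first exact: Tcvg.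
  apply/funext => n; have [u [uu su]] := fin_measurable_seq (is_ n).1.
  rewrite (simple_integral_comp (phi := T) (is_ n).1 uu su); last first.
    move=> a Ta0; apply: (is_ n).2; apply: contra Ta0 => /eqP ->; exact/eqP.
  rewrite (simple_integral_seq uu su).
  elim/big_rec2: _ => [|a x y _ ->]; first by rewrite T0.
  by rewrite TD TZ.
Qed.

End BochnerMap.

Section BochnerReal.
Variables (R : realType) (A : completeNormedModType R[i]).
Local Notation RM := (measurableTypeR R).
Local Notation mu := (@lebesgue_measure R).
Import HBNNSimple.

Lemma is_bochnerZ (c : R[i]) (f : R -> A) v : is_bochner_integral f v ->
  is_bochner_integral (fun x => c *: f x) (c *: v).
Proof.
apply: (is_bochner_map (T := fun a => c *: a) (K := Normc.normc c)).
- by case: c => a b /=; rewrite sqrtr_ge0.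
- by move=> a; rewrite rnormZ.
- by move=> a b; rewrite scalerBr.
- by move=> r a; rewrite !scalerA mulrC.
Qed.

Lemma markov_set (u : RM -> R) (E : set RM) (c : R) : 0 < c -> measurable E ->
  measurable_fun [set: RM] u -> (forall x, 0 <= u x) -> (forall x, E x -> c <= u x) ->
  (\int[mu]_x (u x)%:E < +oo)%E -> (mu E < +oo)%E.
Proof.
move=> c0 mE mu_ u0 cu ui.
have h : (c%:E * mu E <= \int[mu]_x (u x)%:E)%E.
  rewrite -[X in (_ * mu X)%E]setIT -integral_indic// -ge0_integralZl_EFin//; last 2 first.
  - by apply/measurable_EFinP; exact: measurable_indic.
  - exact: ltW.
  apply: ge0_le_integral => //.
  - by move=> x _; rewrite mule_ge0// lee_fin ltW.
  - by apply: measurable_funeM; apply/measurable_EFinP; exact: measurable_indic.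
  - exact/measurable_EFinP.
  move=> x _; rewrite -EFinM lee_fin indicE.
  have [/set_mem /cu h|_] := boolP (x \in E); first by rewrite mulr1.
  by rewrite mulr0.
rewrite ltey; apply/eqP => muy; move: h; rewrite muy gt0_muley ?lte_fin//.
by rewrite leye_eq => /eqP h; rewrite h in ui.
Qed.

Lemma inorm_real (u : RM -> R) (a : A) : measurable_fun [set: RM] u ->
  inorm (fun x => (u x)%:C *: a) = ((rnorm a)%:E * \int[mu]_x `|u x|%:E)%E.
Proof.
move=> mu_; rewrite -ge0_integralZl_EFin ?rnorm_ge0//; last first.
  by apply/measurable_EFinP; exact: measurableT_comp.
by apply: eq_integral => x _; rewrite rnormZR mulrC EFinM.
Qed.

(** One sequence of simple functions increasing to u serves twice: dominated convergence makes the
    error tend to 0, monotone convergence makes the integrals tend to that of u. *)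
Lemma ge0_is_bochner_real (u : RM -> R) (a : A) : measurable_fun [set: RM] u ->
  (forall x, 0 <= u x) -> (\int[mu]_x (u x)%:E < +oo)%E ->
  is_bochner_integral (fun x => (u x)%:C *: a) ((fine (\int[mu]_x (u x)%:E))%:C *: a).
Proof.
move=> mu_ u0 ui; have muE : measurable_fun [set: RM] (EFin \o u) by exact/measurable_EFinP.
pose g := @nnsfun_approx _ RM R setT measurableT (EFin \o u) muE.
have gu x : g n x @[n --> \oo] --> u x.
  have /fine_cvgP[] // : EFin \o g ^~ x @ \oo --> (u x)%:E.
  by apply: (@cvg_nnsfun_approx _ RM R setT measurableT (EFin \o u) muE) => // ? _; rewrite lee_fin.
have gle n x : g n x <= u x.
  rewrite /g nnsfun_approxE -lee_fin; apply: le_approx => // ? _.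
  by rewrite lee_fin.
have g0 n x : 0 <= g n x by [].
have mg n : measurable_fun [set: RM] (g n) by exact: measurable_funP.
have gi n : (\int[mu]_x (g n x)%:E < +oo)%E.
  apply: le_lt_trans ui; apply: ge0_le_integral => //; try exact/measurable_EFinP.
    by move=> x _; rewrite lee_fin.
  by move=> x _; rewrite lee_fin gle.
have fmg n : fin_measurable (g n).
  split; first exact: (fimfunP (g n)).
  move=> r; rewrite -[X in measurable X]setTI.
  by apply: measurable_funP => //; exact: measurable_set1.
have fin n r : r != 0 -> (mu (g n @^-1` [set r]) < +oo)%E.
  move=> r0; have [r1|r1] := ltP 0 r.
    by apply: (markov_set r1 _ (mg n)) => //; do ?[exact: (fmg n).2|by move=> x /= ->].
  rewrite (_ : _ @^-1` _ = set0) ?measure0//; apply/seteqP; split => // x /= gx.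
  by move: r0; rewrite eq_le r1 -gx g0.
have mf : strongly_measurable (fun x => (u x)%:C *: a).
  exact: (strongly_measurable_real mu_ (strongly_measurable_cst _)).
have fga n : simple_function (fun x => (g n x)%:C *: a).
  exact: (fin_measurable_comp (fun r : R => r%:C *: a) (fmg n)).
have iga n : integrable_simple_function (fun x => (g n x)%:C *: a).
  apply: chebyshev_simple => //; rewrite inorm_real//.
  apply: lte_mul_pinfty; rewrite ?lee_fin ?rnorm_ge0//.
  by under eq_integral do rewrite ger0_norm//.
split=> //; exists (fun n x => (g n x)%:C *: a); split => //.
- apply: (@dominated_cvg0 _ (fun n x => rnorm ((u x)%:C *: a - (g n x)%:C *: a))
    (fun x => rnorm a * u x)) => //.
  + by move=> n; apply: measurable_rnorm; apply: strongly_measurableB => //; exact: integrable_simple_sm.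
  + by apply: measurable_funM => //; exact: measurable_cst.
  + move=> n x; rewrite rnorm_ge0 /= -scalerBl -rmorphB rnormZR mulrC.
    rewrite ler_wpM2l ?rnorm_ge0// ger0_norm ?subr_ge0//.
    by rewrite lerBlDr lerDl.
  + under eq_integral do rewrite EFinM.
    rewrite ge0_integralZl_EFin ?rnorm_ge0//; last by move=> x _; rewrite lee_fin.
    by apply: lte_mul_pinfty; rewrite ?lee_fin ?rnorm_ge0.
  + move=> x; rewrite (_ : (fun n => _) = (fun n => `|u x - g n x| * rnorm a)); last first.
      by apply/funext => n; rewrite -scalerBl -rmorphB rnormZR.
    rewrite -[X in _ --> X](mul0r (rnorm a)); apply: cvgM; last exact: cvg_cst.
    rewrite -(normr0 R) -(subrr (u x)); apply: cvg_norm; apply: cvgB => //.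
    exact: cvg_cst.
- have E n : simple_integral (fun x => (g n x)%:C *: a) =
      (fine (\int[mu]_x (g n x)%:E))%:C *: a.
    have [w [uw gw]] := fin_measurable_seq (fmg n).
    rewrite (simple_integral_comp (phi := fun r : R => r%:C *: a) (fmg n) uw gw); last first.
      by move=> r ra; apply: fin; apply: contra ra => /eqP ->; rewrite scale0r.
    under eq_bigr do rewrite scalerA -rmorphM.
    rewrite -scaler_suml -rmorph_sum; congr (_%:C *: a).
    rewrite integralT_nnsfun sintegralET.
    rewrite -(fsbig_widen [set` w] [set: R])//=; last first.
      move=> r [_ /= nr]; rewrite (_ : _ @^-1` _ = set0) ?measure0 ?mule0//.
      by apply/seteqP; split=> // x /= xr; apply: nr; rewrite -xr.
    rewrite -fsbig_seq// -sum_fine.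
      apply: eq_bigr => r _; have [->|r0] := eqVneq r 0; first by rewrite mul0e mulr0.
      rewrite fineM//; first by rewrite mulrC.
      by rewrite ge0_fin_numE//; exact: fin.
    move=> r _; have [->|r0] := eqVneq r 0; first by rewrite mul0e.
    by rewrite fin_numM// ge0_fin_numE//; exact: fin.
  rewrite (_ : (fun n => _) = (fun n => (fine (\int[mu]_x (g n x)%:E))%:C *: a)); last first.
    by apply/funext => n; exact: E.
  have : (\int[mu]_x (g n x)%:E)%E @[n --> \oo] --> (fine (\int[mu]_x (u x)%:E))%:E.
    rewrite fineK; last first.
      by rewrite ge0_fin_numE// integral_ge0// => x _; rewrite lee_fin.
    rewrite (_ : (\int[mu]_x (u x)%:E = \int[mu]_x limn (fun n => (g n x)%:E))%E); last first.
      apply: eq_integral => x _; apply/esym/cvg_lim => //.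
      by apply/fine_cvgP; split; [exact: nearW|exact: gu].
    apply: cvg_monotone_convergence => //.
    + by move=> n; exact/measurable_EFinP.
    + by move=> n x _; rewrite lee_fin.
    + by move=> x _ m n mn; rewrite lee_fin; exact/lefP/nd_nnsfun_approx.
  move=> /fine_cvgP[_ /cvgrPdist_lt h]; apply/cvg_rnormP.
  rewrite (_ : (fun n => _) = (fun n => `|fine (\int[mu]_x (g n x)%:E) -
      fine (\int[mu]_x (u x)%:E)| * rnorm a)); last first.
    by apply/funext => n; rewrite -scalerBl -rmorphB rnormZR.
  rewrite -[X in _ --> X](mul0r (rnorm a)); apply: cvgM; last exact: cvg_cst.
  apply/cvgrPdist_lt => e /h; apply: filterS => n /=.
  by rewrite sub0r normrN normr_id distrC.
Qed.

Lemma is_bochner_real (u : RM -> R) (a : A) :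
  mu.-integrable [set: RM] (EFin \o u) ->
  is_bochner_integral (fun x => (u x)%:C *: a) ((fine (\int[mu]_x (u x)%:E))%:C *: a).
Proof.
move=> ui; have mu_ : measurable_fun [set: RM] u.
  by apply/measurable_EFinP; exact: (measurable_int mu).
have up := integrable_funepos measurableT ui.
have un := integrable_funeneg measurableT ui.
have hp : (\int[mu]_x ((u^\+)%R x)%:E < +oo)%E.
  by have := integral_funepos_lt_pinfty measurableT ui; under eq_integral do rewrite funerpos.
have hn : (\int[mu]_x ((u^\-)%R x)%:E < +oo)%E.
  by have := integral_funeneg_lt_pinfty measurableT ui; under eq_integral do rewrite funerneg.
have h1 := ge0_is_bochner_real a (measurable_funrpos mu_) (fun x => funrpos_ge0 u x) hp.
have h2 := ge0_is_bochner_real a (measurable_funrneg mu_) (fun x => funrneg_ge0 u x) hn.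
have := is_bochnerB h1 h2.
have -> : (fun x => ((u^\+)%R x)%:C *: a - ((u^\-)%R x)%:C *: a) = (fun x => (u x)%:C *: a).
  by apply/funext => x; rewrite -scalerBl -rmorphB; congr (_%:C *: a); rewrite /funrpos /funrneg; case: (leP (u x) 0) => u0; case: (leP (- u x) 0) => u1; lra.
congr is_bochner_integral; rewrite -scalerBl -rmorphB; congr (_%:C *: a).
rewrite [in RHS]integralE [in RHS]fineB.
- by congr (fine _ - fine _); apply: eq_integral => x _; rewrite ?funerpos ?funerneg.
- by apply: integrable_pos_fin_num.
- by apply: integrable_neg_fin_num.
Qed.

End BochnerReal.

(** * Convolution *)

Section BanachAlgebra.
Variables (R : realType) (A : unitalBanachAlgType R[i]).
Implicit Types a b c : A.

Lemma bmulNl a b : bmul (- a) b = - bmul a b.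
Proof. by rewrite -scaleN1r -bscalerAl scaleN1r. Qed.

Lemma bmulNr a b : bmul a (- b) = - bmul a b.
Proof. by rewrite -scaleN1r -bscalerAr scaleN1r. Qed.

Lemma bmulBl a b c : bmul (a - b) c = bmul a c - bmul b c.
Proof. by rewrite bmulDl bmulNl. Qed.

Lemma bmulBr a b c : bmul a (b - c) = bmul a b - bmul a c.
Proof. by rewrite bmulDr bmulNr. Qed.

Lemma bmul0r a : bmul a 0 = 0.
Proof. by rewrite -{1}(subrr a) bmulBr subrr. Qed.

Lemma rnorm_bmul a b : rnorm (bmul a b) <= rnorm a * rnorm b.
Proof. by rewrite -lecR rmorphM /= -!rnormE ler_norm_bmul. Qed.

Lemma cvg_bmul (u v : nat -> A) a b : u n @[n --> \oo] --> a ->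
  v n @[n --> \oo] --> b -> bmul (u n) (v n) @[n --> \oo] --> bmul a b.
Proof.
move=> ua vb; apply/cvg_rnormP.
have h : rnorm (u n - a) * rnorm (v n) + rnorm a * rnorm (v n - b) @[n --> \oo] --> (0 : R).
  rewrite -[X in _ --> X]addr0; apply: cvgD.
    rewrite -(mul0r (rnorm b)); apply: cvgM; [exact/cvg_rnormP|exact: cvg_rnorm].
  rewrite -(mulr0 (rnorm a)); apply: cvgM; [exact: cvg_cst|exact/cvg_rnormP].
apply: squeeze_cvgr (cvg_cst (0 : R)) h; apply: nearW => n.
rewrite rnorm_ge0 /= -(subrK (bmul a (v n)) (bmul (u n) (v n))) -addrA.
by rewrite -bmulBl -bmulBr; apply: le_trans (rnormD _ _) _; apply: lerD; exact: rnorm_bmul.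
Qed.

Lemma strongly_measurable_bmul (f g : R -> A) : strongly_measurable f ->
  strongly_measurable g -> strongly_measurable (fun x => bmul (f x) (g x)).
Proof. by apply: strongly_measurable_map2 => u v a b; exact: cvg_bmul. Qed.

End BanachAlgebra.

Section ScalarConvolution.
Variables (R : realType).
Local Notation RM := (measurableTypeR R).
Local Notation mu := (@lebesgue_measure R).
Local Open Scope ereal_scope.

Lemma measurable_subM :
  measurable_fun [set: (RM * RM)%type] (fun p : RM * RM => (p.1 - p.2)%R : RM).
Proof. by apply: measurable_funB; [exact: measurable_fst|exact: measurable_snd]. Qed.

Lemma measurable_convol (u v : RM -> \bar R) :
  measurable_fun [set: RM] u -> measurable_fun [set: RM] v ->
  measurable_fun [set: (RM * RM)%type] (fun p : RM * RM => u (p.1 - p.2)%R * v p.2).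
Proof.
move=> mu_ mv; apply: emeasurable_funM.
  exact: (measurableT_comp mu_ measurable_subM).
exact: (measurableT_comp mv measurable_snd).
Qed.

Lemma tonelli_convol (u v : RM -> \bar R) :
  measurable_fun [set: RM] u -> measurable_fun [set: RM] v ->
  (forall x, 0 <= u x) -> (forall x, 0 <= v x) ->
  \int[mu]_x \int[mu]_t (u (x - t)%R * v t) = \int[mu]_x u x * \int[mu]_x v x.
Proof.
move=> mu_ mv u0 v0.
have h0 p : 0 <= u (p.1 - p.2)%R * v p.2 by rewrite mule_ge0.
rewrite (@fubini_tonelli _ _ RM RM R mu mu (fun p => u (p.1 - p.2)%R * v p.2)
  (measurable_convol mu_ mv) h0) /=.
have E t : \int[mu]_x (u (x - t)%R * v t) = \int[mu]_x u x * v t.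
  rewrite ge0_integralZr//.
    by rewrite ge0_integral_shift.
  have mt : measurable_fun [set: RM] (fun x : RM => (x - t)%R : RM).
    by apply: measurable_funB => //; exact: measurable_cst.
  exact: (measurableT_comp mu_ mt).
under eq_integral do rewrite E.
by rewrite ge0_integralZl// integral_ge0.
Qed.

Lemma measurable_integral_convol (u v : RM -> \bar R) :
  measurable_fun [set: RM] u -> measurable_fun [set: RM] v ->
  (forall x, 0 <= u x) -> (forall x, 0 <= v x) ->
  measurable_fun [set: RM] (fun x => \int[mu]_t (u (x - t)%R * v t)).
Proof.
move=> mu_ mv u0 v0.
apply: (@measurable_fun_fubini_tonelli_F _ _ RM RM R mu (fun p => u (p.1 - p.2)%R * v p.2)).
  exact: measurable_convol.
by move=> p; rewrite mule_ge0.
Qed.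

End ScalarConvolution.

Section Convolution.
Variables (R : realType) (A : unitalBanachAlgType R[i]).
Local Notation RM := (measurableTypeR R).
Local Notation mu := (@lebesgue_measure R).
Implicit Types (f g h : R -> A) (w : R -> R).

Definition in_L1 f : Prop := strongly_measurable f /\ (inorm f < +oo)%E.

Definition wnorm w f : \bar R := \int[mu]_x (rnorm (f x) * w x)%:E.

(** Finiteness at x guarantees that the integrand of the convolution at x is Bochner integrable.
    Unlike that integrability, it is governed by Tonelli's theorem. *)
Definition nconv f g (x : R) : \bar R :=
  \int[mu]_t ((rnorm (f (x - t)))%:E * (rnorm (g t))%:E)%E.

Lemma nconv_ge0 f g x : (0 <= nconv f g x)%E.
Proof. by apply: integral_ge0 => t _; rewrite mule_ge0// lee_fin rnorm_ge0. Qed.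

Lemma measurable_nconv f g : strongly_measurable f -> strongly_measurable g ->
  measurable_fun [set: RM] (nconv f g).
Proof.
move=> mf mg; apply: (measurable_integral_convol (measurable_rnormE mf) (measurable_rnormE mg)).
- by move=> x; rewrite lee_fin rnorm_ge0.
- by move=> x; rewrite lee_fin rnorm_ge0.
Qed.

Lemma integral_nconv f g : strongly_measurable f -> strongly_measurable g ->
  (\int[mu]_x nconv f g x = inorm f * inorm g)%E.
Proof.
move=> mf mg; apply: (tonelli_convol (measurable_rnormE mf) (measurable_rnormE mg)).
- by move=> x; rewrite lee_fin rnorm_ge0.
- by move=> x; rewrite lee_fin rnorm_ge0.
Qed.

Lemma strongly_measurable_integrand f g x : strongly_measurable f -> strongly_measurable g ->
  strongly_measurable (fun t => bmul (f (x - t)) (g t)).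
Proof.
move=> mf mg; apply: strongly_measurable_bmul => //.
exact: strongly_measurable_reflect.
Qed.

Lemma inorm_integrand f g (x : R) : strongly_measurable f -> strongly_measurable g ->
  (inorm (fun t => bmul (f (x - t)%R) (g t)) <= nconv f g x)%E.
Proof.
move=> mf mg; apply: inorm_le; first exact: strongly_measurable_integrand.
  apply: emeasurable_funM; last exact: measurable_rnormE.
  by apply: measurable_rnormE; exact: strongly_measurable_reflect.
by move=> t; rewrite -EFinM lee_fin rnorm_bmul.
Qed.

Lemma is_bochner_convolution f g x : strongly_measurable f -> strongly_measurable g ->
  (nconv f g x < +oo)%E ->
  is_bochner_integral (fun t => bmul (f (x - t)) (g t)) (convolution f g x).
Proof.
move=> mf mg fg; apply: is_bochner_bochner; first exact: strongly_measurable_integrand.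
exact: le_lt_trans (inorm_integrand x mf mg) fg.
Qed.

Lemma rnorm_convolution f g x : strongly_measurable f -> strongly_measurable g ->
  ((rnorm (convolution f g x))%:E <= nconv f g x)%E.
Proof.
move=> mf mg; apply: le_trans (inorm_integrand x mf mg).
by apply: bochner_integral_norm; exact: strongly_measurable_integrand.
Qed.

(** At x the convolution is a finite sum over pairs of values, the coefficient of a pair being the
    measure of the x-section of a measurable set of the plane; such coefficients are measurable in
    x. *)
Lemma simple_convolution f g : integrable_simple_function f ->
  integrable_simple_function g -> strongly_measurable (convolution f g).
Proof.
move=> [ff fi] [fg gi].
have [u [uu fu]] := fin_measurable_seq ff; have [v [vv gv]] := fin_measurable_seq fg.
pose E (p : A * A) := [set q : RM * RM | f (q.1 - q.2) = p.1 /\ g q.2 = p.2].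
have mE p : measurable (E p).
  apply: measurableI.
    have := measurable_subM measurableT (ff.2 p.1); by rewrite setTI.
  have := @measurable_snd _ _ RM RM measurableT _ (fg.2 p.2); by rewrite setTI.
pose m p x := fine (mu (xsection (E p) x)).
have mm p : measurable_fun [set: RM] (m p).
  apply: measurableT_comp; first exact: fine_measurable.
  exact: (@measurable_fun_xsection _ _ RM RM R mu).
rewrite (_ : convolution f g = fun x => \sum_(p <- [seq (a, b) | a <- u, b <- v])
    (m p x)%:C *: bmul p.1 p.2).
  apply: strongly_measurable_sum => p; apply: strongly_measurable_real => //.
  exact: strongly_measurable_cst.
apply/funext => x.
have ffx : fin_measurable (fun t => f (x - t)).
  split; first by apply: sub_finite_set ff.1 => _ [t _ <-]; exists (x - t).
  by move=> a; have := measurable_reflect x measurableT (ff.2 a); rewrite setTI.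
have fp := fin_measurable_pair ffx fg.
have sE : (fun t => bmul (f (x - t)) (g t)) =
  (fun p => bmul p.1 p.2) \o (fun t => (f (x - t), g t)) by [].
have fin (p : A * A) : bmul p.1 p.2 != 0 ->
    (mu ((fun t : R => (f (x - t)%R, g t)) @^-1` [set p]) < +oo)%E.
  move=> p0; have p20 : p.2 != 0 by apply: contra p0 => /eqP ->; rewrite bmul0r.
  apply: le_lt_trans (gi _ p20); apply: le_measure; rewrite ?inE; [exact: fp.2|exact: fg.2|].
  by move=> t /= <-.
rewrite /convolution sE (bochner_integralE (is_bochner_simple _)); last first.
  apply: chebyshev_simple; first exact: (fin_measurable_comp _ fp).
  apply: le_lt_trans (inorm_integrand x (integrable_simple_sm (conj ff fi))
    (integrable_simple_sm (conj fg gi))) _.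
  have [C hC] : exists C : R, forall t, rnorm (f t) <= C.
    exists (\sum_(a <- u) rnorm a) => t.
    have -> : \sum_(a <- u) rnorm a = rnorm (f t) + \sum_(a <- u | a != f t) rnorm a.
      by rewrite (bigD1_seq (f t) (fu t) uu).
    rewrite lerDl.
    by apply: sumr_ge0 => a _; exact: rnorm_ge0.
  apply: (@le_lt_trans _ _ (C%:E * inorm g)%E).
    rewrite -ge0_integralZl_EFin//; last 3 first.
    - by move=> t _; rewrite lee_fin rnorm_ge0.
    - by apply: measurable_rnormE; exact: strongly_measurable_simple.
    - exact: le_trans (rnorm_ge0 _) (hC 0).
    apply: ge0_le_integral => //.
    - by move=> t _; rewrite mule_ge0// lee_fin rnorm_ge0.
    - apply: emeasurable_funM; last by apply: measurable_rnormE; exact: strongly_measurable_simple.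
      by apply: measurable_rnormE; apply: strongly_measurable_reflect; exact: strongly_measurable_simple.
    - by apply: measurable_funeM; apply: measurable_rnormE; exact: strongly_measurable_simple.
    - by move=> t _; rewrite -!EFinM lee_fin ler_wpM2r ?rnorm_ge0.
  apply: lte_mul_pinfty => //; first by rewrite lee_fin; exact: le_trans (rnorm_ge0 _) (hC 0).
  exact: inorm_simple_lty (conj fg gi).
rewrite (simple_integral_comp (u := [seq (a, b) | a <- u, b <- v]) fp _ _ fin); last 2 first.
- by apply: allpairs_uniq => // -[a b] [a' b'] _ _ [-> ->].
- by move=> t; apply: allpairs_f.
apply: eq_bigr => -[a b] _; congr ((fine (mu _))%:C *: _).
apply/seteqP; split=> t; rewrite /xsection /= inE /E /=; first by case=> -> ->.
by case=> -> ->.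
Qed.

(* Cut off where the scalar convolution of the norms is infinite; there the
   convolution itself may still be a Bochner integral. *)
Definition tconv f g (x : R) : A :=
  if (nconv f g x < +oo)%E then convolution f g x else 0.

(** Simple approximants of f and g have strongly measurable convolutions, which converge to that of
    f and g at each x where [nconv f g x] is finite, by dominated convergence in the integration
    variable. *)
Lemma strongly_measurable_tconv f g : in_L1 f -> in_L1 g ->
  strongly_measurable (tconv f g).
Proof.
move=> [mf fi] [mg gi].
have [s [is_ sf s2 _]] := bochner_approx mf fi.
have [t [it tg t2 _]] := bochner_approx mg gi.
pose b x : bool := (nconv f g x < +oo)%E.
have mb : measurable ([set x | b x] : set RM).
  apply: measurable_set_bool.
  apply: measurable_fun_lte; [exact: measurable_nconv|exact: measurable_cst].
apply: (@strongly_measurable_cvg _ _ (fun n x => if b x then convolution (s n) (t n) x else 0)).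
  move=> n; apply: strongly_measurable_if => //; last exact: strongly_measurable_cst.
  exact: simple_convolution.
move=> x; have -> : tconv f g x = if b x then convolution f g x else 0 by [].
case: (boolP (b x)) => [bx|_]; last exact: cvg_cst.
have ms n := integrable_simple_sm (is_ n).
have mt n := integrable_simple_sm (it n).
have mi := strongly_measurable_integrand x mf mg.
(* The approximants are at most twice as large as f and g, so the difference of the two products is
   at most [2 * 2 + 1] times the product of the norms. *)
have mfg : measurable_fun [set: RM] (fun y => 5 * (rnorm (f (x - y)) * rnorm (g y))).
  apply: measurable_funM; first exact: measurable_cst.
  apply: measurable_funM; last exact: measurable_rnorm.
  by apply: measurable_rnorm; exact: strongly_measurable_reflect.
apply: bochner_cvg => //.
- by move=> n; exact: strongly_measurable_integrand.
- exact: le_lt_trans (inorm_integrand x mf mg) bx.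
apply: (@dominated_cvg0 _ (fun n y => rnorm (bmul (s n (x - y)) (t n y) - bmul (f (x - y)) (g y)))
  (fun y => 5 * (rnorm (f (x - y)) * rnorm (g y)))) => //.
- move=> n; apply: measurable_rnorm; apply: strongly_measurableB => //.
  exact: strongly_measurable_integrand.
- move=> n y; rewrite rnorm_ge0 /=; apply: le_trans (rnormD _ _) _; rewrite rnormN.
  have h1 := rnorm_bmul (s n (x - y)) (t n y).
  have h2 := rnorm_bmul (f (x - y)) (g y).
  have h3 : rnorm (s n (x - y)) * rnorm (t n y) <=
      (2 * rnorm (f (x - y))) * (2 * rnorm (g y)).
    by apply: ler_pM => //; exact: rnorm_ge0.
  nra.
- under eq_integral do rewrite EFinM EFinM.
  rewrite ge0_integralZl_EFin//; last 2 first.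
  + by move=> y _; rewrite mule_ge0// lee_fin rnorm_ge0.
  + apply: emeasurable_funM; last exact: measurable_rnormE.
    by apply: measurable_rnormE; exact: strongly_measurable_reflect.
  exact: lte_mul_pinfty.
- by move=> y; apply/cvg_rnormP; exact: (cvg_bmul (sf (x - y)) (tg y)).
Qed.

Lemma rnorm_tconv f g x : strongly_measurable f -> strongly_measurable g ->
  ((rnorm (tconv f g x))%:E <= nconv f g x)%E.
Proof.
move=> mf mg; rewrite /tconv; case: ifP => _; first exact: rnorm_convolution.
by rewrite rnorm0 nconv_ge0.
Qed.

Lemma nconv_lty_ae f g : in_L1 f -> in_L1 g ->
  {ae mu, forall x, (nconv f g x < +oo)%E}.
Proof.
move=> [mf fi] [mg gi].
have h : mu.-integrable [set: RM] (nconv f g).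
  apply/integrableP; split; first exact: measurable_nconv.
  under eq_integral do rewrite gee0_abs ?nconv_ge0//.
  rewrite integral_nconv//.
  have f0 := inorm_ge0 f; have g0 := inorm_ge0 g.
  rewrite -(fineK (x := inorm f)) ?ge0_fin_numE//.
  by rewrite lte_mul_pinfty// lee_fin fine_ge0.
have := integrable_ae measurableT h; apply: ae_imply => x /(_ I).
by rewrite ge0_fin_numE ?nconv_ge0.
Qed.

Lemma tconv_ae f g : in_L1 f -> in_L1 g -> ae_equal (tconv f g) (convolution f g).
Proof.
by move=> Lf Lg; apply: ae_imply (nconv_lty_ae Lf Lg) => x; rewrite /tconv => ->.
Qed.

Lemma in_L1_tconv f g : in_L1 f -> in_L1 g -> in_L1 (tconv f g).
Proof.
move=> Lf Lg; have [mf fi] := Lf; have [mg gi] := Lg.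
split; first exact: strongly_measurable_tconv.
apply: (@le_lt_trans _ _ (inorm f * inorm g)%E).
  rewrite -integral_nconv//; apply: inorm_le.
  - exact: strongly_measurable_tconv.
  - exact: measurable_nconv.
  - by move=> x; exact: rnorm_tconv.
have f0 := inorm_ge0 f; have g0 := inorm_ge0 g.
rewrite -(fineK (x := inorm f)) ?ge0_fin_numE//.
by rewrite lte_mul_pinfty// lee_fin fine_ge0.
Qed.

Lemma measurable_wnorm w f : measurable_fun [set: RM] w -> strongly_measurable f ->
  measurable_fun [set: RM] (fun x => (rnorm (f x) * w x)%:E).
Proof.
move=> mw mf; apply/measurable_EFinP; apply: measurable_funM => //.
exact: measurable_rnorm.
Qed.

Lemma wnorm_tconv w f g : weight w -> in_L1 f -> in_L1 g ->
  (wnorm w (tconv f g) <= wnorm w f * wnorm w g)%E.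
Proof.
move=> [mw w1 wM] Lf Lg; have [mf fi] := Lf; have [mg gi] := Lg.
have w0 x : 0 <= w x by apply: le_trans (w1 x).
have nw0 h x : (0 <= (rnorm (h x) * w x)%:E)%E by rewrite lee_fin mulr_ge0 ?rnorm_ge0.
have mfw := measurable_wnorm mw mf; have mgw := measurable_wnorm mw mg.
rewrite /wnorm -(tonelli_convol mfw mgw (nw0 f) (nw0 g)).
apply: ge0_le_integral => //.
- by apply: measurable_wnorm => //; exact: strongly_measurable_tconv.
- exact: (measurable_integral_convol mfw mgw (nw0 f) (nw0 g)).
move=> x _; rewrite EFinM.
apply: (@le_trans _ _ (nconv f g x * (w x)%:E)%E).
  by rewrite lee_wpmul2r ?lee_fin//; exact: rnorm_tconv.
have mi : measurable_fun [set: RM] (fun t => ((rnorm (f (x - t)%R))%:E * (rnorm (g t))%:E)%E).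
  apply: emeasurable_funM; last exact: measurable_rnormE.
  by apply: measurable_rnormE; exact: strongly_measurable_reflect.
have i0 t : (0 <= (rnorm (f (x - t)%R))%:E * (rnorm (g t))%:E)%E.
  by rewrite mule_ge0// lee_fin rnorm_ge0.
rewrite /nconv -ge0_integralZr//; last by rewrite lee_fin.
apply: ge0_le_integral => //.
- by move=> t _; rewrite mule_ge0// lee_fin.
- by apply: emeasurable_funM => //; exact: measurable_cst.
- apply: emeasurable_funM => //.
  exact: (measurableT_comp mfw (measurable_reflect x)).
move=> t _; rewrite -!EFinM lee_fin.
have h := wM (x - t) t; rewrite subrK in h.
have f0 := rnorm_ge0 (f (x - t)); have g0 := rnorm_ge0 (g t).
rewrite [leRHS](_ : _ = rnorm (f (x - t)) * rnorm (g t) * (w (x - t) * w t)); last by ring.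
by rewrite ler_wpM2l// mulr_ge0.
Qed.

Lemma convolutionBl f g h x : strongly_measurable f -> strongly_measurable g ->
  strongly_measurable h -> (nconv f h x < +oo)%E -> (nconv g h x < +oo)%E ->
  convolution (fun y => f y - g y) h x = convolution f h x - convolution g h x.
Proof.
move=> mf mg mh fh gh; apply: bochner_integralE.
have := is_bochnerB (is_bochner_convolution mf mh fh) (is_bochner_convolution mg mh gh).
by congr is_bochner_integral; apply/funext => t; rewrite bmulBl.
Qed.

Lemma convolutionBr f g h x : strongly_measurable f -> strongly_measurable g ->
  strongly_measurable h -> (nconv h f x < +oo)%E -> (nconv h g x < +oo)%E ->
  convolution h (fun y => f y - g y) x = convolution h f x - convolution h g x.
Proof.
move=> mf mg mh fh gh; apply: bochner_integralE.
have := is_bochnerB (is_bochner_convolution mh mf fh) (is_bochner_convolution mh mg gh).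
by congr is_bochner_integral; apply/funext => t; rewrite bmulBr.
Qed.

(** The reflection [t -> x - t] exchanges the two arguments, and a multiple of the unit commutes
    with every value of f. *)
Lemma convolution_central (phi : R -> R[i]) f x :
  convolution (fun y => phi y *: (bone : A)) f x =
  convolution f (fun y => phi y *: (bone : A)) x.
Proof.
rewrite /convolution -(bochner_integral_reflect _ x).
congr bochner_integral; apply/funext => t.
by rewrite opprB addrCA subrr addr0 -bscalerAl -bscalerAr bmul1l bmul1r.
Qed.

End Convolution.

(** * The convolution algebra L^1 *)

Section AlmostEverywhere.
Variables (R : realType) (A : unitalBanachAlgType R[i]).
Local Notation RM := (measurableTypeR R).
Local Notation mu := (@lebesgue_measure R).
Implicit Types (f g h : R -> A).

Lemma ae_equal_refl f : ae_equal f f.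
Proof. by apply: aeW. Qed.

Lemma ae_equal_sym f g : ae_equal f g -> ae_equal g f.
Proof. by apply: ae_imply => x ->. Qed.

Lemma ae_equal_trans g f h : ae_equal f g -> ae_equal g h -> ae_equal f h.
Proof. by move=> fg gh; apply: ae_imply (ae_and fg gh) => x [-> ->]. Qed.

Lemma negligible_reflect (x : R) (E : set RM) : mu.-negligible E ->
  mu.-negligible ((fun t => x - t) @^-1` E).
Proof.
move=> [F [mF F0 EF]]; exists ((fun t => x - t) @^-1` F); split.
- by have := measurable_reflect x measurableT mF; rewrite setTI.
- exact: eq_trans (lebesgue_measure_reflect x mF) F0.
- by move=> t /= /EF.
Qed.

Lemma ae_integrand f f' g g' (x : R) : ae_equal f f' -> ae_equal g g' ->
  {ae mu, forall t : R, f (x - t) = f' (x - t) /\ g t = g' t}.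
Proof. by move=> /(negligible_reflect x) ff gg; exact: (ae_and ff gg). Qed.

(** The equality holds at every point: at each x the two integrands differ on a null set only, which
    affects neither the cut-off nor the Bochner integral. *)
Lemma tconv_congr f f' g g' : strongly_measurable f -> strongly_measurable f' ->
  strongly_measurable g -> strongly_measurable g' ->
  ae_equal f f' -> ae_equal g g' -> tconv f g = tconv f' g'.
Proof.
move=> mf mf' mg mg' ff gg; apply/funext => x.
have h := ae_integrand x ff gg.
have mi k l : strongly_measurable k -> strongly_measurable l ->
    measurable_fun [set: RM] (fun t => ((rnorm (k (x - t) : A))%:E * (rnorm (l t : A))%:E)%E).
  move=> mk ml; apply: emeasurable_funM; last exact: measurable_rnormE.
  by apply: measurable_rnormE; exact: strongly_measurable_reflect.
have E : nconv f g x = nconv f' g' x.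
  apply: ae_eq_integral => //; [exact: mi|exact: mi|].
  by apply: ae_imply h => t [-> ->].
have H (b b' : bool) (c c' : A) : b = b' -> c = c' ->
  (if b then c else 0) = (if b' then c' else 0) by move=> -> ->.
apply: (H (nconv f g x < +oo)%E (nconv f' g' x < +oo)%E (convolution f g x) (convolution f' g' x)).
  by apply: (congr1 (fun z => z < +oo)%E).
rewrite /convolution /bochner_integral.
congr xget; apply/seteqP; split=> v /= hv; apply: (ae_is_bochner hv).
- exact: strongly_measurable_integrand.
- by apply: ae_imply h => t [-> ->].
- exact: strongly_measurable_integrand.
- by apply: ae_imply h => t [-> ->].
Qed.

Lemma in_L1B f g : in_L1 f -> in_L1 g -> in_L1 (fun x => f x - g x).
Proof.
move=> [mf fi] [mg gi]; split; first exact: strongly_measurableB.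
apply: le_lt_trans (inormD mf (strongly_measurableN mg)) _.
by apply: lte_add_pinfty => //; rewrite inormN.
Qed.

Lemma in_L1N f : in_L1 f -> in_L1 (fun x => - f x).
Proof. by move=> [mf fi]; split; [exact: strongly_measurableN|rewrite inormN]. Qed.

Lemma in_L1D f g : in_L1 f -> in_L1 g -> in_L1 (fun x => f x + g x).
Proof.
move=> Lf /in_L1N Lg; have := in_L1B Lf Lg.
by congr in_L1; apply/funext => x; rewrite opprK.
Qed.

Lemma in_L10 : in_L1 (fun=> 0 : A).
Proof.
split; first exact: strongly_measurable_cst.
by rewrite /inorm; under eq_integral do rewrite rnorm0; rewrite integral0.
Qed.

End AlmostEverywhere.

Section L1Type.
Variables (R : realType) (A : unitalBanachAlgType R[i]).
Implicit Types (f g h : R -> A).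

Definition l1rep f : R -> A := xget (fun=> 0) [set g | in_L1 g /\ ae_equal f g].

(* A class modulo a.e. equality is represented by its canonical member, so that
   Leibniz equality of [L1] is a.e. equality. *)
Record L1 := MkL1 { l1fun :> R -> A; _ : in_L1 l1fun /\ l1rep l1fun = l1fun }.

HB.instance Definition _ := gen_eqMixin L1.
HB.instance Definition _ := gen_choiceMixin L1.

Lemma L1P (x : L1) : in_L1 x. Proof. by case: x => f []. Qed.

Lemma l1repP f : in_L1 f -> in_L1 (l1rep f) /\ ae_equal f (l1rep f).
Proof.
move=> Lf; apply: (@xgetPex _ (fun=> 0) [set g | in_L1 g /\ ae_equal f g]).
by exists f; split => //; exact: ae_equal_refl.
Qed.

Lemma l1rep_congr f g : ae_equal f g -> l1rep f = l1rep g.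
Proof.
move=> fg; rewrite /l1rep; congr xget; apply/seteqP; split=> h /= [Lh hh]; split => //.
- exact: ae_equal_trans (ae_equal_sym fg) hh.
- exact: ae_equal_trans fg hh.
Qed.

Lemma l1rep_id f : in_L1 f -> in_L1 (l1rep f) /\ l1rep (l1rep f) = l1rep f.
Proof. by move=> /l1repP[Lf ff]; split=> //; exact/esym/l1rep_congr. Qed.

End L1Type.

(** A function outside L^1 is sent to the class of 0. *)
HB.lock Definition cls (R : realType) (A : unitalBanachAlgType R[i]) (f : R -> A) : L1 A :=
  match pselect (in_L1 f) with
  | left Lf => MkL1 (l1rep_id Lf)
  | right _ => MkL1 (l1rep_id (in_L10 A))
  end.

Section L1Zmodule.
Variables (R : realType) (A : unitalBanachAlgType R[i]).
Local Notation L1 := (L1 A).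
Implicit Types (f g h : R -> A).

Lemma L1_eq (x y : L1) : ae_equal x y -> x = y.
Proof.
case: x y => f [Lf ff] [g [Lg gg]] /= /l1rep_congr fg.
rewrite ff gg in fg; subst g; congr MkL1; exact: Prop_irrelevance.
Qed.

Lemma clsE f : in_L1 f -> ae_equal f (cls f).
Proof. by move=> Lf; rewrite unlock; case: pselect => // Lf'; have [] := l1repP Lf'. Qed.

Lemma cls_eq f g : in_L1 f -> in_L1 g -> ae_equal f g -> cls f = cls g.
Proof.
move=> Lf Lg fg; apply: L1_eq; apply: ae_equal_trans (clsE Lg).
by apply: ae_equal_trans fg; apply: ae_equal_sym; exact: clsE.
Qed.

Lemma clsK (x : L1) : cls x = x.
Proof. by apply: L1_eq; apply: ae_equal_sym; apply: clsE; exact: L1P. Qed.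

Lemma clsP f g : in_L1 f -> in_L1 g -> cls f = cls g -> ae_equal f g.
Proof.
move=> Lf Lg fg; apply: ae_equal_trans (clsE Lf) _; rewrite fg.
by apply: ae_equal_sym; exact: clsE.
Qed.

Definition l1add (x y : L1) := cls (fun t => x t + y t).
Definition l1opp (x : L1) := cls (fun t => - x t).
Definition l10 : L1 := cls (fun=> 0 : A).

Lemma l1addE (x y : L1) : ae_equal (fun t => x t + y t) (l1add x y).
Proof. by apply: clsE; apply: in_L1D; exact: L1P. Qed.

Lemma l1oppE (x : L1) : ae_equal (fun t => - x t) (l1opp x).
Proof. by apply: clsE; apply: in_L1N; exact: L1P. Qed.

Lemma l10E : ae_equal (fun=> 0) l10.
Proof. by apply: clsE; exact: in_L10. Qed.

Lemma l1addA : associative l1add.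
Proof.
move=> x y z; apply: L1_eq.
apply: ae_imply (ae_and (ae_and (l1addE x (l1add y z)) (l1addE y z))
  (ae_and (l1addE (l1add x y) z) (l1addE x y))) => t [[<- <-] [<- <-]].
exact: addrA.
Qed.

Lemma l1addC : commutative l1add.
Proof.
move=> x y; apply: L1_eq; apply: ae_imply (ae_and (l1addE x y) (l1addE y x)) => t [<- <-].
exact: addrC.
Qed.

Lemma l1add0 : left_id l10 l1add.
Proof.
move=> x; apply: L1_eq; apply: ae_imply (ae_and (l1addE l10 x) l10E) => t [<- <-].
exact: add0r.
Qed.

Lemma l1addN : left_inverse l10 l1opp l1add.
Proof.
move=> x; apply: L1_eq; apply: ae_imply (ae_and (l1addE (l1opp x) x) (ae_and l10E (l1oppE x))) => t [<- [<- <-]].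
exact: addNr.
Qed.

HB.instance Definition _ := GRing.isZmodule.Build L1 l1addA l1addC l1add0 l1addN.

Lemma L1D (x y : L1) : ae_equal (fun t => x t + y t) (x + y).
Proof. exact: l1addE. Qed.

Lemma L1N (x : L1) : ae_equal (fun t => - x t) (- x).
Proof. exact: l1oppE. Qed.

Lemma L1B (x y : L1) : ae_equal (fun t => x t - y t) (x - y).
Proof. by apply: ae_imply (ae_and (L1D x (- y)) (L1N y)) => t [<- <-]. Qed.

Lemma clsB f g : in_L1 f -> in_L1 g -> cls (fun t => f t - g t) = cls f - cls g.
Proof.
move=> Lf Lg; apply: L1_eq.
apply: ae_imply (ae_and (ae_and (clsE Lf) (clsE Lg)) (ae_and (L1B (cls f) (cls g)) (clsE (in_L1B Lf Lg)))).
by move=> t [[ft gt] [<- <-]]; rewrite ft gt.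
Qed.

Lemma cls0 : cls (fun=> 0 : A) = 0. Proof. by []. Qed.

Lemma clsD f g : in_L1 f -> in_L1 g -> cls (fun t => f t + g t) = cls f + cls g.
Proof.
move=> Lf Lg; apply: L1_eq.
apply: ae_imply (ae_and (ae_and (clsE Lf) (clsE Lg)) (ae_and (L1D (cls f) (cls g)) (clsE (in_L1D Lf Lg)))).
by move=> t [[ft gt] [<- <-]]; rewrite ft gt.
Qed.

Lemma cls_sum (I : Type) (r : seq I) (F : I -> R -> A) : (forall i, in_L1 (F i)) ->
  in_L1 (fun t => \sum_(i <- r) F i t) /\
  cls (fun t => \sum_(i <- r) F i t) = \sum_(i <- r) cls (F i).
Proof.
move=> LF; elim: r => [|i r [Lr ih]].
  rewrite big_nil (_ : (fun t => _) = (fun=> 0)); first by split=> //; exact: in_L10.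
  by apply/funext => t; rewrite big_nil.
rewrite big_cons -ih -clsD// (_ : (fun t => _) = (fun t => F i t + \sum_(j <- r) F j t)).
  by split=> //; exact: in_L1D.
by apply/funext => t; rewrite big_cons.
Qed.

End L1Zmodule.

HB.lock Definition l1mul (R : realType) (A : unitalBanachAlgType R[i]) (x y : L1 A) : L1 A :=
  cls (tconv x y).

(** Elements of all the weighted spaces live in the single type [L1]; membership in L^1(w) is
    finiteness of this extended norm, so changing the weight requires no coercion. *)
HB.lock Definition nrm (R : realType) (A : unitalBanachAlgType R[i]) (w : R -> R) (x : L1 A) :
  \bar R := wnorm w x.

Section L1Algebra.
Variables (R : realType) (A : unitalBanachAlgType R[i]).
Local Notation RM := (measurableTypeR R).
Local Notation mu := (@lebesgue_measure R).
Local Notation L1 := (L1 A).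
Implicit Types (f g h : R -> A) (x y z : L1).
Local Notation "x ** y" := (l1mul x y) (at level 40, left associativity).

Lemma l1mulE x y : x ** y = cls (tconv x y).
Proof. by rewrite unlock. Qed.

Lemma nrmE w x : nrm w x = wnorm w x.
Proof. by rewrite unlock. Qed.

Lemma l1mul_cls f g : in_L1 f -> in_L1 g -> cls f ** cls g = cls (tconv f g).
Proof.
move=> Lf Lg; rewrite l1mulE; apply: (congr1 (@cls R A)).
have [mf _] := Lf; have [mg _] := Lg.
have [mf' _] := L1P (cls f); have [mg' _] := L1P (cls g).
by apply: tconv_congr => //; apply: ae_equal_sym; exact: clsE.
Qed.

Lemma l1mulBl x y z : (x - y) ** z = x ** z - y ** z.
Proof.
have Lx := L1P x; have Ly := L1P y; have Lz := L1P z.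
rewrite -{1}(clsK x) -{1}(clsK y) -{1}(clsK z) -clsB// l1mul_cls//; last exact: in_L1B.
rewrite !l1mulE -clsB; [|exact: in_L1_tconv..].
apply: cls_eq; [by apply: in_L1_tconv => //; exact: in_L1B|by apply: in_L1B; exact: in_L1_tconv|].
apply: ae_imply (ae_and (tconv_ae (in_L1B Lx Ly) Lz) (ae_and (nconv_lty_ae Lx Lz) (nconv_lty_ae Ly Lz))).
move=> t [-> [hx hy]]; rewrite /tconv hx hy.
by apply: convolutionBl => //; [exact: Lx.1|exact: Ly.1|exact: Lz.1].
Qed.

Lemma l1mulBr x y z : z ** (x - y) = z ** x - z ** y.
Proof.
have Lx := L1P x; have Ly := L1P y; have Lz := L1P z.
rewrite -{1}(clsK x) -{1}(clsK y) -{1}(clsK z) -clsB// l1mul_cls//; last exact: in_L1B.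
rewrite !l1mulE -clsB; [|exact: in_L1_tconv..].
apply: cls_eq; [by apply: in_L1_tconv => //; exact: in_L1B|by apply: in_L1B; exact: in_L1_tconv|].
apply: ae_imply (ae_and (tconv_ae Lz (in_L1B Lx Ly)) (ae_and (nconv_lty_ae Lz Lx) (nconv_lty_ae Lz Ly))).
move=> t [-> [hx hy]]; rewrite /tconv hx hy.
by apply: convolutionBr => //; [exact: Lx.1|exact: Ly.1|exact: Lz.1].
Qed.

Lemma l1mul0l z : 0 ** z = 0.
Proof. by rewrite -{1}(subrr z) l1mulBl subrr. Qed.

Lemma l1mul0r z : z ** 0 = 0.
Proof. by rewrite -{1}(subrr z) l1mulBr subrr. Qed.

Lemma l1mulNl x z : (- x) ** z = - (x ** z).
Proof. by rewrite -sub0r l1mulBl l1mul0l sub0r. Qed.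

Lemma l1mulNr x z : z ** (- x) = - (z ** x).
Proof. by rewrite -sub0r l1mulBr l1mul0r sub0r. Qed.

Lemma l1mulDl x y z : (x + y) ** z = x ** z + y ** z.
Proof. by rewrite -{1}(opprK y) l1mulBl l1mulNl opprK. Qed.

Lemma l1mulDr x y z : z ** (x + y) = z ** x + z ** y.
Proof. by rewrite -{1}(opprK y) l1mulBr l1mulNr opprK. Qed.

Lemma l1mul_suml (I : Type) (r : seq I) (F : I -> L1) z :
  (\sum_(i <- r) F i) ** z = \sum_(i <- r) F i ** z.
Proof.
by elim: r => [|i r ih]; rewrite ?big_nil ?l1mul0l// !big_cons l1mulDl ih.
Qed.

Lemma wnorm_ae w f g : measurable_fun [set: RM] w -> strongly_measurable f ->
  strongly_measurable g -> ae_equal f g -> wnorm w f = wnorm w g.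
Proof.
move=> mw mf mg fg; apply: ae_eq_integral => //; [exact: measurable_wnorm|exact: measurable_wnorm|].
by apply: ae_imply fg => t ->.
Qed.

Lemma nrm_cls w f : weight w -> in_L1 f -> nrm w (cls f) = wnorm w f.
Proof.
move=> [mw _ _] Lf; rewrite nrmE; apply: wnorm_ae => //; [exact: (L1P _).1|exact: Lf.1|].
by apply: ae_equal_sym; exact: clsE.
Qed.

Lemma weight_ge0 (w : R -> R) (t : R) : weight w -> 0 <= w t.
Proof. by move=> [_ h _]; exact: le_trans (h t). Qed.

Lemma nrm_ge0 w x : weight w -> (0 <= nrm w x)%E.
Proof.
by move=> hw; rewrite nrmE; apply: integral_ge0 => t _; rewrite lee_fin mulr_ge0 ?rnorm_ge0 ?weight_ge0.
Qed.

Lemma nrmN w x : weight w -> nrm w (- x) = nrm w x.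
Proof.
move=> hw; have [mw _ _] := hw; have Lx := L1P x.
have -> : - x = cls (fun t => - x t) by [].
rewrite nrm_cls ?nrmE//; last exact: in_L1N.
by apply: eq_integral => t _; rewrite rnormN.
Qed.

Lemma nrmD w x y : weight w -> (nrm w (x + y)%R <= nrm w x + nrm w y)%E.
Proof.
move=> hw; have [mw w1 _] := hw; have Lx := L1P x; have Ly := L1P y.
have -> : (x + y)%R = cls (fun t => x t + y t) by [].
rewrite nrm_cls//; last exact: in_L1D.
have p0 (z : L1) t : (0 <= (rnorm (z t) * w t)%:E)%E.
  by rewrite lee_fin mulr_ge0 ?rnorm_ge0 ?weight_ge0.
have mz (z : L1) : measurable_fun [set: RM] (fun t => (rnorm (z t) * w t)%:E).
  by apply: measurable_wnorm => //; exact: (L1P z).1.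
rewrite !nrmE /wnorm -ge0_integralD//; try exact: mz.
apply: ge0_le_integral => //.
- by move=> t _; rewrite lee_fin mulr_ge0 ?rnorm_ge0 ?weight_ge0.
- apply: measurable_wnorm => //; apply: strongly_measurableD; exact: (L1P _).1.
- by apply: emeasurable_funD; exact: mz.
- by move=> t _; rewrite -EFinD lee_fin -mulrDl ler_wpM2r ?rnormD ?weight_ge0.
Qed.

Lemma nrmM w x y : weight w -> (nrm w (x ** y) <= nrm w x * nrm w y)%E.
Proof.
move=> hw; have Lx := L1P x; have Ly := L1P y.
rewrite l1mulE nrm_cls//; last exact: in_L1_tconv.
by rewrite !nrmE; exact: wnorm_tconv.
Qed.

Lemma weight1 : weight (fun=> 1 : R).
Proof. by split=> [|x|x y]; [exact: measurable_cst| |rewrite mulr1]. Qed.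

Lemma wnorm1 f : wnorm (fun=> 1) f = inorm f.
Proof. by apply: eq_integral => x _; rewrite mulr1. Qed.

Lemma nrm1_lty x : (nrm (fun=> 1%R) x < +oo)%E.
Proof. by rewrite nrmE wnorm1; exact: (L1P x).2. Qed.

Lemma wnorm_mono (w w' : R -> R) f : weight w -> weight w' -> strongly_measurable f ->
  (forall t, w t <= w' t) -> (wnorm w f <= wnorm w' f)%E.
Proof.
move=> hw hw' mf ww; have [mw _ _] := hw; have [mw' _ _] := hw'.
apply: ge0_le_integral => //.
- by move=> t _; rewrite lee_fin mulr_ge0 ?rnorm_ge0 ?weight_ge0.
- exact: measurable_wnorm.
- exact: measurable_wnorm.
- by move=> t _; rewrite lee_fin ler_wpM2l ?rnorm_ge0.
Qed.

Lemma nrm1_le w x : weight w -> (nrm (fun=> 1%R) x <= nrm w x)%E.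
Proof.
move=> hw; rewrite !nrmE; apply: wnorm_mono => //; [exact: weight1|exact: (L1P x).1|].
by have [] := hw.
Qed.

Lemma nrm1_eq0 x : nrm (fun=> 1%R) x = 0%E -> x = 0.
Proof.
rewrite nrmE wnorm1 => h; apply: L1_eq; have [mx _] := L1P x.
have h' : (\int[mu]_t `|(rnorm (x t))%:E| = 0)%E.
  by rewrite -[RHS]h; apply: eq_integral => t _; rewrite gee0_abs ?lee_fin ?rnorm_ge0.
have /(ae_eq_integral_abs mu measurableT (measurable_rnormE mx)) h0 := h'.
have h1 : {ae mu, forall t, rnorm (x t) = 0} by move: h0; apply: negligibleS => t /= nt k; apply: nt; case: (k I).
by apply: ae_imply (ae_and h1 (l10E A)) => t [xt <-]; exact: rnorm0_eq0.
Qed.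

End L1Algebra.

(** * Convolution of bounded integrable real functions *)

Section RealConvolution.
Variable R : realType.
Local Notation RM := (measurableTypeR R).
Local Notation mu := (@lebesgue_measure R).
Implicit Types (u v z : RM -> R).

(** Boundedness of one factor and integrability of the other make the convolution finite at every
    point, so that associativity holds without exceptional null sets. *)
Definition bounded_L1 u : Prop :=
  [/\ measurable_fun [set: RM] u, forall x, 0 <= u x, exists C, forall x, u x <= C
    & (\int[mu]_x (u x)%:E < +oo)%E].

Definition rconv u v (x : RM) : R := fine (\int[mu]_t ((u (x - t))%:E * (v t)%:E)%E).

Lemma bounded_L1_reflect u x : bounded_L1 u ->
  measurable_fun [set: RM] (fun t : RM => (u (x - t))%:E).
Proof.
move=> [mu_ _ _ _]; apply/measurable_EFinP.
exact: (measurableT_comp mu_ (measurable_reflect x)).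
Qed.

Lemma rconv_bound u v C x : bounded_L1 u -> bounded_L1 v -> (forall x, u x <= C) ->
  (\int[mu]_t ((u (x - t)%R)%:E * (v t)%:E) <= C%:E * \int[mu]_t (v t)%:E)%E.
Proof.
move=> nu nv uC; have [mu_ u0 _ _] := nu; have [mv v0 _ vi] := nv.
have mvE : measurable_fun [set: RM] (fun t => (v t)%:E) by exact/measurable_EFinP.
have C0 : 0 <= C by exact: le_trans (u0 0) (uC 0).
rewrite -ge0_integralZl_EFin//; last by move=> t _; rewrite lee_fin.
apply: ge0_le_integral => //.
- by move=> t _; rewrite mule_ge0// lee_fin.
- by apply: emeasurable_funM => //; exact: bounded_L1_reflect.
- exact: measurable_funeM.
- by move=> t _; rewrite -!EFinM lee_fin ler_wpM2r.
Qed.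

Lemma rconv_fin u v x : bounded_L1 u -> bounded_L1 v ->
  (\int[mu]_t ((u (x - t)%R)%:E * (v t)%:E) < +oo)%E.
Proof.
move=> nu nv; have [_ u0 [C uC] _] := nu; have [_ _ _ vi] := nv.
apply: le_lt_trans (rconv_bound x nu nv uC) _.
by apply: lte_mul_pinfty => //; rewrite lee_fin; exact: le_trans (u0 0) (uC 0).
Qed.

Lemma rconvE u v x : bounded_L1 u -> bounded_L1 v ->
  ((rconv u v x)%:E = \int[mu]_t ((u (x - t)%R)%:E * (v t)%:E))%E.
Proof.
move=> nu nv; rewrite /rconv fineK// ge0_fin_numE; first exact: rconv_fin.
have [_ u0 _ _] := nu; have [_ v0 _ _] := nv.
by apply: integral_ge0 => t _; rewrite mule_ge0// lee_fin.
Qed.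

Lemma bounded_L1_rconv u v : bounded_L1 u -> bounded_L1 v -> bounded_L1 (rconv u v).
Proof.
move=> nu nv; have [mu_ u0 [C uC] ui] := nu; have [mv v0 _ vi] := nv.
have muE : measurable_fun [set: RM] (fun t => (u t)%:E) by exact/measurable_EFinP.
have mvE : measurable_fun [set: RM] (fun t => (v t)%:E) by exact/measurable_EFinP.
split.
- apply: measurableT_comp; first exact: fine_measurable.
  by apply: (measurable_integral_convol muE mvE) => x; rewrite lee_fin.
- move=> x; apply: fine_ge0; apply: integral_ge0 => t _; rewrite mule_ge0// lee_fin//.
- exists (C * fine (\int[mu]_t (v t)%:E)) => x; rewrite -lee_fin rconvE// EFinM fineK.
    exact: rconv_bound.
  by rewrite ge0_fin_numE// integral_ge0// => t _; rewrite lee_fin.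
- under eq_integral do rewrite rconvE//.
  rewrite (tonelli_convol muE mvE); [|by move=> x; rewrite lee_fin..].
  rewrite -(fineK (x := \int[mu]_x (u x)%:E)%E).
    by apply: lte_mul_pinfty => //; rewrite lee_fin fine_ge0// integral_ge0// => t _; rewrite lee_fin.
  by rewrite ge0_fin_numE// integral_ge0// => t _; rewrite lee_fin.
Qed.

(** After the inner variable is translated by the outer one, both sides are iterated integrals of
    the same nonnegative function, in opposite orders. *)
Lemma rconvA u v z x : bounded_L1 u -> bounded_L1 v -> bounded_L1 z ->
  rconv (rconv u v) z x = rconv u (rconv v z) x.
Proof.
move=> nu nv nz; congr fine.
have [mu_ u0 _ _] := nu; have [mv v0 _ _] := nv; have [mz z0 _ _] := nz.
have muE : measurable_fun [set: RM] (fun t => (u t)%:E) by exact/measurable_EFinP.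
have mvE : measurable_fun [set: RM] (fun t => (v t)%:E) by exact/measurable_EFinP.
have mzE : measurable_fun [set: RM] (fun t => (z t)%:E) by exact/measurable_EFinP.
transitivity (\int[mu]_t \int[mu]_s ((u (x - t - s)%R)%:E * (v s)%:E * (z t)%:E))%E.
  apply: eq_integral => t _; rewrite rconvE// ge0_integralZr//; last by rewrite lee_fin.
  - by apply: emeasurable_funM => //; exact: (bounded_L1_reflect _ nu).
  - by move=> s _; rewrite mule_ge0// lee_fin.
transitivity (\int[mu]_t \int[mu]_s ((u (x - s)%R)%:E * ((v (s - t)%R)%:E * (z t)%:E)))%E.
  apply: eq_integral => t _.
  have ms (c : R) : measurable_fun [set: RM] (fun s : RM => s - c : RM).
    by apply: measurable_funB => //; exact: measurable_cst.
  rewrite -(@ge0_integral_shift _ t (fun s => (u (x - t - s)%R)%:E * (v s)%:E * (z t)%:E)%E).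
  - apply: eq_integral => s _; rewrite muleA; congr ((u _)%:E * _ * _)%E.
    by rewrite opprB addrA subrK.
  - apply: emeasurable_funM; last exact: measurable_cst.
    by apply: emeasurable_funM => //; exact: (bounded_L1_reflect _ nu).
  - by move=> s; rewrite !mule_ge0// lee_fin.
rewrite (@fubini_tonelli _ _ RM RM R mu mu
  (fun p => (u (x - p.2)%R)%:E * ((v (p.2 - p.1)%R)%:E * (z p.1)%:E))%E) /=; last 2 first.
- apply: emeasurable_funM.
    exact: (measurableT_comp (bounded_L1_reflect x nu) measurable_snd).
  apply: emeasurable_funM; last exact: (measurableT_comp mzE measurable_fst).
  apply: (measurableT_comp mvE).
  by apply: measurable_funB; [exact: measurable_snd|exact: measurable_fst].
- by move=> p; rewrite !mule_ge0// lee_fin.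
apply: eq_integral => s _; rewrite rconvE// ge0_integralZl_EFin//.
- by move=> t _; rewrite mule_ge0// lee_fin.
- by apply: emeasurable_funM => //; exact: (bounded_L1_reflect _ nv).
Qed.

Lemma bounded_L1_indic (E : set RM) : measurable E -> (mu E < +oo)%E ->
  bounded_L1 (\1_E : RM -> R).
Proof.
move=> mE Ei; split.
- exact: measurable_indic.
- by [].
- by exists 1 => x; rewrite indicE; case: (_ \in _).
- by rewrite integral_indic// setIT.
Qed.

End RealConvolution.

Section Lift.
Variables (R : realType) (A : unitalBanachAlgType R[i]).
Local Notation RM := (measurableTypeR R).
Local Notation mu := (@lebesgue_measure R).

Definition lift (u : R -> R) (a : A) (t : R) : A := (u t)%:C *: a.

Lemma in_L1_lift u a : bounded_L1 u -> in_L1 (lift u a).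
Proof.
move=> [mu_ u0 _ ui]; split.
  by apply: strongly_measurable_real => //; exact: strongly_measurable_cst.
rewrite inorm_real//; apply: lte_mul_pinfty; rewrite ?lee_fin ?rnorm_ge0//.
by under eq_integral do rewrite ger0_norm//.
Qed.

Lemma tconv_lift u v a b : bounded_L1 u -> bounded_L1 v ->
  tconv (lift u a) (lift v b) = lift (rconv u v) (bmul a b).
Proof.
move=> nu nv; apply/funext => x.
have [mu_ u0 _ _] := nu; have [mv v0 _ _] := nv.
have m1 : measurable_fun [set: RM] (fun t : RM => u (x - t) * v t).
  apply: measurable_funM => //.
  exact: (measurableT_comp mu_ (measurable_reflect x)).
have fin := rconv_fin x nu nv.
have nc : (nconv (lift u a) (lift v b) x < +oo)%E.
  rewrite /nconv (eq_integral (fun t : RM => (rnorm a * rnorm b)%:E *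
    ((u (x - t)%R)%:E * (v t)%:E))%E); last first.
    move=> t _; rewrite /lift !rnormZR !ger0_norm// -!EFinM; congr (_%:E); ring.
  rewrite ge0_integralZl_EFin//.
  - by apply: lte_mul_pinfty => //; rewrite lee_fin mulr_ge0 ?rnorm_ge0.
  - by move=> t _; rewrite mule_ge0// lee_fin.
  - by under eq_fun do rewrite -EFinM; exact/measurable_EFinP.
  - by rewrite mulr_ge0 ?rnorm_ge0.
have -> : tconv (lift u a) (lift v b) x =
  if (nconv (lift u a) (lift v b) x < +oo)%E then convolution (lift u a) (lift v b) x else 0 by [].
rewrite nc; apply: bochner_integralE.
have -> : (fun t => bmul (lift u a (x - t)) (lift v b t)) =
    (fun t => (u (x - t) * v t)%:C *: bmul a b).
  by apply/funext => t; rewrite /lift -bscalerAl -bscalerAr scalerA -rmorphM.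
have := ge0_is_bochner_real (bmul a b) m1.
have E : (\int[mu]_t (u (x - t) * v t)%:E = \int[mu]_t ((u (x - t)%R)%:E * (v t)%:E))%E.
  by apply: eq_integral => t _; rewrite EFinM.
by rewrite E; apply => // t; rewrite mulr_ge0.
Qed.

End Lift.

HB.lock Definition l1norm (R : realType) (A : unitalBanachAlgType R[i]) (x : L1 A) : R :=
  fine (nrm (fun=> 1) x).

(** * Associativity of the convolution product *)

Section Associativity.
Variables (R : realType) (A : unitalBanachAlgType R[i]).
Local Notation RM := (measurableTypeR R).
Local Notation mu := (@lebesgue_measure R).
Local Notation L := (L1 A).
Local Notation "x ** y" := (l1mul x y) (at level 40, left associativity).
Implicit Types x y z : L.

Lemma l1normE x : (l1norm x)%:E = nrm (fun=> 1) x.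
Proof.
rewrite unlock fineK// ge0_fin_numE; first exact: nrm1_lty.
exact: nrm_ge0 (weight1 R).
Qed.

Lemma l1norm_ge0 x : 0 <= l1norm x.
Proof. by rewrite -lee_fin l1normE; exact: nrm_ge0 (weight1 R). Qed.

Lemma l1normN x : l1norm (- x) = l1norm x.
Proof. by apply: EFin_inj; rewrite !l1normE nrmN//; exact: weight1. Qed.

Lemma l1normD x y : l1norm (x + y) <= l1norm x + l1norm y.
Proof. by rewrite -lee_fin EFinD !l1normE nrmD//; exact: weight1. Qed.

Lemma l1normB x y : l1norm (x - y) <= l1norm x + l1norm y.
Proof. by rewrite -(l1normN y) l1normD. Qed.

Lemma l1normM x y : l1norm (x ** y) <= l1norm x * l1norm y.
Proof. by rewrite -lee_fin EFinM !l1normE nrmM//; exact: weight1. Qed.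

Lemma l1norm_eq0 x : l1norm x = 0 -> x = 0.
Proof. by move=> h; apply: nrm1_eq0; rewrite -l1normE h. Qed.

Lemma l1norm_cls (f : R -> A) : in_L1 f -> (l1norm (cls f))%:E = inorm f.
Proof. by move=> Lf; rewrite l1normE nrm_cls ?wnorm1//; exact: weight1. Qed.

Lemma simple_indicE (s : R -> A) (u : seq A) : uniq u -> (forall t, s t \in u) ->
  s = fun t => \sum_(a <- [seq a <- u | a != 0]) lift (\1_(s @^-1` [set a])) a t.
Proof.
move=> uu su; apply/funext => t; rewrite big_filter big_mkcond /=.
rewrite (bigD1_seq (s t) (su t) uu) /= big1 ?addr0.
  case: eqVneq => [//|_]; rewrite /lift indicE mem_set//.
  by rewrite scale1r.
move=> a /eqP ast; case: ifP => // _; rewrite /lift indicE memNset ?scale0r//.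
by move=> /= h; apply: ast; rewrite h.
Qed.

(* By density of the integrable simple functions. *)
Lemma L1_ind (C : L -> Prop) :
  (forall (E : set RM) a, measurable E -> (mu E < +oo)%E -> C (cls (lift \1_E a))) ->
  C 0 -> (forall x y, C x -> C y -> C (x + y)) ->
  (forall x, (forall e, 0 < e -> exists2 y, C y & l1norm (x - y) < e) -> C x) ->
  forall x, C x.
Proof.
move=> CE C0 CD Ccl x; apply: Ccl => e e0.
have [mx xi] := L1P x; have [s [is_ sf s2 sn]] := bochner_approx mx xi.
have Ls n : in_L1 (s n) by split; [exact: integrable_simple_sm|exact: inorm_simple_lty].
have /fine_cvgP[h3 /cvgrPdist_lt/(_ _ e0) h2] := sn.
have [N _ /(_ N (leqnn N)) [/= ha hb]] := filterI h2 h3.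
rewrite sub0r normrN ger0_norm in ha; last by rewrite fine_ge0 ?inorm_ge0.
exists (cls (s N)); last first.
  have -> : x - cls (s N) = cls (fun t => x t - s N t) by rewrite clsB ?clsK//; exact: L1P.
  have -> // : l1norm (cls (fun t => x t - s N t)) = fine (inorm (fun t => x t - s N t)).
  by rewrite -l1norm_cls//; apply: in_L1B => //; exact: L1P.
have [fs fi] := is_ N; have [u [uu su]] := fin_measurable_seq fs.
pose F a := if a == 0 then fun=> 0 else lift (\1_(s N @^-1` [set a])) a.
have LF a : in_L1 (F a).
  rewrite /F; case: eqVneq => [_|a0]; first exact: in_L10.
  by apply: in_L1_lift; apply: bounded_L1_indic; [exact: fs.2|exact: fi].
have -> : s N = fun t => \sum_(a <- [seq a <- u | a != 0]) F a t.
  rewrite {1}(simple_indicE uu su); apply/funext => t; apply: eq_big_seq => a.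
  by rewrite mem_filter /F => /andP[/negPf -> _].
have [_ ->] := cls_sum [seq a <- u | a != 0] LF.
apply: (big_ind C) => // a _; rewrite /F; case: eqVneq => [_|a0]; first by rewrite cls0.
by apply: CE; [exact: fs.2|exact: fi].
Qed.

(** The bound makes the kernel of P closed, subtractivity makes it additive; it contains the lifted
    indicators, which generate a dense subgroup. *)
Lemma L1_ext (P : L -> L) (K : R) :
  (forall x y, P (x - y) = P x - P y) -> (forall x, l1norm (P x) <= K * l1norm x) ->
  (forall (E : set RM) a, measurable E -> (mu E < +oo)%E -> P (cls (lift \1_E a)) = 0) ->
  forall x, P x = 0.
Proof.
move=> PB PK PE.
have P0 : P 0 = 0 by have := PB 0 0; rewrite !subrr.
have PN y : P (- y) = - P y by rewrite -sub0r PB P0 sub0r.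
apply: L1_ind => // [x y x0 y0|x hx].
  by rewrite -(opprK y) PB PN x0 y0 oppr0 subrr.
apply: l1norm_eq0; apply/eqP; rewrite eq_le l1norm_ge0 andbT.
apply/ler_addgt0Pr => e e0; rewrite add0r.
(* K may be zero or negative; [|K| + 1] bounds it and can serve as a divisor. *)
have K1 : 0 < `|K| + 1 by rewrite ltr_wpDl.
have [y Py hy] := hx _ (divr_gt0 e0 K1).
have -> : P x = P (x - y) by rewrite PB Py subr0.
apply: le_trans (PK _) _; apply: (@le_trans _ _ (`|K| * (e / (`|K| + 1)))).
  apply: (@le_trans _ _ (`|K| * l1norm (x - y))).
    by rewrite ler_wpM2r ?l1norm_ge0// ler_norm.
  by rewrite ler_wpM2l// ltW.
by rewrite mulrA ler_pdivrMr// mulrC ler_wpM2l ?(ltW e0)// lerDl.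
Qed.

Lemma l1mulA_lift (u v w : RM -> R) (a b c : A) : bounded_L1 u -> bounded_L1 v -> bounded_L1 w ->
  cls (lift u a) ** cls (lift v b) ** cls (lift w c) =
  cls (lift u a) ** (cls (lift v b) ** cls (lift w c)).
Proof.
move=> nu nv nw; have nuv := bounded_L1_rconv nu nv; have nvw := bounded_L1_rconv nv nw.
rewrite !l1mul_cls ?tconv_lift//; do ?[exact: in_L1_lift]; rewrite ?l1mul_cls ?tconv_lift//;
  do ?[exact: in_L1_lift].
rewrite bmulA; congr cls; apply/funext => t; rewrite /lift; congr (_%:C *: _).
exact: rconvA.
Qed.

(** The associator is additive in each argument and bounded by twice the product of the norms. Hence
    [L1_ext] reduces the three arguments, one after the other, to lifted indicators, where only real
    convolution and the product of A are involved. *)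
Lemma l1mulA : associative (@l1mul R A).
Proof.
(* [lra] must not see the atoms [l1norm _], which it would try to unify. *)
have aux (t p q r s n1 n2 n3 : R) : t <= p + q -> p <= r * n3 -> r * n3 <= n1 * n2 * n3 ->
  q <= n1 * s -> n1 * s <= n1 * (n2 * n3) -> t <= 2 * n1 * n2 * n3 by lra.
have rot1 (t n1 n2 n3 : R) : t <= 2 * n1 * n2 * n3 -> t <= 2 * n2 * n3 * n1 by lra.
have rot2 (t n1 n2 n3 : R) : t <= 2 * n1 * n2 * n3 -> t <= 2 * n1 * n3 * n2 by lra.
move=> x y z; apply/esym/eqP; rewrite -subr_eq0; apply/eqP.
have bnd x' y' z' : l1norm (x' ** y' ** z' - x' ** (y' ** z')) <=
    2 * l1norm x' * l1norm y' * l1norm z'.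
  have h1 := l1normM (x' ** y') z'; have h2 := l1normM x' y'.
  have h3 := l1normM x' (y' ** z'); have h4 := l1normM y' z'.
  have n1 := l1norm_ge0 x'; have n2 := l1norm_ge0 y'; have n3 := l1norm_ge0 z'.
  have h5 := l1normB (x' ** y' ** z') (x' ** (y' ** z')).
  have h6 : l1norm (x' ** y') * l1norm z' <= l1norm x' * l1norm y' * l1norm z' by rewrite ler_wpM2r.
  have h7 : l1norm x' * l1norm (y' ** z') <= l1norm x' * (l1norm y' * l1norm z') by rewrite ler_wpM2l.
  exact: aux h5 h1 h6 h3 h7.
apply: (L1_ext (P := fun x => x ** y ** z - x ** (y ** z)) (K := 2 * l1norm y * l1norm z)).
- by move=> x1 x2; rewrite !l1mulBl opprD addrACA -opprD.
- by move=> x1; exact: rot1 (bnd x1 y z).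
move=> E a mE Ei.
apply: (L1_ext (P := fun y => cls (lift \1_E a) ** y ** z - cls (lift \1_E a) ** (y ** z))
  (K := 2 * l1norm (cls (lift \1_E a)) * l1norm z)).
- by move=> x1 x2; rewrite !(l1mulBl, l1mulBr) opprD addrACA -opprD.
- by move=> x1; exact: rot2 (bnd (cls (lift \1_E a)) x1 z).
move=> F b mF Fi.
apply: (L1_ext (P := fun z => cls (lift \1_E a) ** cls (lift \1_F b) ** z -
    cls (lift \1_E a) ** (cls (lift \1_F b) ** z))
  (K := 2 * l1norm (cls (lift \1_E a)) * l1norm (cls (lift \1_F b)))).
- by move=> x1 x2; rewrite !(l1mulBl, l1mulBr) opprD addrACA -opprD.
- by move=> x1; exact: bnd.
move=> G c mG Gi; apply/eqP; rewrite subr_eq0; apply/eqP.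
by apply: l1mulA_lift; exact: bounded_L1_indic.
Qed.

End Associativity.

(** * Completeness of the weighted spaces and Neumann series *)

Section Completeness.
Variables (R : realType) (A : unitalBanachAlgType R[i]).
Local Notation RM := (measurableTypeR R).
Local Notation mu := (@lebesgue_measure R).
Local Notation L := (L1 A).
Local Notation "x ** y" := (l1mul x y) (at level 40, left associativity).

(** Here c stands for the value of the weight at a point. The estimate by the tail, once integrated
    over the points, becomes the estimate in L^1(w). *)
Lemma series_pointwise (u : nat -> A) (c : R) : 1 <= c ->
  (\sum_(0 <= k <oo) (rnorm (u k) * c)%:E < +oo)%E ->
  exists l : A, \sum_(k < n) u k @[n --> \oo] --> l /\
    forall n, ((rnorm (l - \sum_(k < n) u k) * c)%:E <= \sum_(n <= k <oo) (rnorm (u k) * c)%:E)%E.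
Proof.
move=> c1 ufin; have c0 : 0 < c by exact: lt_le_trans c1.
have e0 k : (0 <= (rnorm (u k) * c)%:E)%E by rewrite lee_fin mulr_ge0 ?rnorm_ge0// ltW.
have tail m p : (m <= p)%N ->
    ((rnorm (\sum_(k < p) u k - \sum_(k < m) u k)%R * c)%:E <=
     \sum_(m <= k <oo) (rnorm (u k) * c)%:E)%E.
  move=> mp; apply: le_trans (nneseries_lim_ge p _); last by move=> *; exact: e0.
  rewrite sumEFin lee_fin -mulr_suml ler_wpM2r//; first exact: ltW.
  rewrite -!(big_mkord xpredT) /= (big_cat_nat (leq0n m) mp) /= addrAC subrr add0r.
  exact: rnorm_sum.
have h0 := nneseries_tail_cvg ufin (fun k _ => e0 k).
have [l ul] : exists l : A, \sum_(k < n) u k @[n --> \oo] --> l.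
  apply: rnorm_complete => e ep; have e2 : 0 < e / 2 by rewrite divr_gt0.
  have /fine_cvgP[h3 /cvgrPdist_lt/(_ _ e2) h2] := h0.
  have [N _ /(_ N (leqnn N)) [/= ha hb]] := filterI h2 h3.
  have t0 : (0 <= \sum_(N <= k <oo) (rnorm (u k) * c)%:E)%E.
    by apply: nneseries_ge0 => k _ _; exact: e0.
  have hc : (\sum_(N <= k <oo) (rnorm (u k) * c)%:E < (e / 2)%:E)%E.
    rewrite -[X in (X < _)%E]fineK// lte_fin.
    by move: ha; rewrite sub0r normrN ger0_norm ?fine_ge0.
  have b n : (N <= n)%N -> rnorm (\sum_(k < n) u k - \sum_(k < N) u k) < e / 2.
    move=> Nn; rewrite -lte_fin; apply: le_lt_trans hc.
    by apply: le_trans (tail _ _ Nn); rewrite lee_fin ler_peMr ?rnorm_ge0.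
  exists N => n m Nn Nm; rewrite -(subrK (\sum_(k < N) u k) (\sum_(k < n) u k)) -addrA.
  rewrite (splitr e); apply: le_lt_trans (rnormD _ _) _; apply: ltrD; first exact: b.
  by rewrite rnormB; exact: b.
exists l; split=> // n; apply/lee_addgt0Pr => e ep.
have ec : 0 < e / c by rewrite divr_gt0.
have /cvg_rnormP/cvgrPdist_lt/(_ _ ec) [N _ hN] := ul.
pose p := maxn N n.
have := hN p (leq_maxl N n); rewrite /= sub0r normrN ger0_norm ?rnorm_ge0// => hp.
have ht := tail n p (leq_maxr N n).
rewrite addeC; apply: le_trans (leeD2l _ ht); rewrite -EFinD lee_fin.
have -> : l - \sum_(k < n) u k = (l - \sum_(k < p) u k) + (\sum_(k < p) u k - \sum_(k < n) u k).
  by rewrite addrA subrK.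
apply: (@le_trans _ _ ((rnorm (l - \sum_(k < p) u k) +
    rnorm (\sum_(k < p) u k - \sum_(k < n) u k)) * c)).
  by rewrite ler_wpM2r ?rnormD// ltW.
rewrite mulrDl lerD2r -ler_pdivlMr//; apply: ltW.
by rewrite rnormB.
Qed.

(** The Riesz-Fischer argument: the sum of the norms has a finite integral, so the series converges
    absolutely at almost every point; the limit is set to 0 at the remaining points. *)
Lemma L1_series (w : R -> R) (z : nat -> L) : weight w ->
  (\sum_(0 <= k <oo) nrm w (z k) < +oo)%E ->
  exists x : L, forall n, (nrm w (x - \sum_(k < n) z k)%R <= \sum_(n <= k <oo) nrm w (z k))%E.
Proof.
move=> hw zfin; have [mw w1 wM] := hw.
pose e k (t : RM) := (rnorm (z k t) * w t)%:E.
have e0 k t : (0 <= e k t)%E by rewrite lee_fin mulr_ge0 ?rnorm_ge0// (weight_ge0 _ hw).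
have me k : measurable_fun [set: RM] (e k).
  by apply: measurable_wnorm => //; exact: (L1P (z k)).1.
pose T n (t : RM) := (\sum_(n <= k <oo) e k t)%E.
have TE n t : T n t = (\sum_(0 <= i <oo) e (i + n)%N t)%E.
  by rewrite (@nneseries_addn _ (fun k => e k t)).
have mT n : measurable_fun [set: RM] (T n).
  rewrite (_ : T n = fun t => (\sum_(0 <= i <oo) e (i + n)%N t)%E); last first.
    by apply/funext => t; exact: TE.
  exact: (@ge0_emeasurable_sum _ RM R setT (fun k t => e (k + n)%N t) xpredT).
have iT n : (\int[mu]_t T n t = \sum_(n <= k <oo) nrm w (z k))%E.
  rewrite -(@nneseries_addn _ (fun k => nrm w (z k))); last by move=> i; exact: nrm_ge0.
  rewrite (eq_integral (fun t => (\sum_(0 <= i <oo) e (i + n)%N t)%E)); last by move=> t _; exact: TE.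
  rewrite integral_nneseries//.
  by apply: eq_eseriesr => i _; rewrite nrmE.
pose b t : bool := (T 0%N t < +oo)%E.
have mb : measurable ([set t | b t] : set RM).
  by apply: measurable_set_bool; apply: measurable_fun_lte => //; exact: measurable_cst.
have /choice[X hX] : forall t : R, exists l : A, b t -> \sum_(k < n) z k t @[n --> \oo] --> l /\
    forall n, ((rnorm (l - \sum_(k < n) z k t) * w t)%:E <= T n t)%E.
  move=> t; case bt : (b t); last by exists 0.
  by have [l hl] := series_pointwise (w1 t) bt; exists l.
pose x t := if b t then X t else 0.
pose S n t := \sum_(k < n) z k t.
have LS n : in_L1 (S n) /\ cls (S n) = \sum_(k < n) z k.
  have [LS ->] := cls_sum (index_enum 'I_n) (fun k : 'I_n => L1P (z k)).
  by split=> //; apply: eq_bigr => k _; exact: clsK.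
have mx : strongly_measurable x.
  apply: (@strongly_measurable_cvg _ _ (fun n t => if b t then S n t else 0)).
    move=> n; apply: strongly_measurable_if => //; last exact: strongly_measurable_cst.
    exact: (LS n).1.1.
  move=> t; rewrite /x; have := hX t; case: (b t) => [/(_ isT)[]//|_]; exact: cvg_cst.
have xS n t : ((rnorm (x t - S n t) * w t)%:E <= T n t)%E.
  have [bt|bt] := boolP (b t).
    have -> : x t = X t by rewrite /x bt.
    by have [_ h] := hX t bt; exact: h.
  (* Where the series of norms diverges every tail is infinite, as only finitely many finite terms
     are removed; the estimate is then void. *)
  suff -> : T n t = +oo%E by rewrite leey.
  have : T 0%N t = +oo%E by apply/eqP; move: bt; rewrite /b -leNgt leye_eq.
  rewrite /T (@nneseries_split _ (fun k => e k t) 0 n)// add0n.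
  have : (0 <= \sum_(n <= k <oo) e k t)%E by apply: nneseries_ge0 => k _ _; exact: e0.
  case: (\sum_(n <= k <oo) e k t)%E => [r _|//|//].
  by rewrite sumEFin.
have xSi n : (wnorm w (fun t => x t - S n t)%R <= \sum_(n <= k <oo) nrm w (z k))%E.
  rewrite -iT; apply: ge0_le_integral => //.
  - by move=> t _; rewrite lee_fin mulr_ge0 ?rnorm_ge0// (weight_ge0 _ hw).
  - by apply: measurable_wnorm => //; apply: strongly_measurableB => //; exact: (LS n).1.1.
have Lx : in_L1 x.
  split=> //; apply: le_lt_trans (zfin); apply: le_trans (xSi 0%N).
  rewrite -wnorm1 (_ : (fun t => x t - S 0%N t) = x); last first.
    by apply/funext => t; rewrite /S big_ord0 subr0.
  apply: wnorm_mono => //; exact: weight1.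
exists (cls x) => n; rewrite -(LS n).2 -clsB//; last exact: (LS n).1.
rewrite nrm_cls//; apply: in_L1B => //; exact: (LS n).1.
Qed.

Lemma eq0_of_nrm (w : R -> R) (x : L) : weight w ->
  (forall e, 0 < e -> (nrm w x <= e%:E)%E) -> x = 0.
Proof.
move=> hw h; apply: nrm1_eq0; apply/eqP; rewrite eq_le nrm_ge0 ?andbT; last exact: weight1.
apply: le_trans (nrm1_le x hw) _; apply/lee_addgt0Pr => e e0; rewrite add0e; exact: h.
Qed.

(** The terms of the series are [y (- H)^n], of norm at most [C * r ^+ n]. Starting from an
    arbitrary y instead of the unit keeps the whole series inside L^1(w). *)
Lemma l1_neumann (w : R -> R) (H y : L) : weight w -> (nrm w H < 1)%E ->
  (nrm w y < +oo)%E -> exists x : L, (nrm w x < +oo)%E /\ x + x ** H = y.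
Proof.
move=> hw H1 yfin; have H0 := nrm_ge0 H hw; have y0 := nrm_ge0 y hw.
pose r := fine (nrm w H); pose C := fine (nrm w y).
have rE : nrm w H = r%:E by rewrite /r fineK// ge0_fin_numE// (lt_trans H1)// ltry.
have CE : nrm w y = C%:E by rewrite /C fineK// ge0_fin_numE.
have r0 : 0 <= r by rewrite -lee_fin -rE.
have r1 : r < 1 by rewrite -lte_fin -rE.
have C0 : 0 <= C by rewrite -lee_fin -CE.
pose fix z n : L := if n is m.+1 then - (z m ** H) else y.
have zn n : (nrm w (z n) <= (C * r ^+ n)%:E)%E.
  elim: n => [|n ih]; first by rewrite expr0 mulr1 -CE.
  rewrite /= nrmN//; apply: le_trans (nrmM _ _ hw) _.
  rewrite rE exprSr mulrA EFinM; apply: lee_pmul => //; exact: nrm_ge0.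
have geo n : (\sum_(n <= k <oo) nrm w (z k) <= (C * r ^+ n / (1 - r))%:E)%E.
  apply: lime_le.
    by apply: is_cvg_nneseries => k _ _; exact: nrm_ge0.
  apply: nearW => p.
  apply: (@le_trans _ _ (\sum_(n <= k < p) (C * r ^+ k)%:E)%E); first exact: lee_sum.
  rewrite sumEFin lee_fin -mulr_sumr -mulrA ler_wpM2l// ler_pdivlMr ?subr_gt0//.
  have [np|pn] := leqP n p; last first.
    by rewrite big_geq ?(ltnW pn)// mul0r exprn_ge0.
  rewrite mulr_suml (eq_bigr (fun k => - (r ^+ k.+1 - r ^+ k))); last first.
    by move=> k _; rewrite exprS; ring.
  by rewrite sumrN telescope_sumr// opprB lerBlDr lerDl exprn_ge0.
have zfin : (\sum_(0 <= k <oo) nrm w (z k) < +oo)%E by exact: le_lt_trans (geo 0%N) (ltry _).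
have [x hx] := L1_series hw zfin.
have xn n : (nrm w (x - \sum_(k < n) z k)%R <= (C * r ^+ n / (1 - r))%:E)%E.
  exact: le_trans (hx n) (geo n).
exists x; split.
  by have := xn 0%N; rewrite big_ord0 subr0 => h; exact: le_lt_trans h (ltry _).
apply/eqP; rewrite -subr_eq0; apply/eqP; apply: (eq0_of_nrm hw) => e e0.
(* The partial sums solve the equation up to their last term, by telescoping. *)
have tel n : \sum_(k < n) z k + (\sum_(k < n) z k) ** H = y - z n.
  elim: n => [|n ih]; first by rewrite big_ord0 l1mul0l addr0 subrr.
  by rewrite big_ord_recr /= l1mulDl addrACA ih opprK addrA subrK.
have bnd n : (nrm w (x + x ** H - y)%R <= ((2 * (C / (1 - r)) + C) * r ^+ n)%:E)%E.
  have -> : x + x ** H - y = (x - \sum_(k < n) z k) + (x - \sum_(k < n) z k) ** H - z n.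
    have -> : y = \sum_(k < n) z k + (\sum_(k < n) z k) ** H + z n by rewrite tel subrK.
    by rewrite l1mulBl !opprD !addrA; congr (_ + _); congr (_ + _); exact: addrAC.
  apply: le_trans (nrmD _ _ hw) _; rewrite nrmN//.
  have -> : (2 * (C / (1 - r)) + C) * r ^+ n =
      (C * r ^+ n / (1 - r) + C * r ^+ n / (1 - r)) + C * r ^+ n by ring.
  rewrite !EFinD; apply: leeD; last exact: zn.
  apply: le_trans (nrmD _ _ hw) _; apply: leeD; first exact: xn.
  apply: le_trans (nrmM _ _ hw) _; rewrite -[leRHS]mule1; apply: lee_pmul => //.
  - exact: nrm_ge0.
  - exact: ltW.
have D0 : 0 <= 2 * (C / (1 - r)) + C.
  by rewrite addr_ge0// mulr_ge0// divr_ge0// subr_ge0 ltW.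
have hr : (2 * (C / (1 - r)) + C) * r ^+ n @[n --> \oo] --> (0 : R).
  rewrite -[X in _ --> X](mulr0 (2 * (C / (1 - r)) + C)); apply: cvgM; first exact: cvg_cst.
  by apply: cvg_expr; rewrite ger0_norm.
have /cvgrPdist_lt/(_ _ e0) [N _ /(_ N (leqnn N)) /=] := hr.
rewrite sub0r normrN ger0_norm ?mulr_ge0 ?exprn_ge0// => hN.
by apply: le_trans (bnd N) _; rewrite lee_fin ltW.
Qed.

End Completeness.

(** * Fejer kernels *)

Section Fejer.
Variable R : realType.
Local Notation RM := (measurableTypeR R).
Local Notation mu := (@lebesgue_measure R).

Lemma cos_lipschitz (a b : R) : `|cos a - cos b| <= `|a - b|.
Proof.
wlog ab : a b / a <= b => [H|].
  have [/H//|/ltW/H] := leP a b; by rewrite distrC [leRHS]distrC.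
have [->|nab] := eqVneq a b; first by rewrite !subrr normr0.
have {}ab : a < b by rewrite lt_neqAle nab.
have [c _ hc] := @MVT R cos (fun x => - sin x) a b ab
  (fun x _ => is_derive_cos x) (continuous_subspaceT (@continuous_cos R)).
rewrite distrC hc normrM normrN [leRHS]distrC ler_piMl//; exact: sin_max.
Qed.

(** The cosine transform of [1 - s] on [0, 1]; the value 1/2 at 0 is the limit of the quotient. *)
Definition fejer (x : R) : R := if x == 0 then 2^-1 else (1 - cos x) / x ^+ 2.

Lemma fejer_sqr (a x : R) : x != 0 -> a ^+ 2 * fejer (a * x) = (1 - cos (a * x)) / x ^+ 2.
Proof.
move=> x0; have [->|a0] := eqVneq a 0; first by rewrite expr0n !mul0r cos0 subrr mul0r.
rewrite /fejer mulf_eq0 (negPf a0) (negPf x0) /= exprMn.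
by field; rewrite a0 x0.
Qed.

Lemma is_derive_scale (x s : R) (f df : R -> R) :
  (forall t : R, is_derive t (1 : R) f (df t)) ->
  is_derive s (1 : R) (fun s : R => f (x * s)) (x * df (x * s)).
Proof.
move=> hf; have h : is_derive s 1 (fun s : R => x * s) x.
  have := @is_deriveZ R R R id x s 1 1 (is_derive_id s 1).
  by rewrite /GRing.scale /= mulr1.
have := @is_derive1_comp R f (fun s => x * s) s _ _ (hf _) h.
by rewrite mulrC.
Qed.

Lemma fejer_integrand_derive (x s : R) : x != 0 ->
  is_derive s (1 : R) (fun s : R => x^-1 * ((1 - s) * sin (x * s)) - x ^- 2 * cos (x * s))
    ((1 - s) * cos (x * s)).
Proof.
move=> x0.
have h1 := @is_derive_scale x s _ _ (fun t => is_derive_sin t).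
have h2 := @is_derive_scale x s _ _ (fun t => is_derive_cos t).
have d1 : is_derive s 1 (fun s : R => 1 - s) (- 1).
  by have := is_deriveB (is_derive_cst (1 : R) s 1) (is_derive_id s 1); rewrite sub0r.
have d2 := is_deriveZ (x^-1) (is_deriveM d1 h1).
have d3 := is_deriveZ (x ^- 2) h2.
apply: is_derive_eq (is_deriveB d2 d3) _.
rewrite /GRing.scale /=; field; exact: x0.
Qed.

Lemma FTC01 (f F : R -> R) : continuous f -> (forall s : R, is_derive s (1 : R) F (f s)) ->
  (\int[mu]_(s in `[0%R, 1%R]) (f s)%:E = (F 1 - F 0)%:E)%E.
Proof.
move=> cf dF.
have cF : continuous F.
  move=> s; apply: differentiable_continuous; apply/derivable1_diffP.
  exact: (@ex_derive _ _ _ _ _ _ _ (dF s)).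
rewrite (@continuous_FTC2 R f F 0 1 ltr01 (continuous_subspaceT cf)) ?EFinB//.
- split.
  + by move=> s _; exact: (@ex_derive _ _ _ _ _ _ _ (dF s)).
  + by apply: cvg_at_right_filter; exact: cF.
  + by apply: cvg_at_left_filter; exact: cF.
- by move=> s _; rewrite derive1E; exact: (@derive_val _ _ _ _ _ _ _ (dF s)).
Qed.

Lemma continuous_fejer_integrand (x : R) : continuous (fun s : R => (1 - s) * cos (x * s)).
Proof.
move=> s; apply: cvgM; first by apply: cvgB; [exact: cvg_cst|exact: cvg_id].
apply: (@continuous_comp _ _ _ (fun s => x * s) cos); last exact: continuous_cos.
by apply: cvgM; [exact: cvg_cst|exact: cvg_id].
Qed.

Lemma fejer_integral (x : R) :
  (\int[mu]_(s in `[0%R, 1%R]) ((1 - s) * cos (x * s))%:E = (fejer x)%:E)%E.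
Proof.
have cc := @continuous_fejer_integrand x.
have [x0|x0] := eqVneq x 0.
  have hd (s : R) : is_derive s (1 : R) (fun s : R => s - 2^-1 * (s * s))
      ((1 - s) * cos (x * s)).
    have d := is_deriveM (is_derive_id s (1 : R)) (is_derive_id s (1 : R)).
    have h := is_deriveB (is_derive_id s (1 : R)) (is_deriveZ (2^-1 : R) d).
    apply: is_derive_eq h _.
    by rewrite x0 mul0r cos0 /GRing.scale /=; field.
  by rewrite (FTC01 cc hd) /fejer x0 eqxx; congr EFin; field.
rewrite (FTC01 cc (fun s => fejer_integrand_derive s x0)).
by congr EFin; rewrite /fejer (negPf x0) mulr1 mulr0 sin0 cos0; field.
Qed.

Lemma fejer_ge0 x : 0 <= fejer x.
Proof.
rewrite /fejer; case: ifP => _; first by rewrite invr_ge0.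
by rewrite divr_ge0 ?sqr_ge0// subr_ge0 cos_le1.
Qed.

Lemma fejerN x : fejer (- x) = fejer x.
Proof. by rewrite /fejer oppr_eq0 cosN sqrrN. Qed.

Lemma fejer_integrand_integrable (x : R) :
  mu.-integrable `[0%R, 1%R] (EFin \o (fun s : R => (1 - s) * cos (x * s))).
Proof.
apply: continuous_compact_integrable; first exact: segment_compact.
by apply: continuous_subspaceT; exact: continuous_fejer_integrand.
Qed.

Lemma mu01 : mu (`[0%R, 1%R] : set R) = 1%E.
Proof. by rewrite lebesgue_measure_itv/= lte_fin ltr01 -EFinB subr0. Qed.

(** In the integral representation x occurs only inside the cosine, and [(1 - s) * s <= 1]. This
    covers the point 0, where the closed formula is singular, and yields continuity and
    measurability. *)
Lemma fejer_lipschitz x y : `|fejer x - fejer y| <= `|x - y|.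
Proof.
rewrite -lee_fin.
have m01 : measurable (`[0%R, 1%R] : set R) by [].
have -> : (`|fejer x - fejer y|%:E = `|\int[mu]_(s in `[0%R, 1%R])
    ((1 - s) * cos (x * s) - (1 - s) * cos (y * s))%:E|)%E.
  under eq_integral do rewrite EFinB.
  rewrite integralB_EFin//; [|exact: fejer_integrand_integrable..].
  by rewrite !fejer_integral.
have mi : measurable_fun (`[0%R, 1%R] : set R)
    (fun s : R => ((1 - s) * cos (x * s) - (1 - s) * cos (y * s))%:E).
  apply/measurable_EFinP; apply: measurable_funTS; apply: measurable_funB;
  by apply: continuous_measurable_fun; exact: continuous_fejer_integrand.
apply: le_trans (le_abse_integral mu m01 mi) _.
apply: (@le_trans _ _ (\int[mu]_(s in `[0%R, 1%R]) (cst `|x - y|%:E s))%E).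
  apply: ge0_le_integral => //.
  - by apply: measurableT_comp.
  move=> s /=; rewrite in_itv /= => /andP[s0 s1]; rewrite lee_fin -mulrBr normrM.
  rewrite ger0_norm ?subr_ge0//.
  apply: (@le_trans _ _ ((1 - s) * `|x * s - y * s|)).
    by rewrite ler_wpM2l ?subr_ge0// cos_lipschitz.
  by rewrite -mulrBl normrM (ger0_norm s0) mulrCA ler_piMr//; nra.
by rewrite integral_cst//= lebesgue_measure_itv/= lte_fin ltr01 -EFinB subr0 mule1.
Qed.

Lemma continuous_fejer : continuous fejer.
Proof.
move=> x; apply/cvgrPdist_lt => e e0; apply/nbhs_ballP; exists e => // y.
by rewrite /ball_ /= => h; exact: le_lt_trans (fejer_lipschitz x y) h.
Qed.

Lemma measurable_fejer : measurable_fun [set: RM] fejer.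
Proof. by apply: continuous_measurable_fun; exact: continuous_fejer. Qed.

Lemma fejer_le1 x : fejer x <= 1.
Proof.
rewrite -lee_fin -fejer_integral; apply: le_trans (lee_abs _) _.
have m01 : measurable (`[0%R, 1%R] : set R) by [].
have mi : measurable_fun (`[0%R, 1%R] : set R) (fun s : R => ((1 - s) * cos (x * s))%:E).
  apply/measurable_EFinP; apply: measurable_funTS.
  by apply: continuous_measurable_fun; exact: continuous_fejer_integrand.
apply: le_trans (le_abse_integral mu m01 mi) _.
apply: (@le_trans _ _ (\int[mu]_(s in `[0%R, 1%R]) (cst 1%:E s))%E).
  apply: ge0_le_integral => //.
  - by apply: measurableT_comp.
  move=> s /=; rewrite in_itv /= => /andP[s0 s1]; rewrite lee_fin normrM.
  by rewrite ger0_norm ?subr_ge0// mulr_ile1 ?subr_ge0 ?cos_max// gerBl.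
by rewrite integral_cst//= lebesgue_measure_itv/= lte_fin ltr01 -EFinB subr0 mule1.
Qed.

(** For [x ^+ 2 <= 1] the bound by 1 is enough. Beyond, [1 - cos x <= 2] and
    [1 + x ^+ 2 <= 2 * x ^+ 2] produce the constant 4. *)
Lemma fejer_bound x : fejer x <= 4 / (1 + x ^+ 2).
Proof.
have x2 : 0 < 1 + x ^+ 2 by rewrite ltr_pwDl// sqr_ge0.
rewrite ler_pdivlMr//; have [x1|x1] := leP (x ^+ 2) 1.
  have := fejer_le1 x; have := fejer_ge0 x; nra.
have x0 : x != 0 by apply: contraTneq x1 => ->; rewrite expr0n -leNgt ler01.
have xp : 0 < x ^+ 2 by exact: lt_trans x1.
rewrite /fejer (negPf x0) mulrAC ler_pdivrMr//.
have := cos_geN1 x; nra.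
Qed.

Lemma fejer_lty : (\int[mu]_x (fejer x)%:E < +oo)%E.
Proof.
have cV : continuous (fun x : R => (1 + x ^+ 2)^-1).
  move=> x; apply: cvgV; first by rewrite gt_eqF// ltr_pwDl// sqr_ge0.
  apply: cvgD; [exact: cvg_cst|exact: exprn_continuous].
have p0 (x : R) : 0 <= (1 + x ^+ 2)^-1 by rewrite invr_ge0 addr_ge0// sqr_ge0.
apply: (@le_lt_trans _ _ (\int[mu]_x (4%:E * ((1 + x ^+ 2)^-1)%:E))%E).
  apply: ge0_le_integral => //.
  - by move=> x _; rewrite lee_fin fejer_ge0.
  - by apply/measurable_EFinP; exact: measurable_fejer.
  - by apply: measurable_funeM; apply/measurable_EFinP; exact: continuous_measurable_fun.
  - by move=> x _; rewrite -EFinM lee_fin fejer_bound.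
rewrite ge0_integralZl_EFin//; last 2 first.
- by move=> x _; rewrite lee_fin.
- by apply/measurable_EFinP; exact: continuous_measurable_fun.
apply: lte_mul_pinfty => //.
rewrite ge0_symfun_integralT//; last by move=> x /=; rewrite sqrrN.
apply: lte_mul_pinfty => //.
by rewrite -set_itvcy (integral0y_oneDsqr R) ltry.
Qed.

End Fejer.

(** * Integrals of real functions *)

Section RealIntegral.
Variable R : realType.
Local Notation RM := (measurableTypeR R).
Local Notation mu := (@lebesgue_measure R).
Implicit Types (f g h : RM -> R).

Definition rintegrable f := mu.-integrable [set: RM] (EFin \o f).
Definition rint f : R := fine (\int[mu]_x (f x)%:E).

Lemma rintE f : rintegrable f -> ((rint f)%:E = \int[mu]_x (f x)%:E)%E.
Proof. by move=> hf; rewrite /rint fineK//; exact: integrable_fin_num. Qed.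

Lemma rintegrableP f : measurable_fun [set: RM] f ->
  (\int[mu]_x `|f x|%:E < +oo)%E -> rintegrable f.
Proof. by move=> mf h; apply/integrableP; split => //; exact/measurable_EFinP. Qed.

Lemma rintegrable_measurable f : rintegrable f -> measurable_fun [set: RM] f.
Proof. by move=> /measurable_int/measurable_EFinP. Qed.

Lemma rintegrable_lty f : rintegrable f -> (\int[mu]_x `|f x|%:E < +oo)%E.
Proof. by case/integrableP. Qed.

Lemma bounded_rintegrable u : bounded_L1 u -> rintegrable u.
Proof.
move=> [mu_ u0 _ ul]; apply: rintegrableP => //.
by under eq_integral do rewrite ger0_norm//.
Qed.

Lemma rintegrableD f g : rintegrable f -> rintegrable g -> rintegrable (fun x => f x + g x).
Proof. by move=> hf hg; exact: integrableD hf hg. Qed.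

Lemma rintegrableB f g : rintegrable f -> rintegrable g -> rintegrable (fun x => f x - g x).
Proof. by move=> hf hg; exact: integrableB hf hg. Qed.

Lemma rintegrableZ c f : rintegrable f -> rintegrable (fun x => c * f x).
Proof. by move=> hf; exact: integrableZl hf. Qed.

Lemma rintegrable_mul f h C : rintegrable f -> measurable_fun [set: RM] h ->
  (forall x, `|h x| <= C) -> rintegrable (fun x => f x * h x).
Proof.
move=> hf mh hC; apply: (@integrableMl _ _ _ mu [set: RM] measurableT _ h hf mh).
exists C; split; [exact: num_real|] => M CM x _ /=.
exact: le_trans (hC x) (ltW CM).
Qed.

Lemma rintegrable_sum (I : Type) (r : seq I) (F : I -> RM -> R) :
  (forall i, rintegrable (F i)) -> rintegrable (fun x => \sum_(i <- r) F i x).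
Proof.
move=> hF; elim: r => [|i r IH].
  apply: eq_integrable (integrable0 _ _) => // x _; by rewrite /= big_nil.
apply: eq_integrable (rintegrableD (hF i) IH) => // x _; by rewrite /= big_cons.
Qed.

Lemma rintD f g : rintegrable f -> rintegrable g ->
  rint (fun x => f x + g x) = rint f + rint g.
Proof. by move=> hf hg; exact: (@RintegralD _ _ _ mu [set: RM]). Qed.

Lemma rintB f g : rintegrable f -> rintegrable g ->
  rint (fun x => f x - g x) = rint f - rint g.
Proof. by move=> hf hg; exact: (@RintegralB _ _ _ mu [set: RM]). Qed.

Lemma rintZ c f : rintegrable f -> rint (fun x => c * f x) = c * rint f.
Proof. by move=> hf; exact: (@RintegralZl _ _ _ mu [set: RM]). Qed.

Lemma rint0 : rint (fun=> 0) = 0.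
Proof. by rewrite /rint integral0. Qed.

Lemma rint_sum (I : Type) (r : seq I) (F : I -> RM -> R) :
  (forall i, rintegrable (F i)) ->
  rint (fun x => \sum_(i <- r) F i x) = \sum_(i <- r) rint (F i).
Proof.
move=> hF; elim: r => [|i r IH].
  by rewrite big_nil -[RHS]rint0; congr rint; apply/funext => x; rewrite big_nil.
rewrite big_cons -IH -rintD//; last exact: rintegrable_sum.
by congr rint; apply/funext => x; rewrite big_cons.
Qed.

Lemma rint_reflect f (x : R) : measurable_fun [set: RM] f ->
  rint (fun t => f (x - t)) = rint f.
Proof.
by move=> mf; rewrite /rint (integral_reflect x (f := EFin \o f))//; apply/measurable_EFinP.
Qed.

Lemma rint_odd f : measurable_fun [set: RM] f -> (forall x, f (- x) = - f x) ->
  rintegrable f -> rint f = 0.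
Proof.
move=> mf fN hf; have := rint_reflect 0 mf.
have -> : (fun t => f (0 - t)) = (fun t => (-1) * f t).
  by apply/funext => t; rewrite sub0r fN mulN1r.
by rewrite rintZ// => h; lra.
Qed.

Lemma rint_scale f (b : R) : 0 < b -> rintegrable f -> (forall x, 0 <= f x) ->
  rintegrable (fun x => f (b * x)) /\ rint (fun x => f (b * x)) = b^-1 * rint f.
Proof.
move=> b0 hf f0; have mf := rintegrable_measurable hf.
have mE : measurable_fun [set: RM] (EFin \o f) by apply/measurable_EFinP.
have E := @ge0_integral_scale R b (EFin \o f) b0 mE (fun t => f0 t).
have E2 : (\int[mu]_x (f (b * x)%R)%:E = (b^-1 * rint f)%:E)%E.
  by rewrite [LHS]E EFinM rintE.
split; last by rewrite /rint E2.
apply: rintegrableP; first by apply: measurableT_comp => //; exact: measurable_scale.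
under eq_integral do rewrite ger0_norm//.
by rewrite E2 ltry.
Qed.

End RealIntegral.

(** * The normalized Fejer kernels and their transforms *)

Section FejerKernel.
Variable R : realType.
Local Notation RM := (measurableTypeR R).
Local Notation mu := (@lebesgue_measure R).

Lemma fejer_rintegrable : rintegrable (@fejer R).
Proof.
apply: rintegrableP; first exact: measurable_fejer.
by under eq_integral do rewrite ger0_norm ?fejer_ge0//; exact: fejer_lty.
Qed.

(** The number is pi; it enters only as a positive normalizing constant. *)
Definition fejer_mass : R := rint (@fejer R).

Lemma fejer_mass_gt0 : 0 < fejer_mass.
Proof.
rewrite -lte_fin rintE; last exact: fejer_rintegrable.
(* The function is 1/2 at 0 and 1-Lipschitz, hence at least 1/4 on [0, 1/4]. *)
have h0 : (0 < \int[mu]_(x in `[0%R, (4^-1)%R]) (cst (4^-1)%R%:E x))%E.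
  rewrite integral_cst//= lebesgue_measure_itv/= lte_fin invr_gt0 ltr0n -EFinB -EFinM lte_fin.
  by lra.
apply: (lt_le_trans h0).
have h1 : (\int[mu]_(x in `[0%R, (4^-1)%R]) (cst (4^-1)%R%:E x) <=
    \int[mu]_(x in `[0%R, (4^-1)%R]) (fejer x)%:E)%E.
  apply: ge0_le_integral => //.
  - by move=> x _; rewrite /= lee_fin invr_ge0.
  - by apply/measurable_EFinP; apply: measurable_funTS; exact: measurable_fejer.
  move=> x /=; rewrite in_itv /= => /andP[x0 x1]; rewrite lee_fin.
  have := fejer_lipschitz 0 x; rewrite sub0r normrN (ger0_norm x0) {1}/fejer eqxx.
  by rewrite ler_norml => /andP[_]; lra.
apply: (le_trans h1); apply: ge0_subset_integral => //.
- by apply/measurable_EFinP; exact: measurable_fejer.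
- by move=> x _; rewrite lee_fin fejer_ge0.
Qed.

(** Away from 0 the integrand is [(1 - cos (a * x)) / x ^+ 2]; scaling gives the factor
    [a ^+ 2 / |a|]. The absolute values in [tri] originate here. *)
Lemma rint_fejer_sqr (a : R) : rintegrable (fun x => a ^+ 2 * fejer (a * x)) /\
  rint (fun x => a ^+ 2 * fejer (a * x)) = `|a| * fejer_mass.
Proof.
have pos (b : R) : 0 < b -> rintegrable (fun x => b ^+ 2 * fejer (b * x)) /\
  rint (fun x => b ^+ 2 * fejer (b * x)) = b * fejer_mass.
  move=> b0; have [h1 h2] := rint_scale b0 fejer_rintegrable (@fejer_ge0 R).
  split; first exact: rintegrableZ.
  by rewrite rintZ// h2 mulrA expr2 mulfK// gt_eqF.
have [a0|a0|->] := ltgtP a 0.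
- rewrite ltr0_norm//; have := pos (- a); rewrite oppr_gt0 => /(_ a0).
  have -> // : (fun x => (- a) ^+ 2 * fejer (- a * x)) = (fun x => a ^+ 2 * fejer (a * x)).
  by apply/funext => x; rewrite sqrrN mulNr fejerN.
- by rewrite gtr0_norm//; exact: pos.
have -> : (fun x : R => 0 ^+ 2 * fejer (0 * x)) = (fun=> 0).
  by apply/funext => x; rewrite expr0n mul0r.
by rewrite normr0 mul0r rint0; split => //; exact: integrable0.
Qed.

(** A product-to-sum formula: [(1 - cos x) * cos (xi * x)] is a combination of three terms
    [1 - cos (a * x)]. The transform of the kernel then reduces to the integrals just computed,
    without Fourier inversion. *)
Lemma fejer_cos (xi x : R) : fejer x * cos (xi * x) =
  2^-1 * ((1 + xi) ^+ 2 * fejer ((1 + xi) * x)) +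
  2^-1 * ((1 - xi) ^+ 2 * fejer ((1 - xi) * x)) - xi ^+ 2 * fejer (xi * x).
Proof.
have [->|x0] := eqVneq x 0.
  by rewrite !mulr0 cos0 /fejer eqxx; field.
have -> : fejer x = (1 - cos x) / x ^+ 2.
  by rewrite /fejer (negPf x0).
rewrite !fejer_sqr//.
have -> : (1 + xi) * x = x + xi * x by ring.
have -> : (1 - xi) * x = x - xi * x by ring.
rewrite cosD cosB; field; exact: x0.
Qed.

(** The tent function [max 0 (1 - |x|)], written as a second difference of [|x| / 2]; in this form
    its sums over equally spaced points telescope. *)
Definition tri (x : R) : R := 2^-1 * `|1 + x| + 2^-1 * `|1 - x| - `|x|.

Definition fejerK (b x : R) : R := b / fejer_mass * fejer (b * x).

Lemma fejerK_ge0 b x : 0 <= b -> 0 <= fejerK b x.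
Proof. by move=> b0; rewrite mulr_ge0 ?fejer_ge0// divr_ge0// ltW// fejer_mass_gt0. Qed.

Lemma fejerKN b x : fejerK b (- x) = fejerK b x.
Proof. by rewrite /fejerK mulrN fejerN. Qed.

Lemma measurable_fejerK b : measurable_fun [set: RM] (fejerK b).
Proof.
apply: measurable_funM => //; apply: (measurableT_comp (@measurable_fejer R)).
exact: measurable_scale.
Qed.

Lemma rintegrable_fejerK b : 0 < b -> rintegrable (fejerK b).
Proof.
move=> b0; apply: rintegrableZ.
by case: (rint_scale b0 fejer_rintegrable (@fejer_ge0 R)).
Qed.

Lemma bounded_fejerK b : 0 < b -> bounded_L1 (fejerK b).
Proof.
move=> b0; split.
- exact: measurable_fejerK.
- by move=> x; exact: fejerK_ge0 (ltW b0).
- exists (b / fejer_mass) => x; rewrite ler_piMr ?fejer_le1// divr_ge0 ?ltW//.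
  exact: fejer_mass_gt0.
have := rintegrable_lty (rintegrable_fejerK b0).
by under eq_integral do rewrite ger0_norm ?fejerK_ge0 ?(ltW b0)//.
Qed.

(** The cosine transform, which is the Fourier transform for the even kernels considered here. *)
Definition ft (k : RM -> R) (xi : R) : R := rint (fun x => k x * cos (xi * x)).

Lemma measurable_cos_scale (xi : R) : measurable_fun [set: RM] (fun x => cos (xi * x) : R).
Proof.
apply: measurableT_comp; last exact: measurable_scale.
exact: continuous_measurable_fun (@continuous_cos R).
Qed.

Lemma measurable_sin_scale (xi : R) : measurable_fun [set: RM] (fun x => sin (xi * x) : R).
Proof.
apply: measurableT_comp; last exact: measurable_scale.
exact: continuous_measurable_fun (@continuous_sin R).
Qed.

Lemma rintegrable_cos (k : RM -> R) (xi : R) : rintegrable k -> rintegrable (fun x => k x * cos (xi * x)).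
Proof.
move=> hk; apply: (rintegrable_mul hk (measurable_cos_scale xi) (C := 1)) => x.
by rewrite cos_max.
Qed.

Lemma rintegrable_sin (k : RM -> R) (xi : R) : rintegrable k -> rintegrable (fun x => k x * sin (xi * x)).
Proof.
move=> hk; apply: (rintegrable_mul hk (measurable_sin_scale xi) (C := 1)) => x.
by rewrite sin_max.
Qed.

Lemma ft_fejerK b xi : 0 < b -> ft (fejerK b) xi = tri (xi / b).
Proof.
move=> b0; have C0 := fejer_mass_gt0; set z := xi / b.
have hz : xi = z * b by rewrite /z mulfVK// gt_eqF.
pose S (a : R) (x : R) := (a * b) ^+ 2 * fejer (a * b * x).
have E x : fejerK b x * cos (xi * x) = (b * fejer_mass)^-1 *
    (2^-1 * S (1 + z) x + 2^-1 * S (1 - z) x - S z x).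
  rewrite /fejerK mulrAC -mulrA [cos _ * _]mulrC.
  have -> : xi * x = z * (b * x) by rewrite hz mulrA.
  rewrite fejer_cos /S !mulrA; field; rewrite !gt_eqF//.
have h a : rintegrable (S a) /\ rint (S a) = `|a * b| * fejer_mass := rint_fejer_sqr _.
rewrite /ft; under [X in rint X]eq_fun do rewrite E.
have i1 := rintegrableZ 2^-1 (h (1 + z)).1.
have i2 := rintegrableZ 2^-1 (h (1 - z)).1.
rewrite rintZ; last by apply: rintegrableB (h z).1; exact: rintegrableD.
rewrite rintB; [|exact: rintegrableD|exact: (h z).1].
rewrite (rintD i1 i2) (rintZ _ (h (1 + z)).1) (rintZ _ (h (1 - z)).1).
rewrite (h (1 + z)).2 (h (1 - z)).2 (h z).2 (normrM (1 + z)) (normrM (1 - z)) (normrM z) (gtr0_norm b0) /tri.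
move: `|1 + z| `|1 - z| `|z| => p q r; field.
by rewrite !gt_eqF.
Qed.

Lemma rint_fejerK b : 0 < b -> rint (fejerK b) = 1.
Proof.
move=> b0; have := ft_fejerK 0 b0; rewrite mul0r /tri !addr0 subr0 normr0 normr1 => h.
transitivity (ft (fejerK b) 0); last by rewrite h; lra.
by congr rint; apply/funext => x; rewrite mul0r cos0 mulr1.
Qed.

End FejerKernel.

(** * Kernels reproducing a Fejer kernel *)

Section Reproducing.
Variable R : realType.
Local Notation RM := (measurableTypeR R).
Local Notation mu := (@lebesgue_measure R).
Implicit Types (k : RM -> R).

Definition kernel k := rintegrable k /\ forall x, k (- x) = k x.

(** A cosine is an eigenfunction of convolution by an even kernel: in the addition formula the sine
    part integrates to 0 by oddness. *)
Lemma ft_shift k xi x : kernel k ->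
  rint (fun t => k t * cos (xi * (x - t))) = cos (xi * x) * ft k xi.
Proof.
move=> [hk kN].
transitivity (rint (fun t => cos (xi * x) * (k t * cos (xi * t)) +
    sin (xi * x) * (k t * sin (xi * t)))).
  congr rint; apply/funext => t; rewrite mulrBr cosB; ring.
have ic := rintegrable_cos xi hk; have is_ := rintegrable_sin xi hk.
rewrite (rintD (rintegrableZ _ ic) (rintegrableZ _ is_)) (rintZ _ ic) (rintZ _ is_).
rewrite [rint (fun t => k t * sin _)]rint_odd ?mulr0 ?addr0//.
  exact: rintegrable_measurable.
by move=> t; rewrite kN mulrN sinN mulrN.
Qed.

(* Uses the representation of the Fejer kernel as an average of cosines. *)
Lemma fejerK_reproducing (a : R) k x : 0 < a -> kernel k ->
  (forall xi, 0 <= xi <= a -> ft k xi = 1) ->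
  rint (fun t => fejerK a (x - t) * k t) = fejerK a x.
Proof.
move=> a0 hk k1; have [ik kN] := hk.
have mk := rintegrable_measurable ik.
(* The half tent whose cosine transform is [fejer], extended by 0 to the whole line so that Fubini's
   theorem applies there. *)
pose phi (s : RM) : R := \1_(`[0%R, 1%R] : set R) s * (1 - s).
have mphi : measurable_fun [set: RM] phi.
  apply: measurable_funM; first exact: measurable_indic.
  exact: measurable_reflect.
have phi1 s : `|phi s| <= \1_(`[0%R, 1%R] : set R) s.
  rewrite /phi indicE; case: (boolP (s \in _)) => [|_]; last by rewrite mul0r normr0.
  rewrite inE /= in_itv /= mul1r => /andP[s0 s1].
  by rewrite ger0_norm ?subr_ge0// gerBl.
have iphi : rintegrable phi.
  apply: rintegrableP => //.
  apply: (@le_lt_trans _ _ (\int[mu]_s (\1_(`[0%R, 1%R] : set R) s)%:E)%E).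
    apply: ge0_le_integral => //.
    - by apply/measurable_EFinP; apply: measurableT_comp.
    - by apply/measurable_EFinP; exact: measurable_indic.
    by move=> s _; rewrite lee_fin.
  rewrite integral_indic// setIT; apply: le_lt_trans (ltry 1).
  by rewrite le_eqVlt; apply/orP; left; apply/eqP; exact: mu01.
have fE (z : R) : rint (fun s => phi s * cos (z * s)) = fejer z.
  rewrite /rint -[RHS]/(fine (fejer z)%:E) -fejer_integral; congr fine.
  rewrite [RHS]integral_mkcond; apply: eq_integral => s _; rewrite patchE /phi indicE.
  by case: ifPn => _; rewrite ?mul1r// !mul0r.
(* Integrating h in s first gives [k t * fejer (a * (x - t))]. Integrating in t first gives
   [phi s * cos (a * s * x)] times [ft k (a * s)], which is 1 because [a * s] lies in [0, a] when
   phi does not vanish at s. *)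
pose h (p : RM * RM) : R := k p.1 * phi p.2 * cos (a * (x - p.1) * p.2).
have mh : measurable_fun [set: (RM * RM)%type] h.
  apply: measurable_funM.
    apply: measurable_funM; first exact: measurableT_comp mk measurable_fst.
    exact: measurableT_comp mphi measurable_snd.
  apply: (measurableT_comp (continuous_measurable_fun (@continuous_cos R))).
  apply: measurable_funM; last exact: measurable_snd.
  apply: (measurableT_comp (@measurable_scale R a)).
  exact: (measurableT_comp (@measurable_reflect R x) measurable_fst).
have ih : (mu \x mu)%E.-integrable [set: (RM * RM)%type] (EFin \o h).
  apply/integrable12ltyP; first exact/measurable_EFinP.
  apply: (@le_lt_trans _ _ (\int[mu]_t (`|k t|%:E * \int[mu]_s `|phi s|%:E))%E).
    apply: ge0_le_integral => //.
    - by move=> t _; apply: integral_ge0.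
    - apply: (@measurable_fun_fubini_tonelli_F _ _ RM RM R mu (fun p => `|(h p)%:E|)%E) => //.
      by apply: measurableT_comp => //; exact/measurable_EFinP.
    - apply: emeasurable_funM => //; apply/measurable_EFinP.
      exact: measurableT_comp.
    move=> t _; rewrite -ge0_integralZl_EFin//; last first.
      by apply/measurable_EFinP; exact: measurableT_comp.
    apply: ge0_le_integral => //.
    - apply: measurableT_comp => //; apply/measurable_EFinP.
      by apply: (measurableT_comp mh); exact: measurable_pair1.
    - by apply: measurable_funeM; apply/measurable_EFinP; exact: measurableT_comp.
    move=> s _; rewrite -EFinM lee_fin /h /= !normrM.
    by apply: ler_piMr; [exact: mulr_ge0|exact: cos_max].
  rewrite ge0_integralZr//; last 2 first.
  - by apply/measurable_EFinP; exact: measurableT_comp.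
  - by apply: integral_ge0.
  rewrite lte_mul_pinfty//.
  - by apply: integral_ge0.
  - by rewrite ge0_fin_numE ?rintegrable_lty//; apply: integral_ge0.
  - exact: rintegrable_lty.
have F := Fubini ih.
have E1 : (\int[mu]_t \int[mu]_s (EFin \o h) (t, s) =
    \int[mu]_t (k t * fejer (a * (x - t)))%:E)%E.
  apply: eq_integral => t _; rewrite -fE -rintZ ?rintE//.
  - by apply: eq_integral => s _; rewrite /h /= mulrA.
  - by apply: rintegrableZ; exact: rintegrable_cos.
  - exact: rintegrable_cos.
have E2 : (\int[mu]_s \int[mu]_t (EFin \o h) (t, s) = (fejer (a * x))%:E)%E.
  rewrite -fE rintE; last exact: rintegrable_cos.
  apply: eq_integral => s _.
  transitivity (\int[mu]_t (phi s * (k t * cos (a * s * (x - t))))%:E)%E.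
    by apply: eq_integral => t _; rewrite /h /=; congr EFin; rewrite mulrAC [RHS]mulrC;
       congr (_ * cos _ * _); ring.
  have ikc : rintegrable (fun t => k t * cos (a * s * (x - t))).
    apply: (rintegrable_mul ik (C := 1)) => [|t]; last exact: cos_max.
    exact: measurableT_comp (measurable_cos_scale (a * s)) (@measurable_reflect R x).
  rewrite -rintE; last exact: rintegrableZ.
  rewrite rintZ// ft_shift// /phi indicE.
  case: (boolP (s \in _)) => [|_]; last by rewrite !mul0r.
  rewrite inE /= in_itv /= => /andP[s0 s1]; rewrite k1.
    by rewrite mulr1; congr (_ * cos _)%:E; ring.
  by rewrite mulr_ge0 ?(ltW a0)//= ler_piMr// ltW.
transitivity (rint (fun t => a / fejer_mass R * (k t * fejer (a * (x - t))))).
  by congr rint; apply/funext => t; rewrite /fejerK -mulrA; congr (_ * _); exact: mulrC.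
rewrite rintZ; first by rewrite /fejerK; congr (_ * _); rewrite /rint -E1 F E2.
apply: (rintegrable_mul ik (C := 1)) => [|t].
  apply: (measurableT_comp (@measurable_fejer R)).
  exact: (measurableT_comp (@measurable_scale R a) (@measurable_reflect R x)).
by rewrite ger0_norm ?fejer_ge0// fejer_le1.
Qed.

End Reproducing.

(** * Kernels whose transform is 1 on an interval *)

Section FlatKernels.
Variable R : realType.

Lemma tri01 (t : R) : 0 <= t <= 1 -> tri t = 1 - t.
Proof.
by move=> /andP[t0 t1]; rewrite /tri !ger0_norm ?subr_ge0 ?addr_ge0//; lra.
Qed.

(** The de la Vallee Poussin kernel: twice the tent of half-width [2 * d] minus the tent of
    half-width d is constant 1 on [-d, d]. *)
Definition flatK (d x : R) : R := 2 * fejerK (2 * d) x - fejerK d x.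

Lemma kernel_flatK d : 0 < d -> kernel (flatK d).
Proof.
move=> d0; have d2 : 0 < 2 * d by rewrite mulr_gt0.
split; last by move=> x; rewrite /flatK !fejerKN.
apply: rintegrableB; last exact: rintegrable_fejerK.
by apply: rintegrableZ; exact: rintegrable_fejerK.
Qed.

Lemma ft_flatK d xi : 0 < d -> 0 <= xi <= d -> ft (flatK d) xi = 1.
Proof.
move=> d0 /andP[x0 xd]; have d2 : 0 < 2 * d by rewrite mulr_gt0.
have i1 := rintegrable_cos xi (rintegrable_fejerK d2).
have i2 := rintegrable_cos xi (rintegrable_fejerK d0).
have -> : ft (flatK d) xi = 2 * ft (fejerK (2 * d)) xi - ft (fejerK d) xi.
  rewrite /ft -(rintZ _ i1) -(rintB (rintegrableZ _ i1) i2); congr rint.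
  by apply/funext => x; rewrite /flatK mulrBl mulrA.
rewrite !ft_fejerK// !tri01; last 2 first.
- by rewrite divr_ge0 ?(ltW d0)//= ler_pdivrMr// mul1r.
- by rewrite divr_ge0 ?(ltW d2)//= ler_pdivrMr// mul1r (le_trans xd)//; lra.
by field; rewrite gt_eqF.
Qed.

(** By this scaling the L^1 norm of the kernel does not depend on d, and its modulus of continuity
    at z depends only on [d * z]. *)
Lemma flatK_scale d x : flatK d x = d * flatK 1 (d * x).
Proof. by rewrite /flatK /fejerK -(mulrA 2 d x) !mulr1 !mul1r; ring. Qed.

Definition node (d : R) (m : nat) (j : 'I_m.*2.+1) : R := (j%:R - m%:R) * d.

(** The sum of the Fejer kernel modulated to the nodes; the sine parts cancel because the nodes are
    symmetric about 0. In frequency it is a sum of tents spaced by their half-width d. *)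
Definition sumK (d : R) (m : nat) (x : R) : R :=
  \sum_(j < m.*2.+1) fejerK d x * cos (node d j * x).

Lemma kernel_sumK d m : 0 < d -> kernel (sumK d m).
Proof.
move=> d0; split; last first.
  by move=> x; apply: eq_bigr => j _; rewrite fejerKN mulrN cosN.
by apply: rintegrable_sum => j; apply: rintegrable_cos; exact: rintegrable_fejerK.
Qed.

Lemma tri_diff (t : R) :
  tri t = (2^-1 * `|t + 1| - 2^-1 * `|t|) - (2^-1 * `|t| - 2^-1 * `|t - 1|).
Proof. by rewrite /tri [1 + t]addrC [`|1 - t|]distrC; lra. Qed.

(** Tents at unit distance form a partition of unity. As each is a second difference, the sum
    telescopes to boundary terms, whose absolute values are resolved by [0 <= t <= m%:R]. Both signs
    occur because a product of two cosines involves the sum and the difference of the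
    frequencies. *)
Lemma tri_sum (t : R) m : 0 <= t <= m%:R ->
  \sum_(j < m.*2.+1) tri (t + (j%:R - m%:R)) = 1 /\
  \sum_(j < m.*2.+1) tri (t - (j%:R - m%:R)) = 1.
Proof.
move=> /andP[t0 tm].
pose e (i : nat) : R := 2^-1 * `|t - m%:R + i%:R| - 2^-1 * `|t - m%:R + i%:R - 1|.
pose e' (i : nat) : R := 2^-1 * `|t + m%:R + 1 - i%:R| - 2^-1 * `|t + m%:R - i%:R|.
have mm : (m.*2.+1%:R : R) = m%:R + m%:R + 1 by rewrite -addnn -addn1 !natrD.
have m0 : 0 <= m%:R :> R by [].
split.
- transitivity (\sum_(0 <= j < m.*2.+1) (e j.+1 - e j)).
    rewrite big_mkord; apply: eq_bigr => j _; have jS : (j.+1%:R : R) = j%:R + 1 by rewrite natr1.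
    rewrite tri_diff /e jS.
    have -> : t + (j%:R - m%:R) + 1 = t - m%:R + (j%:R + 1) by ring.
    have -> : t + (j%:R - m%:R) = t - m%:R + j%:R by ring.
    by have -> : t - m%:R + (j%:R + 1) - 1 = t - m%:R + j%:R by ring.
  rewrite telescope_sumr// /e mm addr0.
  have -> : t - m%:R + (m%:R + m%:R + 1) = t + m%:R + 1 by ring.
  rewrite addrK (@ger0_norm _ (t + m%:R + 1)) ?(@ger0_norm _ (t + m%:R)); [|lra..].
  by rewrite !ler0_norm; [lra..].
- transitivity (\sum_(0 <= j < m.*2.+1) (- e' j.+1 - - e' j)).
    rewrite big_mkord; apply: eq_bigr => j _; have jS : (j.+1%:R : R) = j%:R + 1 by rewrite natr1.
    rewrite tri_diff /e' jS.
    have -> : t - (j%:R - m%:R) + 1 = t + m%:R + 1 - j%:R by ring.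
    have -> : t - (j%:R - m%:R) - 1 = t + m%:R - (j%:R + 1) by ring.
    have -> : t - (j%:R - m%:R) = t + m%:R - j%:R by ring.
    have -> : t + m%:R + 1 - (j%:R + 1) = t + m%:R - j%:R by ring.
    lra.
  rewrite (@telescope_sumr _ 0 m.*2.+1 (fun j => - e' j))// /e' mm !subr0.
  have -> : t + m%:R + 1 - (m%:R + m%:R + 1) = t - m%:R by ring.
  have -> : t + m%:R - (m%:R + m%:R + 1) = t - m%:R - 1 by ring.
  rewrite (@ger0_norm _ (t + m%:R + 1)) ?(@ger0_norm _ (t + m%:R)); [|lra..].
  by rewrite !ler0_norm; [lra..].
Qed.

Lemma ft_sumK d m xi : 0 < d -> 0 <= xi <= m%:R * d -> ft (sumK d m) xi = 1.
Proof.
move=> d0 /andP[x0 xm].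
have i s : rintegrable (fun x => fejerK d x * cos (s * x)).
  by apply: rintegrable_cos; exact: rintegrable_fejerK.
have -> : ft (sumK d m) xi = \sum_(j < m.*2.+1)
    (2^-1 * ft (fejerK d) (xi + node d j) + 2^-1 * ft (fejerK d) (xi - node d j)).
  transitivity (rint (fun x => \sum_(j < m.*2.+1)
    (2^-1 * (fejerK d x * cos ((xi + node d j) * x)) +
     2^-1 * (fejerK d x * cos ((xi - node d j) * x))))).
    congr rint; apply/funext => x; rewrite /sumK mulr_suml; apply: eq_bigr => j _.
    by rewrite mulrDl mulrBl cosD cosB; field.
  rewrite rint_sum; last first.
    by move=> j; apply: rintegrableD; exact: rintegrableZ.
  by apply: eq_bigr => j _; rewrite (rintD (rintegrableZ _ (i _)) (rintegrableZ _ (i _))) !rintZ.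
rewrite big_split /= -!mulr_sumr.
have tm : 0 <= xi / d <= m%:R.
  by rewrite divr_ge0 ?(ltW d0)//= ler_pdivrMr.
have [E1 E2] := tri_sum tm.
have -> : \sum_(j < m.*2.+1) ft (fejerK d) (xi + node d j) = 1.
  rewrite -[RHS]E1; apply: eq_bigr => j _; rewrite ft_fejerK// /node.
  by congr tri; field; rewrite gt_eqF.
have -> : \sum_(j < m.*2.+1) ft (fejerK d) (xi - node d j) = 1.
  rewrite -[RHS]E2; apply: eq_bigr => j _; rewrite ft_fejerK// /node.
  by congr tri; field; rewrite gt_eqF.
lra.
Qed.

Lemma sin_node_sum d m (x : R) : \sum_(j < m.*2.+1) sin (node d j * x) = 0.
Proof.
set S := LHS; have : S = - S.
  rewrite {1}/S (reindex_inj rev_ord_inj) /= -sumrN; apply: eq_bigr => j _.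
  rewrite -sinN -mulNr; congr (sin (_ * _)); rewrite /node /= -mulNr; congr (_ * _).
  have -> : ((m.*2.+1 - j.+1)%:R : R) = m%:R + m%:R - j%:R.
    rewrite subSS natrB; last by rewrite -ltnS; exact: ltn_ord.
    by rewrite -[X in X%:R - _]addnn natrD.
  ring.
by move/eqP; rewrite -subr_eq0 opprK -mulr2n mulrn_eq0 => /eqP.
Qed.

End FlatKernels.

(** * Moduli of continuity *)

Section Translation.
Variable R : realType.
Local Notation RM := (measurableTypeR R).
Local Notation mu := (@lebesgue_measure R).
Implicit Types (u v : RM -> R).

(** Dominated convergence is available along sequences: if no d worked, the choices [d = n.+1%:R^-1]
    would provide a sequence of parameters tending to 0 that contradicts it. *)
Lemma dominated_param (g : R -> RM -> R) (G : RM -> R) :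
  (forall p, measurable_fun [set: RM] (g p)) -> measurable_fun [set: RM] G ->
  (forall p x, `|p| <= 1 -> 0 <= g p x <= G x) -> (\int[mu]_x (G x)%:E < +oo)%E ->
  (forall x, g p x @[p --> (0 : R)] --> (0 : R)) ->
  forall e, 0 < e -> exists2 d, 0 < d & forall p, `|p| < d -> (\int[mu]_x (g p x)%:E < e%:E)%E.
Proof.
move=> mg mG gG iG g0 e e0; apply: contrapT => H.
have h (n : nat) : exists p, `|p| < n.+1%:R^-1 /\ (e%:E <= \int[mu]_x (g p x)%:E)%E.
  apply: contrapT => K; apply: H; exists n.+1%:R^-1; first by rewrite invr_gt0.
  move=> p hp; rewrite ltNge; apply/negP => hle; apply: K; exists p; split => //.
have [p hp] := choice h.
have p0 : p n @[n --> \oo] --> (0 : R).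
  apply/cvgr0Pnorm_lt => d d0.
  have := near_infty_natSinv_lt (PosNum d0); apply: filterS => n /= hn.
  exact: lt_trans (hp n).1 hn.
have p1 n : `|p n| <= 1.
  by apply: le_trans (ltW (hp n).1) _; rewrite invf_le1// ler1n.
have := @dominated_cvg0 R (fun n => g (p n)) G (fun n => mg _) mG
  (fun n x => gG _ x (p1 n)) iG (fun x => cvg_comp _ _ p0 (g0 x)).
move=> /fine_cvgP[_ /cvgr0Pnorm_lt/(_ e e0)] => -[N _ /(_ N (leqnn N))] /=.
have i0 : (0 <= \int[mu]_x (g (p N) x)%:E)%E.
  by apply: integral_ge0 => x _; rewrite lee_fin; case/andP: (gG _ x (p1 N)).
have il : (\int[mu]_x (g (p N) x)%:E < +oo)%E.
  apply: le_lt_trans iG; apply: ge0_le_integral => //.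
  - by move=> x _; rewrite lee_fin; case/andP: (gG _ x (p1 N)).
  - exact/measurable_EFinP.
  - exact/measurable_EFinP.
  - by move=> x _; rewrite lee_fin; case/andP: (gG _ x (p1 N)).
rewrite ger0_norm ?fine_ge0// -lte_fin fineK ?ge0_fin_numE// => hlt.
by have := le_lt_trans (hp N).2 hlt; rewrite ltxx.
Qed.

Definition modulus u (z : RM) : \bar R := \int[mu]_x `|u (x - z) - u x|%:E.

Lemma measurable_diff u : measurable_fun [set: RM] u ->
  measurable_fun [set: (RM * RM)%type] (fun p : RM * RM => `|u (p.1 - p.2) - u p.1|).
Proof.
move=> mu_; apply: measurableT_comp => //; apply: measurable_funB.
  exact: measurableT_comp mu_ (@measurable_subM R).
exact: measurableT_comp mu_ measurable_fst.
Qed.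

Lemma measurable_modulus u : measurable_fun [set: RM] u ->
  measurable_fun [set: RM] (modulus u).
Proof.
move=> mu_; apply: (@measurable_fun_fubini_tonelli_G _ _ RM RM R mu
  (fun p => `|u (p.1 - p.2) - u p.1|%:E)).
  by apply/measurable_EFinP; exact: measurable_diff.
by move=> p; rewrite lee_fin.
Qed.

Lemma modulus_ge0 u z : (0 <= modulus u z)%E.
Proof. by apply: integral_ge0 => x _; rewrite lee_fin. Qed.

Lemma measurable_shift u z : measurable_fun [set: RM] u ->
  measurable_fun [set: RM] (fun x => u (x - z)).
Proof.
move=> mu_; apply: (measurableT_comp mu_); apply: measurable_funB => //.
Qed.

Lemma measurable_absE u : measurable_fun [set: RM] u ->
  measurable_fun [set: RM] (fun x => `|u x|%:E).
Proof. by move=> mu_; apply/measurable_EFinP; exact: measurableT_comp. Qed.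

Lemma modulus_le u z : measurable_fun [set: RM] u ->
  (modulus u z <= 2%:E * \int[mu]_x `|u x|%:E)%E.
Proof.
move=> mu_; have ms := measurable_shift z mu_.
apply: (@le_trans _ _ (\int[mu]_x (`|u (x - z)|%:E + `|u x|%:E))%E).
  apply: ge0_le_integral => //.
  - by apply: measurable_absE; exact: measurable_funB.
  - by apply: emeasurable_funD; exact: measurable_absE.
  - by move=> x _; rewrite -EFinD lee_fin ler_normB.
rewrite ge0_integralD//; [|exact: measurable_absE..].
rewrite (ge0_integral_shift z (f := fun x => `|u x|%:E))//; last exact: measurable_absE.
have i0 : (0 <= \int[mu]_x `|u x|%:E)%E by apply: integral_ge0.
by rewrite (_ : 2 = 1 + 1)// EFinD ge0_muleDl// mul1e.
Qed.

Lemma modulus_lin u v (c : R) z : measurable_fun [set: RM] u -> measurable_fun [set: RM] v ->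
  (modulus (fun x => (c * u x - v x)%R) z <= `|c|%:E * modulus u z + modulus v z)%E.
Proof.
move=> mu_ mv; have su := measurable_shift z mu_; have sv := measurable_shift z mv.
have m1 := measurable_absE (measurable_funB su mu_).
have m2 := measurable_absE (measurable_funB sv mv).
rewrite /modulus -ge0_integralZl_EFin// -ge0_integralD//; last first.
  exact: measurable_funeM.
apply: ge0_le_integral => //.
- apply: measurable_absE; apply: measurable_funB; apply: measurable_funB => //;
  by apply: measurable_funM.
- by apply: emeasurable_funD => //; exact: measurable_funeM.
move=> x _; rewrite -EFinM -EFinD lee_fin -normrM.
by apply: le_trans (ler_normB _ _); rewrite le_eqVlt; apply/orP; left; apply/eqP; congr (`|_|); ring.
Qed.

Lemma modulus_scale u (b z : R) : 0 < b -> measurable_fun [set: RM] u ->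
  modulus (fun x => b * u (b * x)) z = modulus u (b * z).
Proof.
move=> b0 mu_; rewrite /modulus.
have ms := measurable_absE (measurable_funB (measurable_shift (b * z) mu_) mu_).
have := @ge0_integral_scale R b (fun x => `|u (x - b * z) - u x|%:E) b0 ms (fun x => normr_ge0 _).
move=> /= /(congr1 (fun y => b%:E * y)%E); rewrite muleA -EFinM mulfV ?gt_eqF// mul1e => <-.
rewrite -ge0_integralZl_EFin ?(ltW b0)//; last first.
  by apply: (measurableT_comp ms); exact: measurable_scale.
by apply: eq_integral => x _; rewrite -EFinM (mulrBr b x z) -[b * u _ - _]mulrBr normrM (gtr0_norm b0).
Qed.

Lemma cvg_modulusP u : (forall e, 0 < e -> exists2 d, 0 < d &
    forall z, `|z| < d -> (modulus u z < e%:E)%E) ->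
  (forall z, (modulus u z < +oo)%E) ->
  fine (modulus u z) @[z --> (0 : R)] --> (0 : R).
Proof.
move=> h hl; apply/cvgr0Pnorm_lt => e e0; have [d d0 hd] := h e e0.
apply/nbhs_ballP; exists d => // z; rewrite /ball_ /= sub0r normrN => /hd.
rewrite ger0_norm ?fine_ge0 ?modulus_ge0// -lte_fin fineK//.
by rewrite ge0_fin_numE ?modulus_ge0.
Qed.

Lemma modulus_fejer (e : R) : 0 < e -> exists2 d, 0 < d &
  forall z, `|z| < d -> (modulus (@fejer R) z < e%:E)%E.
Proof.
move=> e0.
have mf := @measurable_fejer R.
(* For [|z| <= 1] one has [1 + x ^+ 2 <= 3 * (1 + (x - z) ^+ 2)], so the translated bound costs a
   factor 3 and [4 * 3 = 12]. *)
have bound (z x : R) : `|z| <= 1 ->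
    `|fejer (x - z) - fejer x| <= 12 * (1 + x ^+ 2)^-1 + 4 * (1 + x ^+ 2)^-1.
  move=> z1; apply: le_trans (ler_normB _ _) _.
  rewrite !ger0_norm ?fejer_ge0// lerD ?fejer_bound//.
  apply: le_trans (fejer_bound _) _.
  have p1 : 0 < 1 + x ^+ 2 by rewrite ltr_pwDl// sqr_ge0.
  have p2 : 0 < 1 + (x - z) ^+ 2 by rewrite ltr_pwDl// sqr_ge0.
  rewrite ler_pdivrMr// mulrAC ler_pdivlMr//.
  have zz : z ^+ 2 <= 1 by rewrite -real_normK ?num_real// exprn_ile1.
  have : 0 <= (x - z * 2) ^+ 2 by exact: sqr_ge0.
  nra.
have mi : measurable_fun [set: RM] (fun x : R => (1 + x ^+ 2)^-1).
  apply: continuous_measurable_fun => x; apply: cvgV.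
    by rewrite gt_eqF// ltr_pwDl// sqr_ge0.
  apply: cvgD; [exact: cvg_cst|exact: exprn_continuous].
have ii : (\int[mu]_x ((1 + x ^+ 2)^-1)%:E < +oo)%E.
  rewrite ge0_symfun_integralT//; last 3 first.
  - by move=> x; rewrite invr_ge0 addr_ge0// sqr_ge0.
  - move=> x; apply: cvgV; first by rewrite gt_eqF// ltr_pwDl// sqr_ge0.
    apply: cvgD; [exact: cvg_cst|exact: exprn_continuous].
  - by move=> x /=; rewrite sqrrN.
  apply: lte_mul_pinfty => //.
  by rewrite -set_itvcy (integral0y_oneDsqr R) ltry.
apply: (dominated_param (g := fun z x => `|fejer (x - z) - fejer x|)
  (G := fun x => 16 * (1 + x ^+ 2)^-1)) => //.
- move=> z; apply: measurableT_comp => //; apply: measurable_funB => //.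
  exact: measurable_shift.
- exact: measurable_funM.
- by move=> z x z1; rewrite normr_ge0 /= (le_trans (bound z x z1))//; lra.
- under eq_integral do rewrite EFinM.
  rewrite ge0_integralZl_EFin//; last 2 first.
  + by move=> x _; rewrite lee_fin invr_ge0 addr_ge0// sqr_ge0.
  + exact/measurable_EFinP.
  exact: lte_mul_pinfty.
move=> x; apply/cvgr0Pnorm_lt => d d0; apply/nbhs_ballP; exists d => // z.
rewrite /ball_ /= sub0r normrN normr_id => zd.
by apply: le_lt_trans (fejer_lipschitz _ _) _; rewrite addrAC subrr sub0r normrN.
Qed.

Lemma compact_open_shift (K U : set R) : compact K -> open U -> K `<=` U ->
  exists2 d, 0 < d & forall z x, `|z| < d -> K x -> U (x + z).
Proof.
move=> cK oU KU.
have := (compact_near_coveringP _).1 cK R (nbhs (0 : R)) (fun z x => U (x + z)) _.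
move=> /(_ _)[|d d0 hd].
  move=> x Kx; have : nbhs (x + 0) U by rewrite addr0; exact: open_nbhs_nbhs (conj oU (KU _ Kx)).
  have /= cD : (p.1 + p.2) @[p --> (x, 0 : R)] --> x + 0 by exact: (@add_continuous R (x, 0)).
  by move=> /cD.
exists d => // z x zd Kx; apply: (hd z) => //=.
by rewrite /ball_ /= sub0r normrN.
Qed.

(** Regularity gives a compact K inside E and an open U around E with [U \ K] of measure below
    [e / 2]. A small translation keeps K inside U, so where the indicator changes, x or [x - z] lies
    in [U \ K]. *)
Lemma modulus_indic (E : set RM) (e : R) : measurable E -> (mu E < +oo)%E -> 0 < e ->
  exists2 d, 0 < d & forall z, `|z| < d -> (modulus \1_E z < e%:E)%E.
Proof.
move=> mE El e0.
have e4 : 0 < e / 4 by rewrite divr_gt0.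
have [U [oU EU hU]] := lebesgue_regularity_outer mE El e4.
have [K [cK KE hK]] := lebesgue_regularity_inner mE El e4.
have [d d0 hd] := compact_open_shift cK oU (subset_trans KE EU).
have mU : measurable (U : set RM) by exact: open_measurable.
have mK : measurable (K : set RM) by apply: closed_measurable; apply: compact_closed.
pose W : set RM := U `\` K.
have mW : measurable W by exact: measurableD.
have hW : (mu W < (e / 2)%:E)%E.
  have -> : W = (U `\` E) `|` (E `\` K).
    apply/seteqP; split => [x [Ux Kx]|x [[Ux Ex]|[Ex Kx]]].
    - by have [Ex|Ex] := pselect (E x); [right|left].
    - by split => // /KE.
    - by split => //; exact: EU.
  apply: (le_lt_trans (measureU2 mu (measurableD mU mE) (measurableD mE mK))).
  have -> : e / 2 = e / 4 + e / 4 by field.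
  by rewrite EFinD lteD.
exists d => // z zd.
have h1W : measurable_fun [set: RM] (\1_W : RM -> R) by exact: measurable_indic.
apply: (@le_lt_trans _ _ (\int[mu]_x ((\1_W (x - z))%:E + (\1_W x)%:E))%E).
  apply: ge0_le_integral => //.
  - apply: measurable_absE; apply: measurable_funB; last exact: measurable_indic.
    by apply: measurable_shift; exact: measurable_indic.
  - apply: emeasurable_funD; apply/measurable_EFinP => //.
    exact: measurable_shift.
  move=> x _; rewrite -EFinD lee_fin !indicE.
  have inW y : U y -> ~ K y -> (y \in W) by move=> Uy Ky; rewrite inE.
  have [h1|h1] := boolP (x - z \in E); have [h2|h2] := boolP (x \in E);
    rewrite ?subrr ?normr0 ?subr0 ?sub0r ?normrN ?normr1 ?addr_ge0//.
  - have Exz := set_mem h1; have Ex : ~ E x by move=> h; rewrite mem_set in h2.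
    have [Kxz|Kxz] := pselect (K (x - z)).
      rewrite (inW x) ?lerDr//; last by move=> /KE.
      by have := hd z _ zd Kxz; rewrite subrK.
    by rewrite (inW (x - z)) ?lerDl//; exact: EU.
  - have Ex := set_mem h2; have Exz : ~ E (x - z) by move=> h; rewrite mem_set in h1.
    have [Kx|Kx] := pselect (K x).
      rewrite (inW (x - z)) ?lerDl//; last by move=> /KE.
      by apply: hd => //; rewrite normrN.
    by rewrite (inW x) ?lerDr//; exact: EU.
rewrite ge0_integralD//; last 2 first.
- by apply/measurable_EFinP; exact: measurable_shift.
- exact/measurable_EFinP.
rewrite (ge0_integral_shift z (f := fun x => (\1_W x)%:E))//; last first.
  exact/measurable_EFinP.
rewrite integral_indic// setIT (_ : e = e / 2 + e / 2); last by field.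
by rewrite EFinD lteD.
Qed.

End Translation.

(** * Wiener's theorem in L^1 *)

Section SignedLift.
Variables (R : realType) (A : unitalBanachAlgType R[i]).
Local Notation RM := (measurableTypeR R).
Local Notation mu := (@lebesgue_measure R).
Local Notation L := (L1 A).
Local Notation "x ** y" := (l1mul x y) (at level 40, left associativity).
Implicit Types (k u : RM -> R) (a b c : A).

Lemma strongly_measurable_lift k a : measurable_fun [set: RM] k ->
  strongly_measurable (lift k a).
Proof.
by move=> mk; apply: strongly_measurable_real => //; exact: strongly_measurable_cst.
Qed.

Lemma in_L1_klift k a : rintegrable k -> in_L1 (lift k a).
Proof.
move=> ik; have mk := rintegrable_measurable ik; split; first exact: strongly_measurable_lift.
rewrite inorm_real//; apply: lte_mul_pinfty; rewrite ?lee_fin ?rnorm_ge0//.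
exact: rintegrable_lty.
Qed.

Lemma l1norm_lift k a : rintegrable k ->
  l1norm (cls (lift k a)) = rnorm a * rint (fun x => `|k x|).
Proof.
move=> ik; have mk := rintegrable_measurable ik; apply: EFin_inj.
rewrite l1norm_cls; last exact: in_L1_klift.
rewrite inorm_real// EFinM rintE//; apply: rintegrableP; first exact: measurableT_comp.
by under eq_integral do rewrite normr_id; exact: rintegrable_lty.
Qed.

Lemma cls_liftDr k a b : rintegrable k ->
  cls (lift k (a + b)) = cls (lift k a) + cls (lift k b).
Proof.
move=> ik; rewrite -clsD; [|exact: in_L1_klift..]; congr cls; apply/funext => t.
by rewrite /lift scalerDr.
Qed.

Lemma tconvE f g x : (nconv f g x < +oo)%E -> tconv f g x = convolution f g x :> A.
Proof. by rewrite /tconv => ->. Qed.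

Lemma nconv_lift_lty u a (f : R -> A) C x : measurable_fun [set: RM] u ->
  (forall t, `|u t| <= C) -> in_L1 f -> (nconv (lift u a) f x < +oo)%E.
Proof.
move=> mu_ uC [mf fi].
have C0 : 0 <= C by exact: le_trans (normr_ge0 _) (uC 0).
apply: (@le_lt_trans _ _ (\int[mu]_t ((C * rnorm a)%:E * (rnorm (f t))%:E))%E).
  apply: ge0_le_integral => //.
  - by move=> t _; rewrite -EFinM lee_fin mulr_ge0 ?rnorm_ge0.
  - apply: emeasurable_funM; last exact: measurable_rnormE.
    by apply: measurable_rnormE; apply: strongly_measurable_reflect; exact: strongly_measurable_lift.
  - by apply: measurable_funeM; exact: measurable_rnormE.
  - by move=> t _; rewrite -!EFinM lee_fin /lift rnormZR ler_wpM2r ?rnorm_ge0// ler_wpM2r ?rnorm_ge0.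
rewrite ge0_integralZl_EFin//; last 3 first.
- by move=> t _; rewrite lee_fin rnorm_ge0.
- exact: measurable_rnormE.
- by rewrite mulr_ge0 ?rnorm_ge0.
by apply: lte_mul_pinfty => //; rewrite lee_fin mulr_ge0 ?rnorm_ge0.
Qed.

Lemma l1mul_reproducing u k a b C : rintegrable u -> (forall t, `|u t| <= C) -> rintegrable k ->
  (forall x, rint (fun t => u (x - t) * k t) = u x) ->
  cls (lift u a) ** cls (lift k b) = cls (lift u (bmul a b)).
Proof.
move=> iu uC ik h; have mu_ := rintegrable_measurable iu.
rewrite l1mul_cls; [|exact: in_L1_klift..]; congr cls; apply/funext => x.
have nc := nconv_lift_lty a x mu_ uC (in_L1_klift b ik).
rewrite tconvE//; apply: bochner_integralE.
have -> : (fun t => bmul (lift u a (x - t)) (lift k b t)) =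
    (fun t => (u (x - t) * k t)%:C *: bmul a b).
  by apply/funext => t; rewrite /lift -bscalerAl -bscalerAr scalerA -rmorphM.
rewrite /lift -(h x); apply: is_bochner_real.
have -> : (EFin \o (fun t => u (x - t) * k t)) = EFin \o (fun t => k t * u (x - t)).
  by apply/funext => t; rewrite /= mulrC.
apply: (rintegrable_mul ik (C := C)) => //.
exact: measurableT_comp mu_ (measurable_reflect x).
Qed.

Lemma l1mul_lift_central k (y : L) : rintegrable k ->
  cls (lift k bone) ** y = y ** cls (lift k bone).
Proof.
move=> ik; have Lk := in_L1_klift (bone : A) ik.
suff H (f : R -> A) : in_L1 f -> cls (lift k bone) ** cls f = cls f ** cls (lift k bone).
  by have := H _ (L1P y); rewrite clsK.
move=> Lf; rewrite (l1mul_cls Lk Lf) (l1mul_cls Lf Lk); apply: cls_eq; [exact: in_L1_tconv..|].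
apply: ae_equal_trans (tconv_ae Lk Lf) _.
apply: ae_equal_trans _ (ae_equal_sym (tconv_ae Lf Lk)).
have -> : convolution (lift k bone) f = convolution f (lift k bone); last exact: ae_equal_refl.
by apply/funext => x; exact: (convolution_central (fun t => (k t)%:C)).
Qed.

(** As v is the integral of f, the difference at x is the integral over t of [(u (x - t) - u x)]
    times [bmul a (f t)]; Tonelli turns its norm into the modulus of u. With u a flat kernel this
    compares [V_d b * f] with [V_d b v]; with u an indicator and f a Fejer kernel it yields the
    approximate identity. *)
Lemma lift_modulus u a (f : R -> A) v : rintegrable u -> is_bochner_integral f v -> in_L1 f ->
  ((l1norm (cls (lift u a) ** cls f - cls (lift u (bmul a v))))%:E <=
   (rnorm a)%:E * \int[mu]_t (modulus u t * (rnorm (f t))%:E))%E.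
Proof.
move=> iu hv Lf; have mu_ := rintegrable_measurable iu; have [mf fi] := Lf.
have Lu := in_L1_klift a iu; have Lv := in_L1_klift (bmul a v) iu.
rewrite l1mul_cls// -clsB//; last exact: in_L1_tconv.
rewrite l1norm_cls; last by apply: in_L1B => //; exact: in_L1_tconv.
pose h (p : RM * RM) : \bar R := ((rnorm a)%:E * (`|u (p.1 - p.2)%R - u p.1|%:E * (rnorm (f p.2))%:E))%E.
have mh : measurable_fun [set: (RM * RM)%type] h.
  apply: measurable_funeM; apply: emeasurable_funM.
    by apply/measurable_EFinP; exact: measurable_diff.
  exact: measurableT_comp (measurable_rnormE mf) measurable_snd.
have h0 p : (0 <= h p)%E by rewrite /h mule_ge0 ?mule_ge0// lee_fin ?rnorm_ge0.
have m1 (x : RM) : measurable_fun [set: RM] (fun t : RM => h (x, t)).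
  by apply: (measurableT_comp mh); exact: measurable_pair1.
have m2 (x : RM) : measurable_fun [set: RM] (fun t : RM => h (t, x)).
  by apply: (measurableT_comp mh); exact: measurable_pair2.
apply: (@le_trans _ _ (\int[mu]_x \int[mu]_t h (x, t))%E).
  apply: ae_ge0_le_integral => //.
  - by move=> x _; rewrite lee_fin rnorm_ge0.
  - apply: measurable_rnormE; apply: strongly_measurableB; last exact: Lv.1.
    by case: (in_L1_tconv Lu Lf).
  - by move=> x _; apply: integral_ge0.
  - exact: (@measurable_fun_fubini_tonelli_F _ _ RM RM R mu h).
  apply: ae_imply (nconv_lty_ae Lu Lf) => x nc _.
  rewrite tconvE//.
  have b1 := is_bochner_convolution Lu.1 Lf.1 nc.
  have b2 : is_bochner_integral (fun t => (u x)%:C *: bmul a (f t)) ((u x)%:C *: bmul a v).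
    apply: is_bochnerZ; apply: (is_bochner_map (T := bmul a) (K := rnorm a)) hv.
    - exact: rnorm_ge0.
    - by move=> c; exact: rnorm_bmul.
    - by move=> c d; exact: bmulBr.
    - by move=> r c; rewrite bscalerAr.
  have b3 := is_bochnerB b1 b2.
  apply: le_trans (is_bochner_norm b3) _.
  apply: inorm_le => [||t].
  - by case: b3.
  - exact: m1.
  rewrite /h /lift -bscalerAl -scalerBl -rmorphB rnormZR -!EFinM lee_fin mulrCA.
  by rewrite ler_wpM2l// rnorm_bmul.
rewrite (@fubini_tonelli _ _ RM RM R mu mu h)//.
rewrite -ge0_integralZl_EFin ?rnorm_ge0//; last 2 first.
- by move=> t _; rewrite mule_ge0 ?modulus_ge0// lee_fin rnorm_ge0.
- by apply: emeasurable_funM; [exact: measurable_modulus|exact: measurable_rnormE].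
apply: ge0_le_integral => //.
- by move=> t _; apply: integral_ge0.
- exact: (@measurable_fun_fubini_tonelli_G _ _ RM RM R mu h).
- apply: measurable_funeM; apply: emeasurable_funM; [exact: measurable_modulus|exact: measurable_rnormE].
move=> t _; have ms : measurable_fun [set: RM] (fun x => `|u (x - t) - u x|%:E).
  by apply: measurable_absE; apply: measurable_funB => //; exact: measurable_shift.
rewrite /h ge0_integralZl_EFin ?rnorm_ge0//; last 2 first.
- by move=> x _; rewrite mule_ge0// lee_fin ?rnorm_ge0.
- by apply: emeasurable_funM => /=; [exact: ms|exact: measurable_cst].
rewrite /= ge0_integralZr//; last first.
- by rewrite lee_fin rnorm_ge0.
Qed.

End SignedLift.

(** * Modulation, that is, translation of the frequency *)

Section Modulation.
Variables (R : realType) (A : unitalBanachAlgType R[i]).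
Local Notation RM := (measurableTypeR R).
Local Notation L := (L1 A).
Local Notation "x ** y" := (l1mul x y) (at level 40, left associativity).
Implicit Types (s : R) (f g : R -> A) (x y : L).

Definition modf s f (t : R) : A := cis (s * t) *: f t.

Lemma cisD (s t : R) : cis (s + t) = cis s * cis t.
Proof.
rewrite /cis cosD sinD; apply/eqP; rewrite eq_complex /= eqxx /=.
by apply/eqP; rewrite addrC.
Qed.

Lemma cis0 : cis (0 : R) = 1.
Proof. by rewrite /cis cos0 sin0. Qed.

Lemma cisE (t : R) : cis t = (cos t)%:C + 'i * (sin t)%:C.
Proof. exact: (complexE (cis t)). Qed.

Lemma strongly_measurable_modf s f : strongly_measurable f -> strongly_measurable (modf s f).
Proof.
move=> mf.
have -> : modf s f = fun t => (cos (s * t))%:C *: f t + 'i *: ((sin (s * t))%:C *: f t).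
  by apply/funext => t; rewrite /modf cisE scalerDl scalerA.
apply: strongly_measurableD; first exact: strongly_measurable_real (measurable_cos_scale s) mf.
by apply: strongly_measurableZ; exact: strongly_measurable_real (measurable_sin_scale s) mf.
Qed.

Lemma inorm_modf s f : inorm (modf s f) = inorm f.
Proof. by apply: eq_integral => t _; rewrite rnorm_cis. Qed.

Lemma in_L1_modf s f : in_L1 f -> in_L1 (modf s f).
Proof. by move=> [mf fi]; split; [exact: strongly_measurable_modf|rewrite inorm_modf]. Qed.

Lemma tconv_modf s f g : in_L1 f -> in_L1 g -> tconv (modf s f) (modf s g) = modf s (tconv f g).
Proof.
move=> Lf Lg; apply/funext => x.
have E : nconv (modf s f) (modf s g) x = nconv f g x.
  by apply: eq_integral => t _; rewrite !rnorm_cis.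
rewrite /modf; have [nc|nc] := pselect (nconv f g x < +oo)%E; last first.
  by rewrite /tconv E; move/negP/negPf : nc => ->; rewrite scaler0.
rewrite !tconvE//; last by rewrite E.
apply: bochner_integralE.
have := is_bochnerZ (cis (s * x)) (is_bochner_convolution Lf.1 Lg.1 nc).
congr is_bochner_integral; apply/funext => t.
by rewrite -bscalerAl -bscalerAr scalerA -cisD -mulrDr subrK.
Qed.

Definition modl s x : L := cls (modf s x).

Lemma modl_cls s f : in_L1 f -> modl s (cls f) = cls (modf s f).
Proof.
move=> Lf; apply: cls_eq; [exact: in_L1_modf (L1P _)|exact: in_L1_modf|].
by apply: ae_imply (ae_equal_sym (clsE Lf)) => t; rewrite /modf => ->.
Qed.

Lemma modlM s x y : modl s (x ** y) = modl s x ** modl s y.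
Proof.
suff H f g : in_L1 f -> in_L1 g -> modl s (cls f ** cls g) = modl s (cls f) ** modl s (cls g).
  by have := H _ _ (L1P x) (L1P y); rewrite !clsK.
move=> Lf Lg; rewrite (l1mul_cls Lf Lg) (modl_cls s Lf) (modl_cls s Lg) (modl_cls s (in_L1_tconv Lf Lg)).
by rewrite (l1mul_cls (in_L1_modf s Lf) (in_L1_modf s Lg)) tconv_modf.
Qed.

Lemma modlD s x y : modl s (x + y) = modl s x + modl s y.
Proof.
suff H f g : in_L1 f -> in_L1 g -> modl s (cls f + cls g) = modl s (cls f) + modl s (cls g).
  by have := H _ _ (L1P x) (L1P y); rewrite !clsK.
move=> Lf Lg; rewrite -(clsD Lf Lg) (modl_cls s Lf) (modl_cls s Lg) (modl_cls s (in_L1D Lf Lg)).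
rewrite -(clsD (in_L1_modf s Lf) (in_L1_modf s Lg)); congr cls.
by apply/funext => t; rewrite /modf scalerDr.
Qed.

Lemma modlK s x : modl s (modl (- s) x) = x.
Proof.
rewrite [modl (- s) x]/modl modl_cls; last exact: in_L1_modf (L1P _).
rewrite -[RHS]clsK; congr cls; apply/funext => t.
by rewrite /modf scalerA -cisD mulNr subrr cis0 scale1r.
Qed.

Lemma rnorm_cis_sub1 (t : R) (a : A) : rnorm (cis t *: a - a) <= 2 * `|t| * rnorm a.
Proof.
have sl : `|sin t| <= `|t|.
  have := cos_lipschitz (pi / 2 - t) (pi / 2).
  by rewrite cosB cos_pihalf sin_pihalf mul0r mul1r add0r subr0 addrAC subrr sub0r normrN.
have cl := cos_lipschitz t 0; rewrite cos0 subr0 in cl.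
have -> : cis t *: a - a = (cos t - 1)%:C *: a + 'i *: ((sin t)%:C *: a).
  by rewrite cisE scalerDl scalerA rmorphB /= scalerBl scale1r addrAC.
apply: le_trans (rnormD _ _) _.
have -> : rnorm ('i *: ((sin t)%:C *: a)) = `|sin t| * rnorm a.
  by rewrite rnormZ rnormZR /= expr0n add0r expr1n sqrtr1 mul1r.
rewrite rnormZR -mulrDl ler_wpM2r ?rnorm_ge0//; lra.
Qed.

(** Dominated convergence with majorant [2 * rnorm (x t)]. This is what makes the localization at
    one frequency valid at all nearby ones. *)
Lemma modl_continuous x s0 (e : R) : 0 < e ->
  exists2 d, 0 < d & forall s, `|s - s0| < d -> l1norm (modl s x - modl s0 x) < e.
Proof.
move=> e0; have [mx xi] := L1P x.
pose g (p : R) (t : RM) : R := rnorm (modf (s0 + p) x t - modf s0 x t).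
have sm p : strongly_measurable (fun t => modf (s0 + p) x t - modf s0 x t).
  by apply: strongly_measurableB; exact: strongly_measurable_modf.
have := @dominated_param R g (fun t => 2 * rnorm (x t)).
move=> /(_ _ _ _ _ _ e e0)[].
- by move=> p; exact: measurable_rnorm.
- by apply: measurable_funM => //; exact: measurable_rnorm.
- move=> p t _; rewrite rnorm_ge0 /=; apply: le_trans (rnormD _ _) _.
  by rewrite rnormN !rnorm_cis; lra.
- under eq_integral do rewrite EFinM.
  rewrite ge0_integralZl_EFin//; last 2 first.
  + by move=> t _; rewrite lee_fin rnorm_ge0.
  + exact: measurable_rnormE.
  exact: lte_mul_pinfty.
- move=> t; apply/cvgr0Pnorm_lt => r r0.
  have gle p : g p t <= `|p| * (2 * `|t| * rnorm (x t)).
    rewrite /g /modf mulrDl cisD -scalerA.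
    have -> : cis (s0 * t) *: (cis (p * t) *: x t) - cis (s0 * t) *: x t =
        cis (s0 * t) *: (cis (p * t) *: x t - x t) by rewrite scalerBr.
    rewrite rnorm_cis; apply: le_trans (rnorm_cis_sub1 _ _) _.
    by rewrite normrM; rewrite le_eqVlt; apply/orP; left; apply/eqP; ring.
  have B0 : 0 < 2 * `|t| * rnorm (x t) + 1 by rewrite ltr_wpDl// mulr_ge0 ?rnorm_ge0.
  apply/nbhs_ballP; exists (r / (2 * `|t| * rnorm (x t) + 1)); first exact: divr_gt0.
  move=> p; rewrite /ball_ /= sub0r normrN ltr_pdivlMr// => hp.
  rewrite ger0_norm ?rnorm_ge0//; apply: le_lt_trans (gle p) (le_lt_trans _ hp).
  by rewrite ler_wpM2l// lerDl.
move=> d d0 hd; exists d => // s hs.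
have := hd _ hs; rewrite -lte_fin; congr (_ < _)%E.
rewrite /modl -clsB; [|exact: in_L1_modf (L1P _)..].
rewrite l1norm_cls; last by apply: in_L1B; exact: in_L1_modf (L1P _).
by apply: eq_integral => t _; rewrite /g [s0 + _]addrC subrK.
Qed.

End Modulation.

Section ModulusParam.
Variables (R : realType) (A : unitalBanachAlgType R[i]).
Local Notation RM := (measurableTypeR R).
Local Notation mu := (@lebesgue_measure R).

Definition small_modulus (u : RM -> R) := forall e, 0 < e ->
  exists2 d, 0 < d & forall z, `|z| < d -> (modulus u z < e%:E)%E.

Lemma modulus_lty (u : RM -> R) z : rintegrable u -> (modulus u z < +oo)%E.
Proof.
move=> iu; apply: le_lt_trans (modulus_le z (rintegrable_measurable iu)) _.
by apply: lte_mul_pinfty => //; exact: rintegrable_lty.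
Qed.

(** The modulus is bounded by twice the integral of [|u|] and tends to 0 at 0, so dominated
    convergence applies. The parameter p will be d for the flat kernels and [d^-1] for the Fejer
    kernels. *)
Lemma modulus_param (u : RM -> R) (f : R -> A) : rintegrable u -> small_modulus u -> in_L1 f ->
  forall e, 0 < e -> exists2 d, 0 < d & forall p, `|p| < d ->
    (\int[mu]_t (modulus u (p * t)%R * (rnorm (f t))%:E) < e%:E)%E.
Proof.
move=> iu hu [mf fi] e e0.
have mu_ := rintegrable_measurable iu.
have mfin z : modulus u z \is a fin_num by rewrite ge0_fin_numE ?modulus_ge0// modulus_lty.
have ul := rintegrable_lty iu.
have u0 : (0 <= \int[mu]_x `|u x|%:E)%E by exact: integral_ge0.
pose B := fine (2%:E * \int[mu]_x `|u x|%:E)%E.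
have hB z : fine (modulus u z) <= B.
  rewrite /B fine_le//; last exact: modulus_le.
  by rewrite fin_numM// ge0_fin_numE.
have hm0 z : 0 <= fine (modulus u z) by rewrite fine_ge0 ?modulus_ge0.
have B0 : 0 <= B by exact: le_trans (hm0 0) (hB 0).
have [] := @dominated_param R (fun p t => fine (modulus u (p * t)) * rnorm (f t))
    (fun t => B * rnorm (f t)) _ _ _ _ _ e e0.
- move=> p; apply: measurable_funM; last exact: measurable_rnorm.
  apply: (measurableT_comp (fine_measurable measurableT)).
  exact: measurableT_comp (measurable_modulus mu_) (measurable_scale p).
- by apply: measurable_funM => //; exact: measurable_rnorm.
- by move=> p t _; rewrite mulr_ge0 ?rnorm_ge0//= ler_wpM2r ?rnorm_ge0.
- under eq_integral do rewrite EFinM.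
  rewrite ge0_integralZl_EFin//; last 2 first.
  + by move=> t _; rewrite lee_fin rnorm_ge0.
  + exact: measurable_rnormE.
  exact: lte_mul_pinfty.
- move=> t.
  have c1 : (p * t) @[p --> (0 : R)] --> (0 * t : R).
    by apply: cvgM; [exact: cvg_id|exact: cvg_cst].
  rewrite mul0r in c1.
  have c2 := cvg_comp _ _ c1 (cvg_modulusP hu (fun z => modulus_lty z iu)).
  have := cvgM c2 (cvg_cst (rnorm (f t))) => /(_ _ _).
  rewrite mul0r; exact.
move=> d d0 hd; exists d => // p /hd; congr (_ < _)%E.
by apply: eq_integral => t _; rewrite EFinM fineK.
Qed.

Lemma small_modulus_fejerK (b : R) : 0 < b -> small_modulus (fejerK b).
Proof.
move=> b0 e e0; have C0 := fejer_mass_gt0 R.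
have mf : measurable_fun [set: RM] (fun x : R => b * fejer (b * x)).
  apply: measurable_funM => //; apply: (measurableT_comp (@measurable_fejer R)).
  exact: measurable_scale.
have h z : (modulus (fejerK b) z <= (fejer_mass R)^-1%:E * modulus (@fejer R) (b * z)%R)%E.
  have := modulus_lin (fejer_mass R)^-1 z mf (measurable_cst (0 : R)).
  rewrite (modulus_scale z b0 (@measurable_fejer R)) gtr0_norm ?invr_gt0//.
  have -> : modulus (cst 0) z = 0%E.
    by rewrite /modulus; under eq_integral do rewrite subrr normr0; exact: integral0.
  rewrite adde0; congr (_ <= _)%E; congr modulus; apply/funext => x.
  by rewrite /fejerK subr0 mulrCA mulrA.
have [d d0 hd] := modulus_fejer (mulr_gt0 C0 e0).
exists (d / b) => [|z hz]; first exact: divr_gt0.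
apply: le_lt_trans (h z) _.
have : (modulus (@fejer R) (b * z)%R < (fejer_mass R * e)%:E)%E.
  by apply: hd; rewrite normrM (gtr0_norm b0) mulrC -ltr_pdivlMr.
have ff : modulus (@fejer R) (b * z) \is a fin_num.
  by rewrite ge0_fin_numE ?modulus_ge0//; apply: modulus_lty; exact: fejer_rintegrable.
by rewrite -(fineK ff) -EFinM !lte_fin ltr_pdivrMl.
Qed.

Lemma small_modulus_flatK : small_modulus (@flatK R 1).
Proof.
move=> e e0; have p20 : (0 : R) < 2 * 1 by [].
have [d1 d10 h1] := small_modulus_fejerK p20 (divr_gt0 e0 (ltr0n _ 4)).
have [d2 d20 h2] := small_modulus_fejerK (@ltr01 R) (divr_gt0 e0 (ltr0n _ 4)).
exists (Num.min d1 d2); first by rewrite lt_min d10.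
move=> z; rewrite lt_min => /andP[/h1 z1 /h2 z2].
have h : (modulus (@flatK R 1) z <=
    2%:E * modulus (fejerK (2 * 1)) z + modulus (fejerK 1) z)%E.
  have := modulus_lin 2 z (@measurable_fejerK R (2 * 1)) (@measurable_fejerK R 1).
  by rewrite ger0_norm.
apply: (le_lt_trans h) => {h}.
have f1 : modulus (fejerK (2 * 1)) z \is a fin_num.
  by rewrite ge0_fin_numE ?modulus_ge0//; apply: modulus_lty; exact: rintegrable_fejerK.
have f2 : modulus (fejerK 1) z \is a fin_num.
  by rewrite ge0_fin_numE ?modulus_ge0//; apply: modulus_lty; exact: rintegrable_fejerK.
have h : (2%:E * modulus (fejerK (2 * 1)) z + modulus (fejerK 1) z <
    2%:E * (e / 4)%:E + (e / 4)%:E)%E.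
  by apply: lteD => //; rewrite lte_pmul2l.
apply: (lt_le_trans h); rewrite -EFinM -EFinD lee_fin; lra.
Qed.

Lemma modulus_flatK (d z : R) : 0 < d -> modulus (flatK d) z = modulus (@flatK R 1) (d * z).
Proof.
move=> d0; rewrite -modulus_scale//; last first.
  by case: (kernel_flatK (@ltr01 R)) => /rintegrable_measurable.
by congr modulus; apply/funext => x; exact: flatK_scale.
Qed.

Lemma rint_flatK (d : R) : 0 < d -> rint (fun x => `|flatK d x|) = rint (fun x => `|@flatK R 1 x|).
Proof.
move=> d0; have [i1 _] := kernel_flatK (@ltr01 R); have m1 := rintegrable_measurable i1.
have ia : rintegrable (fun x => `|@flatK R 1 x|).
  apply: rintegrableP; first exact: measurableT_comp.
  by under eq_integral do rewrite normr_id; exact: rintegrable_lty.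
have [h1 h2] := rint_scale d0 ia (fun x => normr_ge0 _).
transitivity (rint (fun x => d * `|@flatK R 1 (d * x)|)).
  by congr rint; apply/funext => x; rewrite flatK_scale normrM gtr0_norm.
by rewrite rintZ// h2 mulrA mulfV ?gt_eqF// mul1r.
Qed.

End ModulusParam.

(** * Localization in frequency *)

Section Wiener.
Variables (R : realType) (A : unitalBanachAlgType R[i]).
Local Notation RM := (measurableTypeR R).
Local Notation mu := (@lebesgue_measure R).
Local Notation L := (L1 A).
Local Notation "x ** y" := (l1mul x y) (at level 40, left associativity).
Implicit Types (f x y : L) (a b c : A) (d : R).

Definition fejerL d a : L := cls (lift (fejerK d) a).
Definition flatL d a : L := cls (lift (flatK d) a).

Lemma fejerL_central d y : 0 < d -> fejerL d bone ** y = y ** fejerL d bone.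
Proof. by move=> d0; apply: l1mul_lift_central; exact: rintegrable_fejerK. Qed.

Lemma fejerK_bounded d : 0 < d -> exists C, forall t : R, `|fejerK d t| <= C.
Proof.
move=> d0; have [_ h0 [C hC] _] := bounded_fejerK d0; exists C => t.
by rewrite ger0_norm.
Qed.

Lemma fejerL_kernel d (k : RM -> R) a b : 0 < d -> kernel k ->
  (forall xi, 0 <= xi <= d -> ft k xi = 1) ->
  fejerL d a ** cls (lift k b) = fejerL d (bmul a b).
Proof.
move=> d0 hk k1; have [C hC] := fejerK_bounded d0.
apply: (l1mul_reproducing _ _ (rintegrable_fejerK d0) hC); first by case: hk.
by move=> x; exact: fejerK_reproducing.
Qed.

Lemma fejerL_flatL d a b : 0 < d -> fejerL d a ** flatL d b = fejerL d (bmul a b).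
Proof.
move=> d0; apply: fejerL_kernel => //; first exact: kernel_flatK.
by move=> xi; exact: ft_flatK.
Qed.

Lemma l1norm_fejerL d a : 0 < d -> l1norm (fejerL d a) = rnorm a.
Proof.
move=> d0; rewrite l1norm_lift; last exact: rintegrable_fejerK.
have -> : (fun x : R => `|fejerK d x|) = fejerK d.
  by apply/funext => x; rewrite ger0_norm// fejerK_ge0// ltW.
by rewrite rint_fejerK// mulr1.
Qed.

Lemma is_bochner_fejerK d : 0 < d -> is_bochner_integral (lift (fejerK d) (bone : A)) bone.
Proof.
move=> d0; have := is_bochner_real (bone : A) (rintegrable_fejerK d0).
by rewrite -/(rint _) rint_fejerK// scale1r.
Qed.

(** Centrality puts the indicator on the left, where its modulus of continuity controls the error;
    rescaling the kernel to [fejerK 1] then moves d into the modulus as [d^-1]. *)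
Lemma fejerL_approx_indic (E : set RM) a (e : R) : measurable E -> (mu E < +oo)%E -> 0 < e ->
  exists2 d0, 0 < d0 & forall d, d0 <= d ->
    l1norm (cls (lift \1_E a) - fejerL d bone ** cls (lift \1_E a)) < e.
Proof.
move=> mE El e0.
have iE : rintegrable (\1_E : RM -> R) by apply: bounded_rintegrable; exact: bounded_L1_indic.
have sE : small_modulus (\1_E : RM -> R) by move=> r r0; exact: modulus_indic.
have LF := in_L1_klift (bone : A) (rintegrable_fejerK (@ltr01 R)).
have a1 : 0 < rnorm a + 1 by rewrite ltr_wpDl ?rnorm_ge0.
have [r r0 hr] := modulus_param iE sE LF (divr_gt0 e0 a1).
(* From [2 / r <= d] follows [d^-1 <= r / 2], strictly below r. *)
exists (2 / r) => [|d hd]; first exact: divr_gt0.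
have d0 : 0 < d by apply: lt_le_trans hd; exact: divr_gt0.
rewrite fejerL_central// -l1normN opprB -lte_fin.
have := lift_modulus a iE (is_bochner_fejerK d0) (in_L1_klift (bone : A) (rintegrable_fejerK d0)).
rewrite bmul1r => h; apply: le_lt_trans h _.
have -> : (\int[mu]_t (modulus \1_E t * (rnorm (lift (fejerK d) (bone : A) t))%:E) =
    \int[mu]_t (modulus \1_E (d^-1 * t)%R * (rnorm (lift (fejerK 1) (bone : A) t))%:E))%E.
  have mI : measurable_fun [set: RM]
      (fun t => modulus \1_E (d^-1 * t)%R * (rnorm (lift (fejerK 1) (bone : A) t))%:E)%E.
    apply: emeasurable_funM; last exact: measurable_rnormE LF.1.
    apply: (measurableT_comp (measurable_modulus (rintegrable_measurable iE))).
    exact: measurable_scale.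
  have nI (t : RM) : (0 <= modulus \1_E (d^-1 * t)%R * (rnorm (lift (fejerK 1) (bone : A) t))%:E)%E.
    by rewrite mule_ge0 ?modulus_ge0// lee_fin rnorm_ge0.
  have E1 := ge0_integral_scale d0 mI nI.
  apply/esym; have := congr1 (fun r : \bar R => d%:E * r)%E E1.
  rewrite muleA -EFinM mulfV ?gt_eqF// mul1e => <-.
  rewrite -ge0_integralZl_EFin ?(ltW d0)//; last first.
  - by apply: (measurableT_comp mI); exact: measurable_scale.
  apply: eq_integral => t _; rewrite mulrA mulVf ?gt_eqF// mul1r muleCA -EFinM.
  congr (_ * _%:E)%E; rewrite /lift !rnormZR !ger0_norm ?fejerK_ge0 ?(ltW d0)//.
  rewrite /fejerK !mul1r; ring.
have hr1 : `|d^-1| < r.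
  rewrite gtr0_norm ?invr_gt0// -[r]invrK ltf_pV2 ?posrE ?invr_gt0//.
  apply: lt_le_trans hd; rewrite mulrC ltr_pMr ?invr_gt0//; lra.
have := hr _ hr1; move: (integral _ _ _) (rnorm_ge0 a) => I a0 hI.
apply: (@le_lt_trans _ _ ((rnorm a)%:E * (e / (rnorm a + 1))%:E)%E).
  by rewrite lee_wpmul2l// ltW.
rewrite -EFinM lte_fin mulrA ltr_pdivrMr//; nra.
Qed.

Lemma l1norm0 : l1norm (0 : L) = 0.
Proof.
apply: EFin_inj; rewrite -cls0 l1norm_cls; last exact: in_L10.
by rewrite /inorm; under eq_integral do rewrite rnorm0; exact: integral0.
Qed.

Lemma fejerL_approx x (e : R) : 0 < e ->
  exists2 d0, 0 < d0 & forall d, d0 <= d -> l1norm (x - fejerL d bone ** x) < e.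
Proof.
have M0 := rnorm_ge0 (bone : A); set M := rnorm bone in M0.
move: e; move: x; apply: L1_ind.
- by move=> E a mE El e e0; exact: fejerL_approx_indic.
- move=> e e0; exists 1 => // d _; rewrite l1mul0r subr0.
  by rewrite l1norm0.
- move=> x y hx hy e e0; have e2 : 0 < e / 2 by rewrite divr_gt0.
  have [d1 d10 h1] := hx _ e2; have [d2 d20 h2] := hy _ e2.
  exists (Num.max d1 d2); first by rewrite lt_max d10.
  move=> d; rewrite ge_max => /andP[/h1 {}h1 /h2 {}h2].
  rewrite l1mulDr opprD addrACA; apply: le_lt_trans (l1normD _ _) _.
  by rewrite (splitr e) ltrD.
move=> x hx e e0; have e2 : 0 < e / 2 by rewrite divr_gt0.
(* Multiplication by [fejerL d bone] has norm at most M, the norm of the unit, which may differ from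
   1; the part [x - y] thus costs at most [1 + M] times its norm. *)
have e3 : 0 < e / 2 / (M + 1) by rewrite divr_gt0// ltr_wpDl.
have [y hy hxy] := hx _ e3; have [d0 d00 hd] := hy _ e2.
exists d0 => // d d0d; have dp : 0 < d by exact: lt_le_trans d0d.
have -> : x - fejerL d bone ** x =
    ((x - y) - fejerL d bone ** (x - y)) + (y - fejerL d bone ** y).
  by rewrite l1mulBr opprB -addrA (addrC (_ - _) (y - _)) !subrKA.
apply: le_lt_trans (l1normD _ _) _.
rewrite (splitr e) ler_ltD//; last exact: hd.
apply: le_trans (l1normB _ _) _.
apply: (@le_trans _ _ (l1norm (x - y) + M * l1norm (x - y))).
  by rewrite lerD2l; apply: le_trans (l1normM _ _) _; rewrite l1norm_fejerL.
rewrite -[X in X + _]mul1r -mulrDl [1 + M]addrC -ler_pdivlMl ?ltr_wpDl//.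
by rewrite mulrC ltW.
Qed.

(** The y of this form constitute the left ideal [L1 (1 + f)] of L^1. Solvability for [y = - f]
    provides a left inverse of 1 + f. *)
Definition solvable f y : Prop := exists x, x + x ** f = y.

Lemma solvableD f y z : solvable f y -> solvable f z -> solvable f (y + z).
Proof.
by move=> [x <-] [x' <-]; exists (x + x'); rewrite l1mulDl addrACA.
Qed.

Lemma neumann1 (H y : L) : l1norm H < 1 -> exists u, u + u ** H = y.
Proof.
move=> H1; have [||x [_ hx]] := @l1_neumann R A (fun=> 1) H y (@weight1 R).
- by rewrite -l1normE lte_fin.
- exact: nrm1_lty.
by exists x.
Qed.

Lemma flatL_modulus b f v (e : R) : 0 < e -> is_bochner_integral f v ->
  exists2 d0, 0 < d0 & forall d, 0 < d < d0 ->
    l1norm (flatL d b ** f - flatL d (bmul b v)) < e.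
Proof.
move=> e0 hv; have b1 : 0 < rnorm b + 1 by rewrite ltr_wpDl ?rnorm_ge0.
have i1 := (kernel_flatK (@ltr01 R)).1.
have [d0 d00 hd] := modulus_param i1 (@small_modulus_flatK R) (L1P f) (divr_gt0 e0 b1).
exists d0 => // r /andP[r0 rd].
have := lift_modulus b (kernel_flatK r0).1 hv (L1P f).
rewrite clsK -lte_fin => h; apply: le_lt_trans h _.
under eq_integral do rewrite modulus_flatK//.
have := hd r; rewrite gtr0_norm// => /(_ rd).
move: (integral _ _ _) (rnorm_ge0 b) => I a0 hI.
apply: (@le_lt_trans _ _ ((rnorm b)%:E * (e / (rnorm b + 1))%:E)%E).
  by rewrite lee_wpmul2l// ltW.
rewrite -EFinM lte_fin mulrA ltr_pdivrMr//; nra.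
Qed.

(** The conclusion covers all f' near f because moving to a nearby frequency amounts to replacing f
    by a nearby modulation of it; b is kept fixed. *)
Lemma local_solvable f b v : is_bochner_integral f v -> bmul b (bone + v) = bone ->
  exists2 r, 0 < r & forall f' d, l1norm (f' - f) < r -> 0 < d < r ->
    forall y, solvable f' (fejerL d bone ** y).
Proof.
move=> hv hb.
pose M := rnorm b * rint (fun x : R => `|@flatK R 1 x|).
have M0 : 0 <= M.
  rewrite mulr_ge0 ?rnorm_ge0// /rint fine_ge0//; exact: integral_ge0.
have [d0 d00 hd] := flatL_modulus b (divr_gt0 (@ltr01 R) (ltr0n _ 2)) hv.
(* M is the norm of [flatL d b], the same for every d by scaling; this radius keeps
   [M * l1norm (f' - f)] below 1/2. *)
have r0 : 0 < (2 * (M + 1))^-1 by rewrite invr_gt0 mulr_gt0// ltr_wpDl.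
exists (Num.min d0 (2 * (M + 1))^-1); first by rewrite lt_min d00.
move=> f' d; rewrite !lt_min => /andP[_ hf'] /andP[dp /andP[dd0 _]] y.
(* H is [V_d b (1 + f') - V_d]. Since [b (e + v) = e], it is the sum of [V_d b * f - V_d b v] and
   [V_d b * (f' - f)], each of norm below 1/2. *)
pose H := flatL d b + flatL d b ** f' - flatL d bone.
have id := (kernel_flatK dp).1.
have HE : H = (flatL d b ** f - flatL d (bmul b v)) + flatL d b ** (f' - f).
  rewrite /H -hb bmulDr bmul1r /flatL (cls_liftDr _ _ id) l1mulBr.
  rewrite opprD addrA [X in X - _](addrAC) subrr add0r.
  by rewrite [RHS]addrC subrKA.
have H1 : l1norm H < 1.
  rewrite HE; apply: le_lt_trans (l1normD _ _) _.
  rewrite (splitr 1) ltrD//; first by apply: hd; rewrite dp.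
  apply: le_lt_trans (l1normM _ _) _.
  rewrite l1norm_lift// rint_flatK// -/M.
  move: hf' (l1norm_ge0 (f' - f)); move: (l1norm _) => n hn n0.
  have h2 : n * (2 * (M + 1)) < 1 by rewrite -ltr_pdivlMr// ?mul1r// mulr_gt0// ltr_wpDl.
  nra.
have [u hu] := neumann1 y H1.
(* As [F_d V_d = F_d], one has [F_d b (1 + f') = F_d (1 + H)]. Hence
   [u F_d b (1 + f') = F_d u (1 + H) = F_d y], because F_d is central. *)
exists (u ** fejerL d b).
have pq : fejerL d b + fejerL d b ** f' = fejerL d bone + fejerL d bone ** H.
  rewrite /H l1mulBr l1mulDr l1mulA !fejerL_flatL// !bmul1l.
  by rewrite addrCA addrN addr0.
rewrite -l1mulA -l1mulDr pq l1mulDr l1mulA -(fejerL_central u dp) -l1mulA -l1mulDr.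
by rewrite hu.
Qed.

Lemma is_bochner_modf f s : is_bochner_integral (modl s f) (fourier f s).
Proof.
have Lm := in_L1_modf s (L1P f).
apply: (@ae_is_bochner _ _ (modf s f)); last exact: clsE.
  by apply: is_bochner_bochner; case: Lm.
by case: (L1P (modl s f)).
Qed.

(** Modulation moves the frequency s to 0, where the local result applies, and the solution is
    modulated back. Near each frequency one bound on d serves, and compactness of the segment makes
    it uniform. *)
Lemma segment_solvable f (a : R) :
  (forall t, exists b, bmul b (bone + fourier f t) = bone) ->
  exists2 r, 0 < r & forall d s, 0 < d < r -> - a <= s <= a ->
    forall y, solvable f (modl (- s) (fejerL d bone) ** y).
Proof.
move=> hinv.
have := (compact_near_coveringP _).1 (@segment_compact R (- a) a) R (at_right (0 : R))
  (fun d s => forall y, solvable f (modl (- s) (fejerL d bone) ** y)) _.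
move=> /(_ _)[|r r0 hr].
  move=> s0 _; have [b hb] := hinv s0.
  have [r r0 hr] := local_solvable (is_bochner_modf f s0) hb.
  have [e e0 he] := modl_continuous f s0 r0.
  exists (ball s0 e, [set d | 0 < d < r]).
    split => /=; first exact: nbhsx_ballx.
    exists r => // d; rewrite /= sub0r normrN => dr dp.
    by rewrite dp -(gtr0_norm dp).
  move=> [s d] /= [hs hd] y.
  have hsr : l1norm (modl s f - modl s0 f) < r by apply: he; rewrite distrC.
  have [x hx] := hr _ d hsr hd (modl s y).
  exists (modl (- s) x).
  have -> : f = modl (- s) (modl s f) by rewrite -{2}(opprK s) modlK.
  rewrite -modlM -modlD hx modlM; congr (_ ** _).
  by rewrite -{2}(opprK s) modlK.
exists r => // d s /andP[d0 dr] hs y; apply: (hr d) => //=.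
by rewrite sub0r normrN gtr0_norm.
Qed.

Definition sumL d (m : nat) : L := \sum_(j < m.*2.+1) modl (- node d j) (fejerL d bone).

(** The modulated kernels are complex, but their sum is a real even kernel times the unit; it is
    therefore central and subject to the reproducing identity. *)
Lemma sumLE d m : 0 < d -> sumL d m = cls (lift (sumK d m) bone).
Proof.
move=> d0; have iF := rintegrable_fejerK d0.
have LF (j : 'I_m.*2.+1) : in_L1 (modf (- node d j) (lift (fejerK d) (bone : A))).
  by apply: in_L1_modf; exact: in_L1_klift.
rewrite /sumL; have [_] := cls_sum (index_enum 'I_m.*2.+1) LF.
have -> : \sum_(j < m.*2.+1) modl (- node d j) (fejerL d bone) =
    \sum_(j < m.*2.+1) cls (modf (- node d j) (lift (fejerK d) (bone : A))).
  by apply: eq_bigr => j _; rewrite modl_cls//; exact: in_L1_klift.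
move=> <-; congr cls; apply/funext => t.
rewrite /modf /lift.
have -> : (sumK d m t)%:C = \sum_(j < m.*2.+1) (cis (- node d j * t) * (fejerK d t)%:C).
  rewrite -mulr_suml.
  have -> : \sum_(j < m.*2.+1) cis (- node d j * t) =
      (\sum_(j < m.*2.+1) cos (node d j * t))%:C - 'i * (\sum_(j < m.*2.+1) sin (node d j * t))%:C.
    rewrite !rmorph_sum /= mulr_sumr -sumrB; apply: eq_bigr => j _.
    by rewrite cisE mulNr cosN sinN rmorphN mulrN.
  rewrite sin_node_sum mulr0 subr0 -rmorphM /sumK mulr_suml; congr _%:C.
  by apply: eq_bigr => j _; rewrite mulrC.
by rewrite scaler_suml; apply: eq_bigr => j _; rewrite scalerA.
Qed.

Lemma wiener_L1 f : (forall t, exists b, bmul b (bone + fourier f t) = bone) ->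
  forall y, solvable f y.
Proof.
move=> hinv y.
have [a a0 ha] := fejerL_approx f (@ltr01 R).
have {}ha := ha a (lexx a).
have [r r0 hr] := segment_solvable a hinv.
have [m hm] : exists m : nat, a / r < m%:R.
  by exists (Num.bound (a / r)); rewrite archi_boundP// divr_ge0 ?ltW.
have m0 : 0 < m%:R :> R by apply: le_lt_trans hm; rewrite divr_ge0 ?ltW.
(* The spacing is below the uniform radius r and divides a, so that the nodes reach exactly from
   [- a] to a. *)
pose d := a / m%:R; have d0 : 0 < d by rewrite divr_gt0.
have dr : d < r by rewrite ltr_pdivrMr// mulrC -ltr_pdivrMr.
have md : m%:R * d = a by rewrite mulrC mulfVK// gt_eqF.
pose K := sumL d m.
have KE : K = cls (lift (sumK d m) bone) by exact: sumLE.
have iK := kernel_sumK m d0.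
have Kc z : K ** z = z ** K by rewrite KE l1mul_lift_central//; case: iK.
pose G := fejerL a bone.
have GK : G ** K = G.
  rewrite KE /G fejerL_kernel// ?bmul1l// => xi hxi.
  by apply: ft_sumK => //; rewrite md.
have KS z : solvable f (K ** z).
  rewrite /K /sumL l1mul_suml; elim/big_ind: _ => [|u v|j _].
  - by exists 0; rewrite l1mul0l addr0.
  - exact: solvableD.
  apply: hr; first by rewrite d0.
  have jm : (j : nat)%:R <= m%:R + m%:R :> R.
    by rewrite -natrD ler_nat addnn -ltnS; exact: ltn_ord.
  have j0 : 0 <= (j : nat)%:R :> R by [].
  have h1 : 0 <= (j : nat)%:R * d by rewrite mulr_ge0// ltW.
  have h2 : (j : nat)%:R * d <= a + a by rewrite -md -mulrDl ler_wpM2r// ltW.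
  by rewrite /node mulrBl md; apply/andP; split; lra.
have [u hu] := neumann1 y ha.
rewrite -[y](subrK (K ** y)); apply: solvableD => //.
(* [K y] is solvable by localization, and this solves for [y - K y]: by choice of u,
   [u (1 + f) = y + G (u f)], and [1 - K] annihilates the error because [K G = G]. *)
exists (u - K ** u); rewrite l1mulBl.
have E : u + u ** f = y + G ** (u ** f).
  rewrite -hu l1mulBr -/G -addrA; congr (_ + _).
  by rewrite [u ** (G ** f)]l1mulA -(fejerL_central u a0) -l1mulA subrK.
have E2 : K ** u + K ** u ** f = K ** y + G ** (u ** f).
  by rewrite -l1mulA -l1mulDr E l1mulDr [K ** (G ** _)]l1mulA (Kc G) GK.
by rewrite addrACA -opprD E E2 opprD addrACA subrr addr0.
Qed.

End Wiener.

(** * Weights *)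

Section LocalBound.
Variable R : realType.
Local Notation RM := (measurableTypeR R).
Local Notation mu := (@lebesgue_measure R).
Implicit Types w : R -> R.

Definition bounded_weight w : Prop := exists C, forall x, w x <= C.

(* For |x| <= l, the sublevel set E of [-2l, 2l] and x - E lie in [-3l, 3l];
   they meet as soon as E has measure greater than 3l. *)
Lemma weight_local_bound w (l : R) : weight w -> 0 < l ->
  exists2 M, 1 <= M & forall x, `|x| <= l -> w x <= M.
Proof.
move=> [mw w1 wM] l0.
pose I : set RM := `[- (2 * l), 2 * l]%classic.
pose E (n : nat) : set RM := I `&` [set x | w x <= n%:R].
have mI : measurable I by exact: measurable_itv.
have mE n : measurable (E n).
  apply: measurableI => //.
  have -> : [set x | w x <= n%:R] = w @^-1` `]-oo, n%:R]%classic.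
    by apply/seteqP; split => x /=; rewrite in_itv.
  by rewrite -[X in measurable X]setTI; apply: mw => //; exact: measurable_itv.
have EU : \bigcup_n E n = I.
  apply/seteqP; split => [x [n _ []//]|x Ix].
  exists (Num.bound (w x)) => //; split => //=.
  by rewrite ltW// archi_boundP// (le_trans ler01).
have nE : nondecreasing_seq E.
  by move=> n m nm; apply/subsetPset => x [Ix /= h]; split => //=; rewrite (le_trans h)// ler_nat.
have muI : mu I = (4 * l)%:E.
  rewrite /I lebesgue_measure_itv /= lte_fin -EFinB ifT; last by lra.
  by congr EFin; ring.
have cE : mu (E n) @[n --> \oo] --> (4 * l)%:E.
  by rewrite -muI -EU; apply: nondecreasing_cvg_mu => //; rewrite EU.
have [n hn] : exists n, ((3 * l)%:E < mu (E n))%E.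
  have : (nbhs (4 * l)%:E) [set y | ((3 * l)%:E < y)%E].
    apply: open_nbhs_nbhs; split; first exact: open_ereal_gt_ereal.
    by rewrite /= lte_fin; lra.
  by move=> /cE [n _ /(_ n (leqnn n))] /= h; exists n.
exists (1 + n%:R ^+ 2); first by rewrite lerDl sqr_ge0.
move=> x; rewrite ler_norml => /andP[x1 x2].
apply: (@le_trans _ _ (n%:R ^+ 2)); last by rewrite lerDr.
pose F : set RM := (fun t => x - t) @^-1` E n.
have mF : measurable F.
  by rewrite -[F]setTI; exact: (measurable_reflect x measurableT (mE n)).
have muF : mu F = mu (E n) by exact: lebesgue_measure_reflect.
have : E n `&` F !=set0.
  apply/set0P; apply/negP => /eqP dis.
  have h1 : mu (E n `|` F) = (mu (E n) + mu F)%E by apply: measureU.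
  pose J : set RM := `[- (3 * l), 3 * l]%classic.
  have h2 : (mu (E n `|` F) <= mu J)%E.
    apply: le_measure; rewrite ?inE//; [exact: measurableU|exact: measurable_itv|].
    move=> t [[]|[]]; rewrite /I /J /= !in_itv /= => /andP[t1 t2] _; apply/andP; split; lra.
  have h3 : mu J = (6 * l)%:E.
    rewrite /J lebesgue_measure_itv /= lte_fin -EFinB ifT; last by lra.
    by congr EFin; ring.
  have : ((3 * l)%:E + (3 * l)%:E < mu (E n) + mu F)%E by rewrite muF lteD.
  rewrite -h1 => /lt_le_trans/(_ h2); rewrite h3 -EFinD lte_fin; lra.
move=> [t [[_ /= ht] [_ /= hxt]]].
have := wM (x - t) t; rewrite subrK => /le_trans; apply.
by rewrite expr2 ler_pM// ?(le_trans ler01).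
Qed.

End LocalBound.

Section Regularization.
Variables (R : realType) (w : R -> R).
Hypothesis hw : weight w.

(* A weight may exceed 1 at 0; this value is lowered so that [nu e 0 = 1]. *)
Definition wt (x : R) : R := if x == 0 then 1 else w x.

Lemma wt_ge1 x : 1 <= wt x.
Proof. by rewrite /wt; case: ifP => // _; case: hw. Qed.

Lemma wt_le x : wt x <= w x.
Proof. by rewrite /wt; case: ifP => // _; case: hw. Qed.

Lemma wtM x y : wt (x + y) <= wt x * wt y.
Proof.
have h x' y' : 1 <= wt x' * wt y' by rewrite -[1]mulr1 ler_pM ?wt_ge1.
rewrite {1}/wt; case: eqVneq => [_//|xy].
have [x0|x0] := eqVneq x 0; first by rewrite /wt x0 eqxx add0r mul1r; case: ifP => // /eqP y0; rewrite x0 y0 addr0 eqxx in xy.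
have [y0|y0] := eqVneq y 0; first by rewrite /wt y0 eqxx addr0 mulr1 (negPf x0).
by rewrite /wt (negPf x0) (negPf y0); case: hw.
Qed.

Definition nu (e x : R) : R := inf [set wt (x - y) * expR (e * `|y|) | y in setT].

Lemma nu_term_ge1 e x y : 0 <= e -> 1 <= wt (x - y) * expR (e * `|y|).
Proof.
move=> e0; rewrite -[1]mulr1 ler_pM ?wt_ge1//.
by rewrite -expR0 ler_expR mulr_ge0.
Qed.

Lemma nu_le e x y : 0 <= e -> nu e x <= wt (x - y) * expR (e * `|y|).
Proof.
move=> e0; apply: ge_inf; last by exists y.
by exists 1 => _ [z _ <-]; exact: nu_term_ge1.
Qed.

Lemma le_nu e x c : (forall y, c <= wt (x - y) * expR (e * `|y|)) -> c <= nu e x.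
Proof.
move=> h; apply: lb_le_inf; first by exists (wt (x - 0) * expR (e * `|0 : R|)); exists 0.
by move=> _ [z _ <-].
Qed.

Lemma nu_ge1 e x : 0 <= e -> 1 <= nu e x.
Proof. by move=> e0; apply: le_nu => y; exact: nu_term_ge1. Qed.

Lemma nu_gt0 e x : 0 <= e -> 0 < nu e x.
Proof. by move=> e0; exact: lt_le_trans (nu_ge1 x e0). Qed.

Lemma nu_le_w e x : 0 <= e -> nu e x <= w x.
Proof.
move=> e0; apply: le_trans (nu_le x 0 e0) _.
by rewrite subr0 normr0 mulr0 expR0 mulr1 wt_le.
Qed.

Lemma nu_le_exp e x : 0 <= e -> nu e x <= expR (e * `|x|).
Proof. by move=> e0; apply: le_trans (nu_le x x e0) _; rewrite subrr /wt eqxx mul1r. Qed.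

(** Decompositions of x and of y add up to one of [x + y]. Dividing by the other factor lets the two
    infima be taken one after the other. *)
Lemma nuM e x y : 0 <= e -> nu e (x + y) <= nu e x * nu e y.
Proof.
move=> e0.
have T0 z y' : 0 < wt (z - y') * expR (e * `|y'|) by exact: lt_le_trans (nu_term_ge1 _ _ e0).
rewrite mulrC -ler_pdivrMr ?nu_gt0//; apply: le_nu => y'.
rewrite ler_pdivrMr ?nu_gt0// mulrC -ler_pdivrMr//; apply: le_nu => x'.
rewrite ler_pdivrMr//; apply: le_trans (nu_le (x + y) (x' + y') e0) _.
have -> : x + y - (x' + y') = (x - x') + (y - y') by ring.
rewrite mulrACA ler_pM ?wtM ?expR_ge0//; first by rewrite (le_trans ler01)// wt_ge1.
by rewrite -expRD ler_expR -mulrDr ler_wpM2l// ler_normD.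
Qed.

Lemma nu_shift e x z : 0 <= e -> nu e (x + z) <= nu e x * expR (e * `|z|).
Proof. by move=> e0; apply: le_trans (nuM _ _ e0) _; rewrite ler_wpM2l ?nu_le_exp// ltW ?nu_gt0. Qed.

(** An infimum over uncountably many y need not be measurable; continuity supplies measurability. A
    translation by z changes nu by a factor between [expR (- e * |z|)] and [expR (e * |z|)]. *)
Lemma continuous_nu e : 0 <= e -> continuous (nu e).
Proof.
move=> e0 x.
have ce (c : R) : nu e x * expR (c * `|y - x|) @[y --> x] --> nu e x.
  rewrite -[X in _ --> X]mulr1; apply: cvgM; first exact: cvg_cst.
  have -> : (1 : R) = expR (c * `|x - x|) by rewrite subrr normr0 mulr0 expR0.
  apply: (@continuous_comp _ _ _ (fun y : R => c * `|y - x|) expR); last exact: continuous_expR.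
  apply: cvgM; first exact: cvg_cst.
  by apply: cvg_norm; apply: cvgB; [exact: cvg_id|exact: cvg_cst].
apply: (squeeze_cvgr _ (ce (- e)) (ce e)); apply: nearW => y; apply/andP; split.
  rewrite (mulNr e _) expRN ler_pdivrMr ?expR_gt0//.
  by have := nu_shift y (x - y) e0; rewrite addrC subrK distrC.
by have := nu_shift x (y - x) e0; rewrite addrC subrK.
Qed.

Lemma weight_nu e : 0 <= e -> weight (nu e).
Proof.
move=> e0; split.
- by apply: continuous_measurable_fun; exact: continuous_nu.
- by move=> x; exact: nu_ge1.
- by move=> x y; exact: nuM.
Qed.

(** Since nu is at most 1 at 0, a constant nu stays below 2. Every x is then within [ln 2 / e] of a
    point where [wt] is below 2, and local boundedness of w turns this into a global bound. *)
Lemma nu_nonconstant e : 0 < e -> ~ bounded_weight w -> ~ constant_fun (nu e).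
Proof.
move=> e0 wb [c hc]; apply: wb; have e0' := ltW e0.
have nu1 x : nu e x < 2.
  rewrite hc -(hc 0); apply: le_lt_trans (nu_le_exp 0 e0') _.
  by rewrite normr0 mulr0 expR0 ltr1n.
have l0 : 0 < ln 2 / e :> R by rewrite divr_gt0// ln_gt0// ltr1n.
have [M M1 hM] := weight_local_bound hw l0.
exists (2 * M) => x.
have [y hy] : exists y, wt (x - y) * expR (e * `|y|) < 2.
  apply: contrapT => H; have := nu1 x; rewrite ltNge => /negP; apply.
  apply: le_nu => y; rewrite leNgt; apply/negP => h; apply: H; by exists y.
have yl : `|y| <= ln 2 / e.
  rewrite ler_pdivlMr// mulrC -ler_expR lnK ?posrE// ltW//; apply: le_lt_trans hy.
  by rewrite ler_peMl ?expR_ge0// wt_ge1.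
have w2 : wt (x - y) < 2.
  apply: le_lt_trans hy; rewrite ler_peMr ?(le_trans ler01 (wt_ge1 _))//.
  by rewrite -expR0 ler_expR mulr_ge0.
have [_ w1 wM] := hw.
have [xy|xy] := eqVneq (x - y) 0.
  have := hM _ yl; rewrite -(subr0_eq xy); have := w1 x; lra.
move: w2; rewrite /wt (negPf xy) => w2; have := wM (x - y) y; rewrite subrK => /le_trans; apply.
by rewrite ler_pM ?(le_trans ler01)// ?hM// ltW.
Qed.

(** The growth bound is applied to the factor [w y] in [w x <= w (x - y) * w y]. The case [x = y] is
    separate, because [wt] is 1 there instead of [w 0]. *)
Lemma le_nu_exp e C : 0 < e -> (forall x, w x <= C * expR (e * `|x|)) ->
  forall x, w x <= C * nu e x.
Proof.
move=> e0 hC x; have [_ w1 wM] := hw.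
have C0 : 0 < C by have := hC 0; rewrite normr0 mulr0 expR0 mulr1; have := w1 0; lra.
rewrite mulrC -ler_pdivrMr//; apply: le_nu => y; rewrite ler_pdivrMr//.
rewrite /wt; case: eqVneq => [/subr0_eq ->|_].
  by rewrite mul1r mulrC.
have := wM (x - y) y; rewrite subrK => /le_trans; apply.
by rewrite -mulrA ler_pM2l ?(lt_le_trans ltr01)// mulrC.
Qed.

End Regularization.

(** * Subexponential growth of admissible weights *)

Section Admissible.
Variable R : realType.
Implicit Types w : R -> R.

Lemma weight_pow w (x : R) n : weight w -> w (n.+1%:R * x) <= w x ^+ n.+1.
Proof.
move=> hw; have [_ w1 wM] := hw; elim: n => [|n IH]; first by rewrite mul1r expr1.
rewrite -natr1 mulrDl mul1r exprSr; apply: le_trans (wM _ _) _.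
by rewrite ler_wpM2r// (le_trans ler01).
Qed.

(* Fekete: one value x0 with w x0 <= exp (e x0) controls the growth on [0, +oo[. *)
Lemma half_line_growth w (e x0 : R) : weight w -> 0 < x0 -> w x0 <= expR (e * x0) -> 0 < e ->
  exists2 C, 1 <= C & forall x, 0 <= x -> w x <= C * expR (e * x).
Proof.
move=> hw x00 hx0 e0; have [_ w1 wM] := hw.
have [M M1 hM] := weight_local_bound hw x00.
exists M => // x xp.
pose n := Num.truncn (x / x0).
have xx0 : 0 <= x / x0 by rewrite divr_ge0// ltW.
have /andP[n1 n2] := truncn_itv xx0.
have r0 : 0 <= x - n%:R * x0 by rewrite subr_ge0 -ler_pdivlMr.
have r1 : x - n%:R * x0 <= x0.
  by rewrite lerBlDr -[X in X + _]mul1r -mulrDl addrC natr1 ltW// -ltr_pdivrMr.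
have hr : w (x - n%:R * x0) <= M by apply: hM; rewrite ger0_norm.
have e1 : 0 <= e * (x - n%:R * x0) by rewrite mulr_ge0// ltW.
(* The quotient 0 is treated apart: [w 0] may exceed 1, so the bound by powers only starts at
   exponent 1. *)
case En : n => [|k].
  move: hr; rewrite En mul0r subr0 => h; apply: le_trans h _.
  by rewrite ler_peMr ?(le_trans ler01)// -expR0 ler_expR mulr_ge0// ltW.
have := wM (x - n%:R * x0) (n%:R * x0); rewrite subrK => /le_trans; apply.
rewrite ler_pM ?(le_trans ler01)//.
rewrite {1}En; apply: le_trans (weight_pow x0 k hw) _; rewrite -En.
apply: (@le_trans _ _ (expR (e * x0) ^+ n)).
  by apply: lerXn2r => //; rewrite nnegrE ?expR_ge0// (le_trans ler01).
rewrite -expRM_natl ler_expR; nra.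
Qed.

Lemma weight_opp w : weight w -> weight (fun x => w (- x)).
Proof.
move=> [mw w1 wM]; split => // [|x y]; last by rewrite opprD.
have -> : (fun x => w (- x)) = (fun x => w (0 - x)) by apply/funext => x; rewrite sub0r.
exact: (measurableT_comp mw (measurable_reflect 0)).
Qed.

Lemma ln_powR_inv w (x : R) : weight w -> ln (w x `^ x^-1) = x^-1 * ln (w x).
Proof. by move=> [_ w1 _]; rewrite ln_powR. Qed.

(** Were [w x > expR (e * x)] for all positive x, [rho2] would be at least e; so one good point
    exists on the right, and likewise on the left by [rho1]. Each governs its half-line, the left
    one through the reflected weight. *)
Lemma admissible_growth w (e : R) : weight w -> admissible w -> 0 < e ->
  exists C, forall x, w x <= C * expR (e * `|x|).
Proof.
move=> hw [h1 h2] e0; have [_ w1 wM] := hw.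
have lnw x : 0 <= ln (w x) by exact: ln_ge0.
have wp x : 0 < w x by exact: lt_le_trans ltr01 (w1 x).
have [x1 x10 hx1] : exists2 x, 0 < x & w x <= expR (e * x).
  apply: contrapT => H.
  have : e <= rho2 w.
    apply: lb_le_inf; first by exists (ln (w 1 `^ 1^-1)); exists 1 => //=.
    move=> _ [x /= x0 <-]; rewrite ln_powR_inv// mulrC ler_pdivlMr//.
    rewrite -ler_expR lnK ?posrE// ltW// ltNge; apply/negP => h; apply: H; by exists x.
  by rewrite h2 leNgt e0.
have [x2 x20 hx2] : exists2 x, 0 < x & w (- x) <= expR (e * x).
  apply: contrapT => H.
  have : rho1 w <= - e.
    apply: ge_sup; first by exists (ln (w (-1) `^ (-1)^-1)); exists (-1) => //=; rewrite ltrN10.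
    move=> _ [x /= x0 <-]; rewrite ln_powR_inv// mulrC -lerN2 opprK -mulrN -invrN.
    rewrite ler_pdivlMr ?oppr_gt0//.
    rewrite -ler_expR lnK ?posrE// ltW// ltNge; apply/negP => h; apply: H.
    by exists (- x); rewrite ?oppr_gt0// opprK.
  by rewrite h1 oppr_ge0 leNgt e0.
have [C1 C11 hC1] := half_line_growth hw x10 hx1 e0.
have [C2 C21 hC2] := half_line_growth (weight_opp hw) x20 hx2 e0.
exists (C1 + C2) => x; have E0 := expR_ge0 (e * `|x|).
have [x0|x0] := leP 0 x.
  rewrite (ger0_norm x0) in E0 *; apply: le_trans (hC1 x x0) _.
  by rewrite ler_wpM2r// lerDl; lra.
rewrite (ltr0_norm x0) in E0 *; have := hC2 (- x); rewrite opprK oppr_ge0 (ltW x0) => /(_ isT).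
by move/le_trans; apply; rewrite ler_wpM2r// lerDr; lra.
Qed.

End Admissible.

(** * Inverses in weighted algebras *)

Section WeightedInverse.
Variables (R : realType) (A : unitalBanachAlgType R[i]).
Local Notation RM := (measurableTypeR R).
Local Notation mu := (@lebesgue_measure R).
Local Notation L := (L1 A).
Local Notation "x ** y" := (l1mul x y) (at level 40, left associativity).
Implicit Types (f g h x y : L) (w : R -> R).

Lemma nrm_bounded w C x : weight w -> (forall t, w t <= C) -> (nrm w x < +oo)%E.
Proof.
move=> hw hC; have [mx xi] := L1P x; have [mw w1 _] := hw.
have C0 : 0 <= C by apply: le_trans (hC 0); exact: le_trans ler01 (w1 0).
rewrite nrmE; apply: (@le_lt_trans _ _ (\int[mu]_t (C%:E * (rnorm (x t))%:E))%E).
  apply: ge0_le_integral => //.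
  - by move=> t _; rewrite lee_fin mulr_ge0 ?rnorm_ge0 ?weight_ge0.
  - exact: measurable_wnorm.
  - by apply: measurable_funeM; exact: measurable_rnormE.
  - by move=> t _; rewrite -EFinM lee_fin mulrC ler_wpM2r ?rnorm_ge0.
rewrite ge0_integralZl_EFin//; last 2 first.
- by move=> t _; rewrite lee_fin rnorm_ge0.
- exact: measurable_rnormE.
exact: lte_mul_pinfty.
Qed.

Lemma nrm_mono w w' x : weight w -> weight w' -> (forall t, w t <= w' t) ->
  (nrm w x <= nrm w' x)%E.
Proof. by move=> hw hw' h; rewrite !nrmE; apply: wnorm_mono => //; case: (L1P x). Qed.

Lemma nu_small w x : weight w -> (nrm w x < +oo)%E -> l1norm x < 1 ->
  exists2 e0, 0 < e0 & forall e, 0 <= e < e0 -> (nrm (nu w e) x < 1)%E.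
Proof.
move=> hw xw x1; have [mx xi] := L1P x; have [mw w1 _] := hw.
have mr : measurable_fun [set: RM] (fun t => rnorm (x t)) by exact: measurable_rnorm.
(* The absolute value extends the parameter to both sides of 0, as [dominated_param] requires. *)
pose g (p : R) (t : RM) : R := rnorm (x t) * (nu w `|p| t - 1).
have mg p : measurable_fun [set: RM] (g p).
  apply: measurable_funM => //; apply: measurable_funB => //.
  by have [] := weight_nu hw (normr_ge0 p).
have g0 p t : 0 <= g p t by rewrite mulr_ge0 ?rnorm_ge0// subr_ge0 nu_ge1.
have [] := @dominated_param R g (fun t => rnorm (x t) * w t) mg _ _ _ _ (1 - l1norm x).
- exact: measurable_funM.
- move=> p t _; rewrite g0 ler_wpM2l ?rnorm_ge0//.
  have := @nu_le_w R w hw `|p| t (normr_ge0 p); lra.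
- by rewrite nrmE in xw.
- move=> t; rewrite -[X in _ --> X](mulr0 (rnorm (x t))); apply: cvgM; first exact: cvg_cst.
  have ce : expR (`|p| * `|t|) - 1 @[p --> (0 : R)] --> expR (`|(0 : R)| * `|t|) - 1.
    apply: cvgB; last exact: cvg_cst.
    apply: (@continuous_comp _ _ _ (fun p : R => `|p| * `|t|) expR); last exact: continuous_expR.
    by apply: cvgM; [exact: cvg_norm|exact: cvg_cst].
  rewrite normr0 mul0r expR0 subrr in ce.
  apply: (squeeze_cvgr _ (cvg_cst (0 : R)) ce); apply: nearW => p.
  by rewrite subr_ge0 nu_ge1//= lerB// nu_le_exp.
- by rewrite subr_gt0.
move=> e0 e00 he; exists e0 => // e /andP[ep ee].
have := he e; rewrite ger0_norm// => /(_ ee) hlt.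
have -> : nrm (nu w e) x = ((l1norm x)%:E + \int[mu]_t (g e t)%:E)%E.
  rewrite l1normE !nrmE /wnorm -ge0_integralD//.
  - apply: eq_integral => t _; rewrite -EFinD /g (ger0_norm ep); congr EFin; ring.
  - by move=> t _; rewrite lee_fin mulr1 rnorm_ge0.
  - by apply/measurable_EFinP; under eq_fun do rewrite mulr1.
  - by move=> t _; rewrite lee_fin.
  - exact/measurable_EFinP.
have -> : (1 = (l1norm x)%:E + (1 - l1norm x)%:E)%E by rewrite -EFinD addrC subrK.
by rewrite lteD2lE.
Qed.

Lemma weighted_dense w g (e : R) : weight w -> 0 < e ->
  exists2 y, (nrm w y < +oo)%E & l1norm (y - g) < e.
Proof.
move=> hw e0; have [mg gi] := L1P g; have [mw w1 _] := hw.
pose u (n : nat) (t : R) : A := if w t <= n%:R then g t else 0.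
have mb n : measurable ([set t | w t <= n%:R] : set RM).
  have -> : [set t | w t <= n%:R] = w @^-1` `]-oo, n%:R]%classic.
    by apply/seteqP; split => t /=; rewrite in_itv.
  by rewrite -[X in measurable X]setTI; apply: mw => //; exact: measurable_itv.
have mu_ n : strongly_measurable (u n).
  by apply: strongly_measurable_if => //; exact: strongly_measurable_cst.
have Lu n : in_L1 (u n).
  split => //; apply: le_lt_trans gi; apply: inorm_le => //; first exact: measurable_rnormE.
  by move=> t; rewrite lee_fin /u; case: ifP => // _; rewrite rnorm0 rnorm_ge0.
have uw n : (nrm w (cls (u n)) < +oo)%E.
  rewrite nrm_cls//; apply: (@le_lt_trans _ _ (\int[mu]_t (n%:R%:E * (rnorm (g t))%:E))%E).
    apply: ge0_le_integral => //.
    - by move=> t _; rewrite lee_fin mulr_ge0 ?rnorm_ge0 ?weight_ge0.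
    - exact: measurable_wnorm.
    - by apply: measurable_funeM; exact: measurable_rnormE.
    - move=> t _; rewrite -EFinM lee_fin /u; case: ifP => [h|_].
        by rewrite mulrC ler_wpM2r ?rnorm_ge0.
      by rewrite rnorm0 mul0r mulr_ge0 ?rnorm_ge0.
  rewrite ge0_integralZl_EFin//; last 2 first.
  - by move=> t _; rewrite lee_fin rnorm_ge0.
  - exact: measurable_rnormE.
  exact: lte_mul_pinfty.
have D : (\int[mu]_t (rnorm (u n t - g t))%:E)%E @[n --> \oo] --> 0%E.
  apply: (dominated_cvg0 (g := fun n t => rnorm (u n t - g t)) (G := fun t => rnorm (g t))) => //.
  - by move=> n; apply: measurable_rnorm; exact: strongly_measurableB.
  - exact: measurable_rnorm.
  - move=> n t; rewrite rnorm_ge0 /= /u; case: ifP => _; last by rewrite sub0r rnormN.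
    by rewrite subrr rnorm0 rnorm_ge0.
  - move=> t; apply: (@cvg_near_cst _ _ (0 : R)).
    exists (Num.bound (w t)) => // n /= hn; rewrite /u ifT ?subrr ?rnorm0//.
    apply: (@le_trans _ _ (Num.bound (w t))%:R); last by rewrite ler_nat.
    by rewrite ltW// archi_boundP// (le_trans ler01).
have := D => /fine_cvgP[hf /cvgr0Pnorm_lt/(_ e e0) he].
have [N _ /(_ N (leqnn N)) [/= h1 h2]] := filterI hf he.
exists (cls (u N)) => //.
have -> : cls (u N) - g = cls (fun t => u N t - g t) by rewrite clsB ?clsK//; exact: L1P.
rewrite -lte_fin l1norm_cls; last by apply: in_L1B => //; exact: L1P.
have i0 : 0 <= fine (\int[mu]_t (rnorm (u N t - g t))%:E)%E.
  by rewrite fine_ge0//; apply: integral_ge0 => t _; rewrite lee_fin rnorm_ge0.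
by move: h2; rewrite /= ger0_norm// -lte_fin fineK.
Qed.

Lemma weighted_inverse w f : weight w -> (nrm w f < +oo)%E -> (forall y, solvable f y) ->
  exists2 e0, 0 < e0 & forall e, 0 <= e < e0 ->
    exists2 g, (nrm (nu w e) g < +oo)%E & g + f + g ** f = 0.
Proof.
move=> hw fw /(_ (- f))[g0 hg0].
have F0 : 0 < 1 + l1norm f by rewrite ltr_pwDl// l1norm_ge0.
have [y yw hy] := weighted_dense g0 hw (divr_gt0 (@ltr01 R) F0).
pose h := y + f + y ** f.
(* As [(1 + g0)(1 + f) = 1], h equals [(y - g0)(1 + f)]; hence the precision [1 / (1 + l1norm f)]
   demanded of y. *)
have hE : h = (y - g0) + (y - g0) ** f.
  rewrite l1mulBl /h addrACA -opprD hg0 opprK -!addrA; congr (_ + _).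
  by rewrite addrC.
have h1 : l1norm h < 1.
  rewrite hE; apply: le_lt_trans (l1normD _ _) _.
  apply: (@le_lt_trans _ _ (l1norm (y - g0) * (1 + l1norm f))).
    by rewrite mulrDr mulr1 lerD2l l1normM.
  by rewrite -ltr_pdivlMr.
have hwf : (nrm w h < +oo)%E.
  apply: le_lt_trans (nrmD _ _ hw) _; apply: lte_add_pinfty.
    by apply: le_lt_trans (nrmD _ _ hw) _; exact: lte_add_pinfty.
  apply: le_lt_trans (nrmM _ _ hw) _; apply: lte_mul_pinfty => //; first exact: nrm_ge0.
  by rewrite ge0_fin_numE// nrm_ge0.
have [e0 e00 he] := nu_small hw hwf h1.
exists e0 => // e /andP[ep ee]; have hn := weight_nu hw ep.
have nuw x : (nrm w x < +oo)%E -> (nrm (nu w e) x < +oo)%E.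
  by apply: le_lt_trans; apply: nrm_mono => // t; exact: nu_le_w.
have hlt : (nrm (nu w e) h < 1)%E by apply: he; rewrite ep.
have hnn : (nrm (nu w e) (- h)%R < +oo)%E by rewrite nrmN//; exact: nuw.
have [u [uw hu]] := l1_neumann hn hlt hnn.
(* This is the product [(1 + u)(1 + y)] without its unit, where [(1 + u)(1 + h) = 1]. *)
exists (u + y + u ** y).
  apply: le_lt_trans (nrmD _ _ hn) _; apply: lte_add_pinfty.
    by apply: le_lt_trans (nrmD _ _ hn) _; apply: lte_add_pinfty => //; exact: nuw.
  apply: le_lt_trans (nrmM _ _ hn) _; apply: lte_mul_pinfty.
  - exact: nrm_ge0.
  - by rewrite ge0_fin_numE// nrm_ge0.
  - exact: nuw.
have -> : u + y + u ** y + f + (u + y + u ** y) ** f = (u + u ** h) + h.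
  rewrite /h !l1mulDr !l1mulDl l1mulA.
  exact: (@GRing.add L).[AC (4*3) (1*(3*5*7)*(2*4*6))].
by rewrite hu addNr.
Qed.

Lemma fourier_cls (f : R -> A) t : in_L1 f -> fourier (cls f) t = fourier f t.
Proof.
move=> Lf; apply: bochner_integralE.
have Lm := in_L1_modf t Lf.
apply: (ae_is_bochner (is_bochner_bochner Lm.1 Lm.2)).
  by case: (in_L1_modf t (L1P (cls f))).
by apply: ae_imply (clsE Lf) => s; rewrite /modf => ->.
Qed.

Lemma l1mul_inverse_unique f g h : g + f + g ** f = 0 -> h + f + f ** h = 0 -> g = h.
Proof.
move=> hg hh.
transitivity (g + (h + f + f ** h) + g ** (h + f + f ** h)).
  by rewrite hh l1mul0r !addr0.
transitivity (g + f + g ** f + h + (g + f + g ** f) ** h).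
  rewrite !l1mulDr !l1mulDl l1mulA; apply/esym.
  exact: (@GRing.add L).[AC (4*3) (1*(4*2*6)*(5*3*7))].
by rewrite hg l1mul0l add0r addr0.
Qed.

End WeightedInverse.

(** * The opposite algebra *)

Section OppositeAlgebra.
Variables (R : realType) (A : unitalBanachAlgType R[i]).

Definition opposite : Type := A.
HB.instance Definition _ := CompleteNormedModule.on opposite.

Definition opp_bmul (x y : opposite) : opposite := @bmul R[i] A y x.

Lemma opp_bmulA : associative opp_bmul.
Proof. by move=> x y z; rewrite /opp_bmul bmulA. Qed.

Lemma opp_bmul1l : left_id (@bone R[i] A : opposite) opp_bmul.
Proof. by move=> x; exact: bmul1r. Qed.

Lemma opp_bmul1r : right_id (@bone R[i] A : opposite) opp_bmul.
Proof. by move=> x; exact: bmul1l. Qed.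

Lemma opp_bmulDl : left_distributive opp_bmul +%R.
Proof. by move=> x y z; exact: bmulDr. Qed.

Lemma opp_bmulDr : right_distributive opp_bmul +%R.
Proof. by move=> x y z; exact: bmulDl. Qed.

Lemma opp_bscalerAl (c : R[i]) (x y : opposite) : c *: opp_bmul x y = opp_bmul (c *: x) y.
Proof. exact: bscalerAr. Qed.

Lemma opp_bscalerAr (c : R[i]) (x y : opposite) : c *: opp_bmul x y = opp_bmul x (c *: y).
Proof. exact: bscalerAl. Qed.

Lemma ler_norm_opp_bmul (x y : opposite) : `|opp_bmul x y| <= `|x| * `|y|.
Proof. by rewrite mulrC; exact: ler_norm_bmul. Qed.

HB.instance Definition _ := isUnitalBanachAlgebra.Build R[i] opposite opp_bmulA
  opp_bmul1l opp_bmul1r opp_bmulDl opp_bmulDr opp_bscalerAl opp_bscalerAr ler_norm_opp_bmul.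

Lemma convolution_opposite (f g : R -> A) x :
  convolution (f : R -> opposite) g x = convolution g f x.
Proof.
rewrite /convolution -[RHS](bochner_integral_reflect _ x); congr bochner_integral.
by apply/funext => t; rewrite opprB addrCA subrr addr0.
Qed.

End OppositeAlgebra.

(** * One-sided inverses for the regularized weight *)

Section WeightedWiener.
Variable R : realType.
Local Notation mu := (@lebesgue_measure R).
Implicit Types w : R -> R.

(** For a bounded w that is not constant, [nu w e] may be constant, as when w is 1 on the rationals
    and 2 elsewhere. But then L^1(w) consists of the same functions as L^1, and w needs no
    regularization. *)
Definition regularized w (e : R) : R -> R :=
  if `[< bounded_weight w >] then w else nu w e.

Lemma weight_regularized w e : weight w -> 0 <= e -> weight (regularized w e).
Proof. by move=> hw e0; rewrite /regularized; case: ifP => // _; exact: weight_nu. Qed.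

Lemma regularized_le w e x : weight w -> 0 <= e -> regularized w e x <= w x.
Proof. by move=> hw e0; rewrite /regularized; case: ifP => // _; exact: nu_le_w. Qed.

Lemma constant_regularized w e : weight w -> 0 < e ->
  constant_fun (regularized w e) <-> constant_fun w.
Proof.
move=> hw e0; rewrite /regularized; case: ifP => // /negbT/asboolPn wb.
split => [/(nu_nonconstant hw e0 wb)//|[c hc]].
by exfalso; apply: wb; exists c => x; rewrite hc.
Qed.

Variable A : unitalBanachAlgType R[i].
Local Notation L := (L1 A).
Local Notation "x ** y" := (l1mul x y) (at level 40, left associativity).
Implicit Types f g : R -> A.

Lemma weighted_L1_mono w w' C f : weight w -> weight w' -> (forall x, w x <= C * w' x) ->
  weighted_L1 w' f -> weighted_L1 w f.
Proof.
move=> hw hw' hC [mf fi]; split => //; have [mw _ _] := hw; have [mw' w1' _] := hw'.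
have C0 : 0 <= C.
  have := le_trans (weight_ge0 0 hw) (hC 0).
  by rewrite pmulr_lge0//; exact: lt_le_trans ltr01 (w1' 0).
apply: (@le_lt_trans _ _ (\int[mu]_x (C%:E * (rnorm (f x) * w' x)%:E))%E).
  apply: ge0_le_integral => //.
  - by move=> x _; rewrite lee_fin mulr_ge0 ?rnorm_ge0 ?weight_ge0.
  - exact: measurable_wnorm.
  - by apply: measurable_funeM; exact: measurable_wnorm.
  - by move=> x _; rewrite -EFinM lee_fin mulrCA ler_wpM2l ?rnorm_ge0.
rewrite ge0_integralZl_EFin//; last 2 first.
- by move=> x _; rewrite lee_fin mulr_ge0 ?rnorm_ge0 ?weight_ge0.
- exact: measurable_wnorm.
exact: lte_mul_pinfty.
Qed.

Lemma weighted_in_L1 w f : weight w -> weighted_L1 w f -> in_L1 f.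
Proof.
move=> hw [mf fi]; split => //; rewrite -wnorm1; apply: le_lt_trans fi.
by apply: wnorm_mono => //; [exact: weight1|case: hw].
Qed.

(** The two factors are kept apart from the two summands, so that one statement serves both orders
    of multiplication. *)
Lemma cls_inverseP f g a b : in_L1 f -> in_L1 g -> in_L1 a -> in_L1 b ->
  ae_equal (fun x => g x + f x + convolution a b x) (fun=> 0) <->
  cls g + cls f + cls a ** cls b = 0.
Proof.
move=> Lf Lg La Lb; have Lt := in_L1_tconv La Lb.
have Lgf := in_L1D Lg Lf; have Ls := in_L1D Lgf Lt.
rewrite (l1mul_cls La Lb) -(clsD Lg Lf) -(clsD Lgf Lt).
have ht := tconv_ae La Lb.
split => h.
  rewrite -cls0; apply: (cls_eq Ls (in_L10 A)).
  by apply: ae_equal_trans _ h; apply: ae_imply ht => x ->.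
have h' := clsP Ls (in_L10 A); rewrite cls0 in h'.
by apply: ae_equal_trans _ (h' h); apply: ae_imply (ae_equal_sym ht) => x ->.
Qed.

Definition left_solution w f g : Prop := weighted_L1 w g /\
  ae_equal (fun x => g x + f x + convolution g f x) (fun=> 0).

(** The conclusion holds for all small e, not for one: the two-sided case needs a left and a right
    inverse over the same weight. *)
Lemma left_weighted w f : weight w -> weighted_L1 w f ->
  (forall t, invertible_in LeftInv (bone + fourier f t)) ->
  exists2 e0, 0 < e0 & forall e, 0 < e < e0 -> exists g, left_solution (regularized w e) f g.
Proof.
move=> hw hf hinv; have Lf := weighted_in_L1 hw hf.
have hW : forall y : L, solvable (cls f) y.
  by apply: wiener_L1 => t; rewrite fourier_cls//; exact: hinv.
have sol (v : R -> R) (g : L) : weight v -> (nrm v g < +oo)%E -> g + cls f + g ** cls f = 0 ->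
    left_solution v f g.
  move=> hv gv hg; split; first by split; [case: (L1P g)|rewrite nrmE in gv].
  by apply/cls_inverseP => //; rewrite ?clsK//; exact: L1P.
have fw : (nrm w (cls f) < +oo)%E by rewrite nrm_cls//; case: hf.
have [wb|wb] := pselect (bounded_weight w).
  have [C hC] := wb; exists 1 => // e _; rewrite /regularized asboolT//; have [g hg] := hW (- cls f).
  exists g; apply: sol => //; first exact: nrm_bounded hC.
  by rewrite addrAC hg addNr.
have [e0 e00 he] := weighted_inverse hw fw hW.
exists e0 => // e /andP[ep ee]; have [|g gw hg] := he e.
  by rewrite (ltW ep).
by exists g; rewrite /regularized asboolF//; apply: sol => //; apply: weight_nu => //; exact: ltW.
Qed.

End WeightedWiener.

Section Unitization.
Variables (R : realType) (A : unitalBanachAlgType R[i]).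
Implicit Types (f g : R -> A) (w : R -> R).

Definition right_solution w f g : Prop := weighted_L1 w g /\
  ae_equal (fun x => g x + f x + convolution f g x) (fun=> 0).

Lemma right_weighted w f : weight w -> weighted_L1 w f ->
  (forall t, invertible_in RightInv (bone + fourier f t)) ->
  exists2 e0, 0 < e0 & forall e, 0 < e < e0 -> exists g, right_solution (regularized w e) f g.
Proof.
move=> hw hf hinv.
have hf' : weighted_L1 w (f : R -> opposite A) by exact: hf.
have hinv' t : invertible_in LeftInv ((bone : opposite A) + fourier (f : R -> opposite A) t).
  by have [b hb] := hinv t; exists b; exact: hb.
have [e0 e00 he] := left_weighted hw hf' hinv'.
exists e0; first exact: e00.
move=> e hee; have [g [gw hg]] := he e hee.
exists g; split; first exact: gw.
by apply: ae_imply hg => x h0; rewrite -(@convolution_opposite R A g f x); exact: h0.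
Qed.

Lemma left_right_unique w v f g h : weight w -> weight v -> in_L1 f ->
  left_solution w f g -> right_solution v f h -> ae_equal g h.
Proof.
move=> hw hv Lf [gw hg] [hvv hh].
have Lg := weighted_in_L1 hw gw; have Lh := weighted_in_L1 hv hvv.
apply: (clsP Lg Lh); apply: (@l1mul_inverse_unique _ _ (cls f)).
- exact: (cls_inverseP Lf Lg Lg Lf).1 hg.
- exact: (cls_inverseP Lf Lh Lf Lh).1 hh.
Qed.

Lemma one_plusM f g : unitization_eq (unitization_mul (one_plus f) (one_plus g)) (unitization_one A) <->
  ae_equal (fun x => g x + f x + convolution f g x) (fun=> 0).
Proof.
have E x : 1 *: g x + 1 *: f x + convolution f g x = g x + f x + convolution f g x.
  by rewrite !scale1r.
rewrite /unitization_eq /= mulr1; split => [[_ h]|h]; last split => //.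
  by apply: ae_imply h => x; rewrite E.
by apply: ae_imply h => x; rewrite E.
Qed.

Lemma regularized_inverse w f k : weight w -> weighted_L1 w f ->
  (forall t, invertible_in k (bone + fourier f t)) ->
  exists2 e0, 0 < e0 & forall e, 0 < e < e0 -> exists2 g, weighted_L1 (regularized w e) g &
    is_inverse k (@unitization_eq R A) (@unitization_mul R A) (unitization_one A)
      (one_plus g) (one_plus f).
Proof.
move=> hw hf; have Lf := weighted_in_L1 hw hf.
have commE g : ae_equal (fun x => f x + g x + convolution g f x) (fun=> 0) <->
    ae_equal (fun x => g x + f x + convolution g f x) (fun=> 0).
  by split; apply: ae_imply => x; rewrite [f x + _]addrC.
case: k => hinv.
- have [e0 e00 he] := left_weighted hw hf hinv.
  exists e0; first exact: e00.
  move=> e hee; have [g [gw hg]] := he e hee; exists g; first exact: gw.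
  by apply/one_plusM; apply/commE.
- have [e0 e00 he] := right_weighted hw hf hinv.
  exists e0; first exact: e00.
  move=> e hee; have [g [gw hg]] := he e hee; exists g; first exact: gw.
  by apply/one_plusM.
have hl t : invertible_in LeftInv (bone + fourier f t).
  by have [b [b1 _]] := hinv t; exists b.
have hr t : invertible_in RightInv (bone + fourier f t).
  by have [b [_ b2]] := hinv t; exists b.
have [e1 e10 h1] := left_weighted hw hf hl.
have [e2 e20 h2] := right_weighted hw hf hr.
(* Below both thresholds, a left inverse and a right inverse exist over the same weight; they agree
   almost everywhere, so the left one is two-sided. *)
exists (Num.min e1 e2); first by rewrite lt_min e10.
move=> e /andP[ep]; rewrite lt_min => /andP[ee1 ee2].
have [|g hg] := h1 e; first by rewrite ep.
have [|h hh] := h2 e; first by rewrite ep.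
have hv := weight_regularized hw (ltW ep).
have gh := left_right_unique hv hv Lf hg hh.
have Lg := weighted_in_L1 hv hg.1; have Lh := weighted_in_L1 hv hh.1.
exists g; first by case: hg.
split; first by apply/one_plusM; apply/commE; case: hg.
apply/one_plusM; apply: ((cls_inverseP Lf Lg Lf Lg).2 _).
rewrite (cls_eq Lg Lh gh).
exact: (cls_inverseP Lf Lh Lf Lh).1 hh.2.
Qed.

End Unitization.

Theorem theorem3 (R : realType) (A : unitalBanachAlgType R[i]) (w : R -> R)
    (hw : weight w) (f : R -> A) (hf : weighted_L1 w f) (k : inverse_kind)
    (hinv : forall t : R, invertible_in k (bone + fourier f t)) :
  (exists (nu : R -> R) (g : R -> A),
     [/\ weight nu,
         weighted_L1 nu g,
         forall x, 1 <= nu x <= w x,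
         constant_fun nu <-> constant_fun w
       & inverse_in_unitization nu k (one_plus g) (one_plus f)]) /\
  (admissible w -> invertible_in_unitization w k (one_plus f)).
Proof.
have [e0 e00 he] := regularized_inverse hw hf hinv.
pose e := e0 / 2; have ep : 0 < e by rewrite divr_gt0.
have [|g gw hg] := he e; first by rewrite ep /e; lra.
have hv := weight_regularized hw (ltW ep).
split.
  exists (regularized w e), g; split => //.
  - by move=> x; rewrite regularized_le ?(ltW ep)// andbT; case: hv.
  - exact: constant_regularized.
  split => //; apply: (weighted_L1_mono (C := 1) hv hw) hf => x.
  by rewrite mul1r regularized_le// ltW.
move=> hadm; exists (one_plus g); split => //.
(* The weight w is bounded by a multiple of the new weight, so the inverse already found lies in
   L^1(w). *)
have [C hC] : exists C, forall x, w x <= C * regularized w e x.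
  rewrite /regularized; case: ifP => _; first by exists 1 => x; rewrite mul1r.
  by have [C hC] := admissible_growth hw hadm ep; exists C; exact: le_nu_exp.
exact: weighted_L1_mono hw hv hC gw.
Qed.
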